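(* Let $q\ge0$ be an integer and let $J_q$ be the Bessel function of the first kind of order $q$. Let $0<z_1<z_2<\cdots$ be the positive zeros of $J_q$ and $z_{-k}=-z_k$ for $k\ge1$. Then for every $z\in\mathbb{C}$ with $J_q(z)\neq0$, $$J_q(z)=\frac{A^{(0,num)}(z)+\sum_{k=-\infty,\,k\ne0}^{\infty}\frac{a_{-1}^{(k,num)}}{z-z_k}}{1+A^{(0,den)}(z)+\sum_{k=-\infty,\,k\ne0}^{\infty}\left(\frac{a_{-2}^{(k,den)}}{(z-z_k)^2}+\frac{a_{-1}^{(k,den)}}{z-z_k}\right)},$$ where for $k\ne0$ $$a_{-1}^{(k,num)}=\frac{1}{J_q^{(1)}(z_k)},\qquad a_{-2}^{(k,den)}=\frac{1}{(J_q^{(1)}(z_k))^2},\qquad a_{-1}^{(k,den)}=-\frac{J_q^{(2)}(z_k)}{(J_q^{(1)}(z_k))^3},$$ and $$A^{(0,num)}(z)=\begin{cases}0, & q=0,\\ \sum_{n=1}^{q}\frac{a_{-n}^{(0,num)}}{z^n}, & q\ge1,\end{cases}\qquad A^{(0,den)}(z)=\begin{cases}0, & q=0,\\ \sum_{n=1}^{2q}\frac{a_{-n}^{(0,den)}}{z^n}, & q\ge1,\end{cases}$$ with $a_{-n}^{(0,num)}$ and $a_{-n}^{(0,den)}$ the coefficients of $z^{-n}$ in the Laurent expansions about $z=0$ of $1/J_q(z)$ and $1/(J_q(z))^2$ respectively.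
   Context: $J_q^{(n)}$ denotes the $n$th derivative of $J_q$. Bi-infinite sums are understood as limits of symmetric partial sums, $\sum_{k=-\infty,k\neq0}^\infty=\lim_{N\to\infty}\sum_{1\le|k|\le N}$. *)

(* Defs.v *)
From Stdlib Require Export Reals ZArith.
From Coquelicot Require Export Coquelicot.

Open Scope C_scope.

(* [iota P] is the unique [x] satisfying [P] when there is exactly one; here,
   the sum of the (everywhere convergent) power series
   J_q(z) = sum_m (-1)^m / (m! (m+q)!) (z/2)^(2m+q). *)
Definition besselJ (q : nat) (z : C) : C :=
  iota (T := C_CompleteNormedModule)
    (is_series (K := C_AbsRing) (V := C_NormedModule)
       (fun m : nat =>
          RtoC ((-1) ^ m / (INR (fact m) * INR (fact (m + q))))%R
          * (z / 2) ^ (2 * m + q))).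

(* Iterated complex derivative.  The library's [C_derive] takes the limit of
   the difference quotient along real increments, which is the complex
   derivative wherever the latter exists ([is_C_derive_unique]). *)
Definition C_derive_n (n : nat) (f : C -> C) : C -> C := Nat.iter n C_derive f.

(* [f] has the (two-sided) Laurent expansion sum_{n in Z} c_n (z - z0)^n on
   some punctured disc about [z0]. *)
Definition is_laurent (f : C -> C) (z0 : C) (c : Z -> C) : Prop :=
  exists r : R, (0 < r)%R /\
  forall z : C, (0 < Cmod (z - z0) < r)%R ->
  exists sreg sprinc : C,
    is_series (K := C_AbsRing) (V := C_NormedModule)
      (fun n : nat => c (Z.of_nat n) * (z - z0) ^ n) sreg /\
    is_series (K := C_AbsRing) (V := C_NormedModule)
      (fun n : nat => c (- Z.of_nat (S n))%Z / (z - z0) ^ (S n)) sprinc /\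
    f z = sreg + sprinc.

Definition laurent_coef (f : C -> C) (z0 : C) (n : Z) : C :=
  iota (T := C_CompleteNormedModule)
    (fun a : C => exists c : Z -> C, is_laurent f z0 c /\ c n = a).

(* sum_{k in Z, k <> 0} f k = l, as the limit over N of the sums over
   1 <= |k| <= N. *)
Definition is_bisum (f : Z -> C) (l : C) : Prop :=
  filterlim
    (fun N : nat =>
       sum_n_m (G := C_AbelianMonoid)
         (fun k : nat => f (Z.of_nat k) + f (- Z.of_nat k)%Z) 1 N)
    eventually (locally l).

(* 0 < z_1 < z_2 < ... are all the positive zeros of [f], and z_{-k} = - z_k;
   the value [zk 0] is irrelevant. *)
Definition enumerates_zeros (f : C -> C) (zk : Z -> R) : Prop :=
  (forall k : Z, (1 <= k)%Z -> (0 < zk k < zk (k + 1)%Z)%R) /\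
  (forall x : R, (0 < x)%R ->
     (f (RtoC x) = 0 <-> exists k : Z, (1 <= k)%Z /\ x = zk k)) /\
  (forall k : Z, (1 <= k)%Z -> zk (- k)%Z = (- zk k)%R).

Definition num_am1 (q : nat) (zk : Z -> R) (k : Z) : C :=
  1 / C_derive_n 1 (besselJ q) (zk k).

Definition den_am2 (q : nat) (zk : Z -> R) (k : Z) : C :=
  1 / (C_derive_n 1 (besselJ q) (zk k)) ^ 2.

Definition den_am1 (q : nat) (zk : Z -> R) (k : Z) : C :=
  - (C_derive_n 2 (besselJ q) (zk k) / (C_derive_n 1 (besselJ q) (zk k)) ^ 3).

Definition A0num (q : nat) (z : C) : C :=
  match q with
  | O => 0
  | S _ =>
      sum_n_m (G := C_AbelianMonoid)
        (fun n : nat =>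
           laurent_coef (fun w => 1 / besselJ q w) 0 (- Z.of_nat n)%Z / z ^ n)
        1 q
  end.

Definition A0den (q : nat) (z : C) : C :=
  match q with
  | O => 0
  | S _ =>
      sum_n_m (G := C_AbelianMonoid)
        (fun n : nat =>
           laurent_coef (fun w => 1 / (besselJ q w) ^ 2) 0 (- Z.of_nat n)%Z
           / z ^ n)
        1 (2 * q)
  end.

(* Main.v *)
Require Import Defs.
From Stdlib Require Import Lra Lia ClassicalEpsilon.

(* Write [J_q(z) = z^q / (2^q q!) F(z^2)] and let [r_0 < r_1 < ...] be the squares of
   the positive zeros, [s_k = 1 / r_k].

   Product. The Laguerre polynomials [g_n] satisfy a first order recurrence that
   preserves real-rootedness, and [p_n(w) = g_n(w / 4n)] tends to [F]. Since
   [p_n(-x) <= exp (sqrt x)], the reciprocals of the roots of [p_n] are at most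
   [2 / (j + 1)^2]; extracting a diagonal subsequence gives [F(w) = prod (1 - s_k w)].

   Partial fractions. Expand [1 / P_N] and [1 / P_N^2] for the partial products [P_N] and let
   [N] tend to infinity. The residues of [1 / P_N] are those of [1 / F] times the tail
   product [prod_(j >= N) (1 - s_j r_k)], which lies in [0, 1], decreases in [k] and tends to 1
   with [N]. As the residues alternate in sign and, by the monotonicity of
   [(z J')^2 + (z^2 - q^2) J^2] and of an energy of [sqrt z J], decrease to 0 after division by
   the right power of [r_k], the sums converge; those for the square converge absolutely.

   Principal parts at 0. The polynomial terms so obtained are the Taylor coefficients of
   [1 / F] and [1 / F^2], hence the Laurent coefficients of [1 / J_q] and [1 / J_q^2].
   The constant 1 in the denominator is the coefficient of [z^0] in [1 / J_q^2], a
   Wronskian computation. *)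

(** No contour integral occurs: the finite expansions are proved by induction on the number of
    nodes, and Laurent coefficients are shown to be unique by averaging over roots of unity. The
    obstacle is that the residues [1 / pz_e k] may grow with [k], so the expansion of [1 / P_N] has
    no termwise limit. A geometric expansion splits off a polynomial in [w], with [half_up q] terms
    for [1 / F] and [q + 1] for [1 / F^2], and only the remainder is summed. The coefficients of
    that polynomial converge for an indirect reason: polynomials of bounded degree that converge at
    all small real points have convergent coefficients. The remainder of [1 / F] need not converge
    absolutely, so dominated convergence does not cover it; because the tail product decreases in
    [k], each truncated sum is again alternating with decreasing terms. In [1 / F^2] each double
    pole carries a simple pole whose relative coefficient tends to [-(q + 1)]; this is exactly the
    value for which splitting off [q + 1] terms removes the simple poles from the limit. *)

(** * Finite sums and products *)

Fixpoint sumR (f : nat -> R) (n : nat) : R :=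
  match n with O => 0%R | S m => (sumR f m + f m)%R end.
Fixpoint prodR (f : nat -> R) (n : nat) : R :=
  match n with O => 1%R | S m => (prodR f m * f m)%R end.
Fixpoint sumC (f : nat -> C) (n : nat) : C :=
  match n with O => 0 | S m => sumC f m + f m end.
Fixpoint prodC (f : nat -> C) (n : nat) : C :=
  match n with O => 1 | S m => prodC f m * f m end.

Lemma RtoC_neq_0 (x : R) : x <> 0%R -> RtoC x <> 0.
Proof. intros H E; apply H, RtoC_inj, E. Qed.

Lemma sumC_S f n : sumC f (S n) = sumC f n + f n.
Proof. reflexivity. Qed.

Lemma prodC_S f n : prodC f (S n) = prodC f n * f n.
Proof. reflexivity. Qed.

Lemma sumR_S f n : sumR f (S n) = (sumR f n + f n)%R.
Proof. reflexivity. Qed.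

Lemma prodR_S f n : prodR f (S n) = (prodR f n * f n)%R.
Proof. reflexivity. Qed.

Lemma sumC_ext (f g : nat -> C) n :
  (forall k, (k < n)%nat -> f k = g k) -> sumC f n = sumC g n.
Proof. induction n; simpl; intros H; [easy|]. rewrite IHn, H; auto. Qed.

Lemma sumR_ext (f g : nat -> R) n :
  (forall k, (k < n)%nat -> f k = g k) -> sumR f n = sumR g n.
Proof. induction n; simpl; intros H; [easy|]. rewrite IHn, H; auto. Qed.

Lemma prodC_ext (f g : nat -> C) n :
  (forall k, (k < n)%nat -> f k = g k) -> prodC f n = prodC g n.
Proof. induction n; simpl; intros H; [easy|]. rewrite IHn, H; auto. Qed.

Lemma prodR_ext (f g : nat -> R) n :
  (forall k, (k < n)%nat -> f k = g k) -> prodR f n = prodR g n.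
Proof. induction n; simpl; intros H; [easy|]. rewrite IHn, H; auto. Qed.

Lemma sumC_plus f g n : sumC (fun k => f k + g k) n = sumC f n + sumC g n.
Proof. induction n; simpl; [|rewrite IHn]; ring. Qed.

Lemma sumC_minus f g n : sumC (fun k => f k - g k) n = sumC f n - sumC g n.
Proof. induction n; simpl; [|rewrite IHn]; ring. Qed.

Lemma sumC_scal c f n : sumC (fun k => c * f k) n = c * sumC f n.
Proof. induction n; simpl; [|rewrite IHn]; ring. Qed.

Lemma sumC_exchange (f : nat -> nat -> C) (g : nat -> C) n p :
  sumC (fun k => sumC (fun i => f k i * g i) p) n
  = sumC (fun i => sumC (fun k => f k i) n * g i) p.
Proof.
  induction p.
  - simpl. induction n; simpl; [easy|rewrite IHn; ring].
  - rewrite sumC_S, <- IHp, Cmult_comm, <- sumC_scal, <- sumC_plus.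
    apply sumC_ext; intros k _. rewrite sumC_S. ring.
Qed.

Lemma sumR_scal c f n : sumR (fun k => c * f k)%R n = (c * sumR f n)%R.
Proof. induction n; simpl; [|rewrite IHn]; ring. Qed.

Lemma sumR_le (f g : nat -> R) n :
  (forall k, (k < n)%nat -> (f k <= g k)%R) -> (sumR f n <= sumR g n)%R.
Proof.
  induction n; simpl; intros H; [lra|].
  apply Rplus_le_compat; auto.
Qed.

Lemma sumR_nonneg f n :
  (forall k, (k < n)%nat -> (0 <= f k)%R) -> (0 <= sumR f n)%R.
Proof.
  induction n; simpl; intros H; [lra|].
  apply Rplus_le_le_0_compat; auto.
Qed.

Lemma sumC_split f n m :
  sumC f (n + m) = sumC f n + sumC (fun k => f (n + k)%nat) m.
Proof.
  induction m; simpl.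
  - rewrite Nat.add_0_r; ring.
  - rewrite Nat.add_succ_r; simpl; rewrite IHm; ring.
Qed.

Lemma sumR_split f n m :
  sumR f (n + m) = (sumR f n + sumR (fun k => f (n + k)%nat) m)%R.
Proof.
  induction m; simpl.
  - rewrite Nat.add_0_r; ring.
  - rewrite Nat.add_succ_r; simpl; rewrite IHm; ring.
Qed.

Lemma prodR_split f n m :
  prodR f (n + m) = (prodR f n * prodR (fun k => f (n + k)%nat) m)%R.
Proof.
  induction m; simpl.
  - rewrite Nat.add_0_r; ring.
  - rewrite Nat.add_succ_r; simpl; rewrite IHm; ring.
Qed.

Lemma sumC_RtoC f n : sumC (fun k => RtoC (f k)) n = RtoC (sumR f n).
Proof. induction n; simpl; [|rewrite IHn, RtoC_plus]; easy. Qed.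

Lemma prodC_RtoC f n : prodC (fun k => RtoC (f k)) n = RtoC (prodR f n).
Proof. induction n; simpl; [|rewrite IHn, RtoC_mult]; easy. Qed.

Lemma Cmod_sumC (f : nat -> C) n : (Cmod (sumC f n) <= sumR (fun k => Cmod (f k)) n)%R.
Proof.
  induction n; simpl; [rewrite Cmod_0; lra|].
  eapply Rle_trans; [apply Cmod_triangle|lra].
Qed.

Lemma prodC_neq_0 (f : nat -> C) n : (forall k, (k < n)%nat -> f k <> 0) -> prodC f n <> 0.
Proof.
  induction n; simpl; intros H; [apply C1_nz|].
  apply Cmult_neq_0; [apply IHn; intros; apply H|apply H]; lia.
Qed.

Lemma prodR_neq_0 (f : nat -> R) n :
  (forall k, (k < n)%nat -> f k <> 0%R) -> prodR f n <> 0%R.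
Proof.
  induction n; simpl; intros H; [lra|].
  apply Rmult_integral_contrapositive; split; [apply IHn; intros; apply H|apply H]; lia.
Qed.

Lemma prodR_eq_0 f n k : (k < n)%nat -> f k = 0%R -> prodR f n = 0%R.
Proof.
  intros H E; induction n; [lia|]; simpl.
  destruct (Nat.eq_dec k n) as [->|]; [rewrite E|rewrite IHn by lia]; ring.
Qed.

Lemma prodC_eq_0 (f : nat -> C) n k : (k < n)%nat -> f k = 0 -> prodC f n = 0.
Proof.
  intros H E; induction n; [lia|]; simpl.
  destruct (Nat.eq_dec k n) as [->|]; [rewrite E|rewrite IHn by lia]; ring.
Qed.

(** * Limits of complex sequences *)

(** Phrased through real distances so that the squeeze and arithmetic rules for real limits apply;
    [clim_filterlim] links it to the filter form used in the theorem. *)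
Definition clim (u : nat -> C) (l : C) : Prop :=
  is_lim_seq (fun n => Cmod (u n - l)) 0%R.

Lemma clim_filterlim (u : nat -> C) (l : C) : clim u l <-> filterlim u eventually (locally l).
Proof.
  assert (E := filterlim_locally_ball_norm (K := C_AbsRing)
    (U := C_NormedModule) (F := eventually) u l).
  change (filterlim u eventually (locally l) <->
    (forall eps : posreal, eventually (fun n => (Cmod (u n - l) < eps)%R))) in E.
  rewrite E; clear E. unfold clim; rewrite <- is_lim_seq_spec.
  split; intros H eps; destruct (H eps) as [N HN]; exists N; intros n Hn;
    specialize (HN n Hn);
    rewrite Rminus_0_r, Rabs_pos_eq in * by apply Cmod_ge_0; exact HN.
Qed.

Lemma clim_squeeze (u : nat -> C) (l : C) (e : nat -> R) :
  (forall n, (Cmod (u n - l) <= e n)%R) -> is_lim_seq e 0%R -> clim u l.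
Proof.
  intros H He; unfold clim.
  apply is_lim_seq_le_le with (fun _ => 0%R) e; auto using is_lim_seq_const.
  intros n; split; auto using Cmod_ge_0.
Qed.

Lemma clim_ext (u v : nat -> C) (l : C) : (forall n, u n = v n) -> clim u l -> clim v l.
Proof.
  intros H; unfold clim; apply is_lim_seq_ext; intros n; now rewrite H.
Qed.

Lemma clim_ext_loc u v l N :
  (forall n, (N <= n)%nat -> u n = v n) -> clim u l -> clim v l.
Proof.
  intros H; unfold clim; apply is_lim_seq_ext_loc; exists N; intros n Hn.
  now rewrite H.
Qed.

Lemma clim_const l : clim (fun _ => l) l.
Proof.
  apply clim_squeeze with (fun _ => 0%R); auto using is_lim_seq_const.
  intros _; replace (l - l) with (RtoC 0) by ring; rewrite Cmod_0; lra.
Qed.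

Lemma clim_unique (u : nat -> C) (l : C) l' : clim u l -> clim u l' -> l = l'.
Proof.
  intros H H'. apply clim_filterlim in H; apply clim_filterlim in H'.
  exact (filterlim_locally_unique (K := C_AbsRing) (V := C_NormedModule)
           (F := eventually) u l l' H H').
Qed.

Lemma clim_plus (u v : nat -> C) (l m : C) :
  clim u l -> clim v m -> clim (fun n => u n + v n) (l + m).
Proof.
  intros Hu Hv.
  apply clim_squeeze with (fun n => Cmod (u n - l) + Cmod (v n - m))%R.
  - intros n; replace (u n + v n - (l + m)) with ((u n - l) + (v n - m)) by ring.
    apply Cmod_triangle.
  - replace (Finite 0) with (Finite (0 + 0)) by (f_equal; ring).
    now apply is_lim_seq_plus'.
Qed.

Lemma clim_mult (u v : nat -> C) (l m : C) :
  clim u l -> clim v m -> clim (fun n => u n * v n) (l * m).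
Proof.
  intros Hu Hv.
  apply clim_squeeze with (fun n => Cmod (u n - l) * Cmod (v n - m) +
     (Cmod (u n - l) * Cmod m + Cmod l * Cmod (v n - m)))%R.
  - intros n; replace (u n * v n - (l * m)) with
      ((u n - l) * (v n - m) + ((u n - l) * m + l * (v n - m))) by ring.
    rewrite <- !Cmod_mult.
    eapply Rle_trans; [apply Cmod_triangle|].
    apply Rplus_le_compat_l, Cmod_triangle.
  - replace (Finite 0) with (Finite (0 * 0 + (0 * Cmod m + Cmod l * 0)))%R
      by (f_equal; ring).
    apply is_lim_seq_plus'; [|apply is_lim_seq_plus'];
    apply is_lim_seq_mult'; auto using is_lim_seq_const.
Qed.

Lemma clim_scal (c : C) (u : nat -> C) (l : C) : clim u l -> clim (fun n => c * u n) (c * l).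
Proof. intros; apply clim_mult; auto using clim_const. Qed.

Lemma clim_minus (u v : nat -> C) (l m : C) :
  clim u l -> clim v m -> clim (fun n => u n - v n) (l - m).
Proof.
  intros Hu Hv.
  apply clim_ext with (fun n => u n + (-1) * v n); [intros; ring|].
  replace (l - m) with (l + (-1) * m) by ring.
  apply clim_plus; auto using clim_scal.
Qed.

Lemma clim_Cmod (u : nat -> C) (l : C) : clim u l -> is_lim_seq (fun n => Cmod (u n)) (Cmod l).
Proof.
  intros H.
  apply is_lim_seq_le_le with (fun n => Cmod l - Cmod (u n - l))%R
                              (fun n => Cmod l + Cmod (u n - l))%R.
  - intros n; split.
    + assert (Cmod l <= Cmod (u n) + Cmod (- (u n - l)))%R.
      { replace l with (u n + - (u n - l)) at 1 by ring. apply Cmod_triangle. }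
      rewrite Cmod_opp in H0; lra.
    + replace (u n) with (l + (u n - l)) at 1 by ring. apply Cmod_triangle.
  - replace (Finite (Cmod l)) with (Finite (Cmod l - 0)) by (f_equal; ring).
    apply is_lim_seq_minus'; auto using is_lim_seq_const.
  - replace (Finite (Cmod l)) with (Finite (Cmod l + 0)) by (f_equal; ring).
    apply is_lim_seq_plus'; auto using is_lim_seq_const.
Qed.

Lemma clim_Cmod_le (u : nat -> C) (l : C) B :
  clim u l -> (forall n, (Cmod (u n) <= B)%R) -> (Cmod l <= B)%R.
Proof.
  intros H HB. apply clim_Cmod in H.
  exact (is_lim_seq_le _ _ _ _ HB H (is_lim_seq_const B)).
Qed.

Lemma clim_inv (u : nat -> C) (l : C) : l <> 0 -> (forall n, u n <> 0) ->
  clim u l -> clim (fun n => / u n) (/ l).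
Proof.
  intros Hl Hu H. unfold clim.
  apply is_lim_seq_ext with
    (fun n => Cmod (u n - l) * (/ Cmod l * / Cmod (u n)))%R.
  - intros n. rewrite <- !Cmod_inv, <- !Cmod_mult by auto.
    replace (/ u n - / l) with (- ((u n - l) * (/ l * / u n)))
      by (field; auto).
    now rewrite Cmod_opp.
  - assert (Cmod l <> 0)%R by (intros E; apply Hl, Cmod_eq_0, E).
    replace (Finite 0) with (Finite (0 * (/ Cmod l * / Cmod l)))%R
      by (f_equal; ring).
    apply is_lim_seq_mult'; auto.
    apply is_lim_seq_mult'; auto using is_lim_seq_const.
    apply (is_lim_seq_inv _ (Cmod l)); [now apply clim_Cmod|].
    intros E; injection E; auto.
Qed.

Lemma clim_RtoC (u : nat -> R) (l : R) :
  is_lim_seq u l -> clim (fun n => RtoC (u n)) (RtoC l).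
Proof.
  intros H; unfold clim.
  apply is_lim_seq_ext with (fun n => Rabs (u n - l)).
  - intros n; now rewrite <- RtoC_minus, Cmod_R.
  - apply (is_lim_seq_abs_0 (fun n => u n - l)%R).
    replace (Finite 0) with (Finite (l - l)) by (f_equal; ring).
    apply is_lim_seq_minus'; auto using is_lim_seq_const.
Qed.

Lemma clim_RtoC_inv (u : nat -> R) (l : R) :
  clim (fun n => RtoC (u n)) (RtoC l) -> is_lim_seq u l.
Proof.
  intros H.
  assert (H0 : is_lim_seq (fun n => u n - l)%R 0%R).
  { apply is_lim_seq_abs_0. eapply is_lim_seq_ext; [|exact H].
    intros n; simpl; now rewrite <- RtoC_minus, Cmod_R. }
  apply is_lim_seq_ext with (fun n => (u n - l) + l)%R; [intros; ring|].
  replace (Finite l) with (Finite (0 + l)) by (f_equal; ring).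
  apply is_lim_seq_plus'; auto using is_lim_seq_const.
Qed.

Lemma clim_incr_1 u l : clim (fun n => u (S n)) l <-> clim u l.
Proof. unfold clim. symmetry. apply (is_lim_seq_incr_1 (fun n => Cmod (u n - l))). Qed.

Lemma clim_incr_n (u : nat -> C) (l : C) N : clim (fun n => u (n + N)%nat) l <-> clim u l.
Proof. unfold clim. symmetry. apply (is_lim_seq_incr_n (fun n => Cmod (u n - l)) N). Qed.

Lemma clim_sumC (u : nat -> nat -> C) (l : nat -> C) n :
  (forall k, (k < n)%nat -> clim (fun N => u N k) (l k)) ->
  clim (fun N => sumC (u N) n) (sumC l n).
Proof.
  induction n; simpl; intros H; [apply clim_const|].
  apply clim_plus; auto.
Qed.

Lemma clim_prodC (u : nat -> nat -> C) (l : nat -> C) n :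
  (forall k, (k < n)%nat -> clim (fun N => u N k) (l k)) ->
  clim (fun N => prodC (u N) n) (prodC l n).
Proof.
  induction n; simpl; intros H; [apply clim_const|].
  apply clim_mult; auto.
Qed.

Lemma sum_n_sumC (a : nat -> C) n :
  sum_n (G := C_AbelianMonoid) a n = sumC a (S n).
Proof.
  induction n.
  - rewrite sum_O; simpl; ring.
  - rewrite sum_Sn, IHn; reflexivity.
Qed.

Lemma is_series_clim (a : nat -> C) (l : C) :
  is_series (K := C_AbsRing) (V := C_NormedModule) a l <-> clim (sumC a) l.
Proof.
  unfold is_series. rewrite <- clim_incr_1, clim_filterlim.
  split; apply filterlim_ext; intros n; now rewrite sum_n_sumC.
Qed.

Lemma sum_n_sumR (a : nat -> R) n :
  sum_n (G := R_AbelianMonoid) a n = sumR a (S n).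
Proof.
  induction n.
  - rewrite sum_O; simpl; ring.
  - rewrite sum_Sn, IHn; reflexivity.
Qed.

Lemma is_series_sumR (a : nat -> R) (l : R) :
  is_series a l <-> is_lim_seq (sumR a) l.
Proof.
  unfold is_series. rewrite is_lim_seq_incr_1. unfold is_lim_seq.
  split; apply filterlim_ext; intros n; now rewrite sum_n_sumR.
Qed.

Lemma clim_dominated (a : nat -> C) (M : nat -> R) (B : R) :
  (forall k, (Cmod (a k) <= M k)%R) -> (forall n, (sumR M n <= B)%R) ->
  exists l, clim (sumC a) l.
Proof.
  intros Ha HB.
  assert (HM : forall k, (0 <= M k)%R)
    by (intros k; eapply Rle_trans; [apply Cmod_ge_0|apply Ha]).
  assert (ex_series M).
  { destruct (ex_finite_lim_seq_incr (sumR M) B) as [l Hl]; auto.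
    - intros n; simpl; specialize (HM n); lra.
    - exists l; now apply is_series_sumR. }
  destruct (ex_series_le (K := C_AbsRing) (V := C_CompleteNormedModule) a M)
    as [l Hl]; auto.
  exists l; now apply is_series_clim.
Qed.

Lemma bounded_sums_lim (M : nat -> R) (B : R) :
  (forall k, (0 <= M k)%R) -> (forall n, (sumR M n <= B)%R) ->
  exists l : R, is_lim_seq (sumR M) l /\ (forall n, (sumR M n <= l)%R).
Proof.
  intros HM HB.
  assert (Hi : forall n, (sumR M n <= sumR M (S n))%R)
    by (intros n; simpl; specialize (HM n); lra).
  destruct (ex_finite_lim_seq_incr (sumR M) B) as [l Hl]; auto.
  exists l; split; auto.
  intros n. apply (is_lim_seq_incr_compare _ l Hl Hi n).
Qed.

(** Dominated convergence for a triangular array. Beyond an index [K] the tails of the row and of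
    the limit are both below the tail of [M], and before it only finitely many entries have to
    converge. *)
Lemma tannery (b : nat -> nat -> C) (beta : nat -> C) (M : nat -> R) (B : R) :
  (forall N k, (k < N)%nat -> (Cmod (b N k) <= M k)%R) ->
  (forall k, clim (fun N => b N k) (beta k)) ->
  (forall n, (sumR M n <= B)%R) ->
  exists l, clim (sumC beta) l /\ clim (fun N => sumC (b N) N) l.
Proof.
  intros Hb Hl HB.
  assert (HM : forall k, (0 <= M k)%R).
  { intros k; eapply Rle_trans; [|apply (Hb (S k)); lia]. apply Cmod_ge_0. }
  assert (Hbeta : forall k, (Cmod (beta k) <= M k)%R).
  { intros k. specialize (Hl k).
    (* The bound on column [k] is known only in rows [N > k], so the first [S k] rows are dropped
       before passing to the limit. *)
    apply (clim_incr_n _ _ (S k)) in Hl.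
    eapply clim_Cmod_le; [exact Hl|]. intros n; apply Hb; lia. }
  destruct (clim_dominated beta M B) as [l Hs]; auto.
  exists l; split; auto.
  destruct (bounded_sums_lim M B) as [T [HT HT']]; auto.
  apply is_lim_seq_spec; intros eps.
  assert (He : (0 < eps / 4)%R) by (destruct eps as [e He]; simpl; lra).
  apply is_lim_seq_spec in HT. destruct (HT (mkposreal _ He)) as [K HK].
  specialize (HK K (Nat.le_refl K)); simpl in HK.
  assert (Htail : forall N, (K <= N)%nat -> (sumR (fun k => M (K + k)%nat) (N - K) < eps / 4)%R).
  { intros N HN. assert (E := sumR_split M K (N - K)).
    replace (K + (N - K))%nat with N in E by lia.
    specialize (HT' N). apply Rabs_def2 in HK. lra. }
  assert (Hfin : clim (fun N => sumC (b N) K) (sumC beta K))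
    by (apply clim_sumC; auto).
  apply is_lim_seq_spec in Hfin; destruct (Hfin (mkposreal _ He)) as [N1 HN1].
  apply is_lim_seq_spec in Hs; destruct (Hs (mkposreal _ He)) as [N2 HN2].
  exists (K + N1 + N2)%nat; intros N HN.
  specialize (HN1 N ltac:(lia)); specialize (HN2 N ltac:(lia)).
  specialize (Htail N ltac:(lia)).
  simpl in HN1, HN2.
  rewrite Rminus_0_r, Rabs_pos_eq in * by apply Cmod_ge_0.
  assert (Eb := sumC_split (b N) K (N - K)).
  assert (Ebeta := sumC_split beta K (N - K)).
  replace (K + (N - K))%nat with N in * by lia.
  set (x := sumC (fun k => b N (K + k)%nat) (N - K)) in *.
  set (y := sumC (fun k => beta (K + k)%nat) (N - K)) in *.
  assert (Hx : (Cmod x < eps / 4)%R).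
  { eapply Rle_lt_trans; [apply Cmod_sumC|]. eapply Rle_lt_trans; [|exact Htail].
    apply sumR_le; intros k Hk; apply Hb; lia. }
  assert (Hy : (Cmod y < eps / 4)%R).
  { eapply Rle_lt_trans; [apply Cmod_sumC|]. eapply Rle_lt_trans; [|exact Htail].
    apply sumR_le; intros k Hk; apply Hbeta; lia. }
  (* Four errors of at most a quarter of [eps]: the heads, the convergence of the limit series, and
     the two tails [x] and [y]. *)
  replace (sumC (b N) N - l) with
    ((sumC (b N) K - sumC beta K) + ((sumC beta N - l) + (x + - y)))
    by (rewrite Eb, Ebeta; ring).
  assert (T1 := Cmod_triangle (sumC (b N) K - sumC beta K) ((sumC beta N - l) + (x + - y))).
  assert (T2 := Cmod_triangle (sumC beta N - l) (x + - y)).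
  assert (T3 := Cmod_triangle x (- y)). rewrite Cmod_opp in T3.
  lra.
Qed.

(* Replacing [p x] by [p (2 x) - 2 ^ n p x] removes the leading term. *)
Lemma poly_coef_clim (n : nat) : forall (a : nat -> nat -> C) (delta : R),
  (0 < delta)%R ->
  (forall x : R, (0 < x < delta)%R ->
     exists l, clim (fun N => sumC (fun i => a N i * RtoC x ^ i) n) l) ->
  forall i, (i < n)%nat -> exists c, clim (fun N => a N i) c.
Proof.
  induction n; intros a delta Hd H i Hi; [lia|].
  assert (Hlow : forall i, (i < n)%nat -> exists c, clim (fun N => a N i) c).
  { intros j Hj.
    destruct (IHn (fun N i => (2 ^ i - 2 ^ n) * a N i) (delta / 2)%R) with j
      as [c Hc]; auto; [lra| |].
    - intros x Hx.
      destruct (H x) as [l Hl]; [lra|]. destruct (H (2 * x)%R) as [l' Hl']; [lra|].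
      exists (l' - 2 ^ n * l).
      eapply clim_ext; [|exact (clim_minus _ _ _ _ Hl' (clim_scal (2 ^ n) _ _ Hl))].
      intros N; simpl. rewrite RtoC_mult, Cpow_mult_l.
      replace (2 ^ n * (sumC (fun i0 => a N i0 * RtoC x ^ i0) n + a N n * RtoC x ^ n))
        with (sumC (fun i0 => 2 ^ n * (a N i0 * RtoC x ^ i0)) n + 2 ^ n * (a N n * RtoC x ^ n))
        by (rewrite sumC_scal; ring).
      assert (E : sumC (fun i0 => (2 ^ i0 - 2 ^ n) * a N i0 * RtoC x ^ i0) n =
        sumC (fun i0 => a N i0 * (2 * RtoC x) ^ i0) n - sumC (fun i0 => 2 ^ n * (a N i0 * RtoC x ^ i0)) n).
      { rewrite <- sumC_minus; apply sumC_ext; intros k _. rewrite Cpow_mult_l; ring. }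
      rewrite E; ring.
    - assert (Hne : 2 ^ j - 2 ^ n <> 0).
      { rewrite <- !RtoC_pow, <- RtoC_minus. apply RtoC_neq_0.
        assert (2 ^ j < 2 ^ n)%R by (apply Rlt_pow; [lra|lia]). lra. }
      exists (/ (2 ^ j - 2 ^ n) * c).
      eapply clim_ext; [|exact (clim_scal (/ (2 ^ j - 2 ^ n)) _ _ Hc)].
      intros N; simpl; field; auto. }
  destruct (Nat.eq_dec i n) as [->|]; [|apply Hlow; lia].
  destruct (choice (fun i c => (i < n)%nat -> clim (fun N => a N i) c)) as [c Hc].
  { intros j; destruct (le_lt_dec n j); [exists 0; intros; lia|].
    destruct (Hlow j) as [c Hc]; auto. exists c; auto. }
  (* Once all lower coefficients converge, the value at a single nonzero point determines the limit
     of the top one. *)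
  set (x := (delta / 2)%R).
  assert (Hx : (0 < x < delta)%R) by (unfold x; lra).
  destruct (H x Hx) as [l Hl].
  assert (Hs : clim (fun N => sumC (fun i => a N i * RtoC x ^ i) n)
     (sumC (fun i => c i * RtoC x ^ i) n)).
  { apply clim_sumC; intros k Hk. apply clim_mult; auto using clim_const. }
  assert (Hne : RtoC x ^ n <> 0).
  { apply Cpow_nz, RtoC_neq_0; lra. }
  exists (/ RtoC x ^ n * (l - sumC (fun i => c i * RtoC x ^ i) n)).
  eapply clim_ext; [|exact (clim_scal (/ RtoC x ^ n) _ _ (clim_minus _ _ _ _ Hl Hs))].
  intros N; simpl. field; auto.
Qed.

(** * Partial fractions of a finite product *)

(* Over [n] nodes: [1/E_k] is the coefficient of [1/(1 - s_k w)] in the partial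
   fraction expansion of [1 / prod (1 - s_j w)], and [2 beta_k / E_k^2] that in
   the expansion of its square. *)
Definition pfE (s : nat -> C) (n k : nat) : C :=
  prodC (fun j => if Nat.eq_dec j k then 1 else 1 - s j / s k) n.
Definition pfbeta (s : nat -> C) (n k : nat) : C :=
  sumC (fun j => if Nat.eq_dec j k then 0 else s j / (s j - s k)) n.

Section PartialFractions.
Variable s : nat -> C.
Hypothesis s_neq_0 : forall k, s k <> 0.
Hypothesis s_inj : forall j k, j <> k -> s j <> s k.

Lemma pf_sub_neq j k : j <> k -> s j - s k <> 0.
Proof. intros H; apply Cminus_eq_contra; auto. Qed.

Lemma pfE_neq_0 n k : pfE s n k <> 0.
Proof.
  apply prodC_neq_0; intros j _. destruct (Nat.eq_dec j k) as [|H]; [apply C1_nz|].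
  replace (1 - s j / s k) with ((s k - s j) / s k) by (field; auto).
  apply Cmult_neq_0; [apply pf_sub_neq; auto|].
  intros E. apply C1_nz. rewrite <- (Cinv_r (s k)), E by auto. ring.
Qed.

Lemma pfE_step n k : (k < n)%nat -> pfE s (S n) k = pfE s n k * ((s k - s n) / s k).
Proof.
  intros H; unfold pfE; simpl. destruct (Nat.eq_dec n k); [lia|].
  f_equal. field; auto.
Qed.

Lemma pfE_last n : pfE s (S n) n = prodC (fun j => 1 - s j * / s n) n.
Proof.
  unfold pfE; simpl. destruct (Nat.eq_dec n n); [|easy].
  rewrite Cmult_1_r. apply prodC_ext; intros j Hj.
  destruct (Nat.eq_dec j n); [lia|reflexivity].
Qed.

Lemma pfbeta_step n k : (k < n)%nat -> pfbeta s (S n) k = pfbeta s n k + s n / (s n - s k).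
Proof.
  intros H; unfold pfbeta; simpl. destruct (Nat.eq_dec n k); [lia|easy].
Qed.

Lemma pfbeta_last n : pfbeta s (S n) n = sumC (fun j => s j / (s j - s n)) n.
Proof.
  unfold pfbeta; simpl. destruct (Nat.eq_dec n n); [|easy].
  rewrite Cplus_0_r. apply sumC_ext; intros j Hj.
  destruct (Nat.eq_dec j n); [lia|reflexivity].
Qed.

Lemma one_sub_last_neq_0 n j : (j < n)%nat -> 1 - s j * / s n <> 0.
Proof.
  intros H. replace (1 - s j * / s n) with ((s n - s j) * / s n) by (field; auto).
  apply Cmult_neq_0; [apply pf_sub_neq; lia|].
  intros E. apply C1_nz. rewrite <- (Cinv_r (s n)), E by auto. ring.
Qed.

(** Induction on the nodes: multiplying the expansion over [n] nodes by [1 / (1 - s_n w)] and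
    separating each product of two poles yields the new coefficients at the old nodes. *)
Lemma partial_fractions n : (0 < n)%nat -> forall w,
  (forall j, (j < n)%nat -> 1 - s j * w <> 0) ->
  / prodC (fun j => 1 - s j * w) n = sumC (fun k => / (pfE s n k * (1 - s k * w))) n.
Proof.
  induction n as [|n IH]; [lia|]. intros _ w Hw.
  destruct (Nat.eq_dec n 0) as [->|Hn0].
  { unfold pfE; simpl. field.
    apply (Hw 0%nat); lia. }
  specialize (IH ltac:(lia)).
  rewrite prodC_S, sumC_S.
  replace (/ (prodC (fun j => 1 - s j * w) n * (1 - s n * w)))
    with (/ (1 - s n * w) * / prodC (fun j => 1 - s j * w) n).
  2: { field; split; auto. apply prodC_neq_0; intros; apply Hw; lia. }
  rewrite IH by (intros; apply Hw; lia).
  rewrite <- sumC_scal.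
  (* The second summands add up to [1 / (1 - s_n w)] times the induction hypothesis evaluated at
     [w = 1 / s_n], which is the coefficient at the new node. *)
  rewrite (sumC_ext _ (fun k => / (pfE s (S n) k * (1 - s k * w)) +
     / (1 - s n * w) * / (pfE s n k * (1 - s k * / s n)))).
  2: { intros k Hk. rewrite pfE_step by lia.
       assert (H1 := pfE_neq_0 n k).
       assert (H3 := pf_sub_neq k n ltac:(lia)).
       assert (H4 := pf_sub_neq n k ltac:(lia)).
       field; repeat split; auto. }
  rewrite sumC_plus, sumC_scal, <- IH, <- pfE_last.
  2: { intros j Hj; apply one_sub_last_neq_0; lia. }
  f_equal. assert (H1 := pfE_neq_0 (S n) n). field; auto.
Qed.

(** Here [a] and [b] stand for [1 / (1 - s_k w)] and [1 / (1 - s_n w)], [k] for [s_k / (s_k - s_n)]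
    and [be] for the old [pfbeta]; the hypothesis is the two-pole separation, applied until no mixed
    product remains. *)
Lemma pf_square_step (a b k be : C) : a * b = k * a + (1 - k) * b ->
  (a ^ 2 + 2 * be * a) * b ^ 2 =
  k ^ 2 * (a ^ 2 + 2 * (be + (1 - k)) * a)
  + ((1 - k) ^ 2 + 2 * be * (1 - k)) * b ^ 2
  + 2 * (k * ((1 - k) ^ 2 + be * (1 - k))) * b.
Proof.
  intros H.
  replace ((a ^ 2 + 2 * be * a) * b ^ 2) with ((a * b) ^ 2 + 2 * be * (a * b) * b) by ring.
  rewrite H.
  replace ((k * a + (1 - k) * b) ^ 2 + 2 * be * (k * a + (1 - k) * b) * b) with
   (k ^ 2 * a ^ 2 + (1 - k) ^ 2 * b ^ 2 + 2 * k * (1 - k) * (a * b)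
    + 2 * be * k * (a * b) + 2 * be * (1 - k) * b ^ 2) by ring.
  rewrite H. ring.
Qed.

(** The analogue of [pf_square_step] for the expansion multiplied by its logarithmic derivative,
    where [a - 1] stands for [s_k w a]. *)
Lemma pf_square_deriv_step (a b k be : C) : a * b = k * a + (1 - k) * b ->
  b ^ 2 * ((a - 1) * (a ^ 2 + be * a)) + (b - 1) * b ^ 2 * (a ^ 2 + 2 * be * a) =
  k ^ 2 * ((a - 1) * (a ^ 2 + (be + (1 - k)) * a))
  + (b - 1) * (b ^ 2 * ((1 - k) ^ 2 + 2 * be * (1 - k))
               + b * (k * ((1 - k) ^ 2 + be * (1 - k)))).
Proof.
  intros H.
  assert (E21 : a ^ 2 * b = k * a ^ 2 + (1 - k) * (k * a + (1 - k) * b)).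
  { rewrite <- H. replace (a ^ 2 * b) with (a * (a * b)) by ring. rewrite H at 1. ring. }
  assert (E12 : a * b ^ 2 = k * (k * a + (1 - k) * b) + (1 - k) * b ^ 2).
  { rewrite <- H. replace (a * b ^ 2) with ((a * b) * b) by ring. rewrite H at 1. ring. }
  assert (E22 : a ^ 2 * b ^ 2 = k * (a ^ 2 * b) + (1 - k) * (a * b ^ 2)).
  { replace (a ^ 2 * b ^ 2) with ((a * b) * (a * b)) by ring. rewrite H at 1. ring. }
  assert (E31 : a ^ 3 * b = k * a ^ 3 + (1 - k) * (a ^ 2 * b)).
  { replace (a ^ 3 * b) with ((a * b) * a ^ 2) by ring. rewrite H at 1. ring. }
  assert (E32 : a ^ 3 * b ^ 2 = k * (a ^ 3 * b) + (1 - k) * (a ^ 2 * b ^ 2)).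
  { replace (a ^ 3 * b ^ 2) with ((a * b) * (a ^ 2 * b)) by ring. rewrite H at 1. ring. }
  assert (E13 : a * b ^ 3 = k * (a * b ^ 2) + (1 - k) * b ^ 3).
  { replace (a * b ^ 3) with ((a * b) * b ^ 2) by ring. rewrite H at 1. ring. }
  assert (E23 : a ^ 2 * b ^ 3 = k * (a ^ 2 * b ^ 2) + (1 - k) * (a * b ^ 3)).
  { replace (a ^ 2 * b ^ 3) with ((a * b) * (a * b ^ 2)) by ring. rewrite H at 1. ring. }
  replace (b ^ 2 * ((a - 1) * (a ^ 2 + be * a)) + (b - 1) * b ^ 2 * (a ^ 2 + 2 * be * a)) with
   ((a ^ 3 * b ^ 2) + (be - 1) * (a ^ 2 * b ^ 2) - be * (a * b ^ 2) + (a ^ 2 * b ^ 3) + 2 * be * (a * b ^ 3)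
     - (a ^ 2 * b ^ 2) - 2 * be * (a * b ^ 2)) by ring.
  rewrite E23, E13, E32, E31, E22, E12, E21. ring.
Qed.

(** The second identity is [w / 2] times the derivative of the first, written without derivatives.
    Both go through one induction because the simple-pole coefficient at a new node is obtained from
    the second identity for the previous nodes. *)
Lemma partial_fractions_square n : (0 < n)%nat ->
  (forall w, (forall j, (j < n)%nat -> 1 - s j * w <> 0) ->
  / prodC (fun j => 1 - s j * w) n ^ 2 =
  sumC (fun k => / pfE s n k ^ 2 *
    ((/ (1 - s k * w)) ^ 2 + 2 * pfbeta s n k * / (1 - s k * w))) n) /\
  (forall w, (forall j, (j < n)%nat -> 1 - s j * w <> 0) ->
  / prodC (fun j => 1 - s j * w) n ^ 2 * sumC (fun j => / (1 - s j * w) - 1) n =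
  sumC (fun k => / pfE s n k ^ 2 * ((/ (1 - s k * w) - 1) *
    ((/ (1 - s k * w)) ^ 2 + pfbeta s n k * / (1 - s k * w)))) n).
Proof.
  induction n as [|n IH]; [lia|]. intros _.
  destruct (Nat.eq_dec n 0) as [->|Hn0].
  { unfold pfE, pfbeta; split; intros w Hw; simpl; field; apply (Hw 0%nat); lia. }
  destruct (IH ltac:(lia)) as [IH1 IH2].
  set (kap := fun k => s k / (s k - s n)).
  assert (Hk1 : forall k, (k < n)%nat -> / (1 - s k * / s n) = 1 - kap k).
  { intros k Hk. unfold kap. assert (H3 := pf_sub_neq k n ltac:(lia)).
    assert (H4 := pf_sub_neq n k ltac:(lia)). field; auto. }
  assert (HE : forall k, (k < n)%nat -> / pfE s (S n) k ^ 2 = / pfE s n k ^ 2 * kap k ^ 2).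
  { intros k Hk. rewrite pfE_step by lia. unfold kap.
    assert (H3 := pf_sub_neq k n ltac:(lia)). assert (H1 := pfE_neq_0 n k).
    field; auto. }
  assert (Hb : forall k, (k < n)%nat -> pfbeta s (S n) k = pfbeta s n k + (1 - kap k)).
  { intros k Hk. rewrite pfbeta_step by lia. unfold kap.
    assert (H3 := pf_sub_neq k n ltac:(lia)). assert (H4 := pf_sub_neq n k ltac:(lia)).
    field; auto. }
  assert (Hn : forall j, (j < n)%nat -> 1 - s j * / s n <> 0)
    by (intros; apply one_sub_last_neq_0; lia).
  assert (D1 : / pfE s (S n) n ^ 2 =
    sumC (fun k => / pfE s n k ^ 2 * ((1 - kap k) ^ 2 + 2 * pfbeta s n k * (1 - kap k))) n).
  { rewrite pfE_last, IH1 by auto. apply sumC_ext; intros k Hk. now rewrite Hk1. }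
  (* At [w = 1 / s_n] the logarithmic-derivative sum equals [- pfbeta s (S n) n], so the second
     induction hypothesis evaluates the new simple-pole coefficient. *)
  assert (D2 : / pfE s (S n) n ^ 2 * pfbeta s (S n) n =
    sumC (fun k => / pfE s n k ^ 2 * (kap k * ((1 - kap k) ^ 2 + pfbeta s n k * (1 - kap k)))) n).
  { specialize (IH2 (/ s n) Hn). rewrite <- pfE_last in IH2.
    rewrite (sumC_ext (fun j => / (1 - s j * / s n) - 1) (fun j => (-1) * kap j)) in IH2.
    2: { intros k Hk. rewrite Hk1 by auto. ring. }
    rewrite sumC_scal in IH2.
    rewrite pfbeta_last.
    transitivity ((-1) * (/ pfE s (S n) n ^ 2 * (-1 * sumC kap n))).
    - replace (sumC (fun j => s j / (s j - s n)) n) with (sumC kap n) by reflexivity. ring.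
    - rewrite IH2, <- sumC_scal. apply sumC_ext; intros k Hk. rewrite Hk1 by auto. ring. }
  assert (Hab : forall w k, (k < n)%nat -> 1 - s k * w <> 0 -> 1 - s n * w <> 0 ->
    / (1 - s k * w) * / (1 - s n * w) = kap k * / (1 - s k * w) + (1 - kap k) * / (1 - s n * w)).
  { intros w k Hk H1 H2. unfold kap.
    assert (H3 := pf_sub_neq k n ltac:(lia)). field; auto. }
  split; intros w Hw; rewrite prodC_S, !sumC_S.
  - set (b := / (1 - s n * w)).
    replace (/ (prodC (fun j => 1 - s j * w) n * (1 - s n * w)) ^ 2) with
      (b ^ 2 * / prodC (fun j => 1 - s j * w) n ^ 2).
    2: { unfold b; field; split; [apply Hw; lia|].
         apply prodC_neq_0; intros; apply Hw; lia. }
    rewrite IH1 by (intros; apply Hw; lia).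
    replace (/ pfE s (S n) n ^ 2 * (b ^ 2 + 2 * pfbeta s (S n) n * b)) with
      (b ^ 2 * / pfE s (S n) n ^ 2 + (2 * b) * (/ pfE s (S n) n ^ 2 * pfbeta s (S n) n)) by ring.
    rewrite D2, D1, <- !sumC_scal, <- !sumC_plus.
    apply sumC_ext; intros k Hk. rewrite HE, Hb by lia.
    assert (St := pf_square_step _ _ _ (pfbeta s n k) (Hab w k Hk (Hw k ltac:(lia)) (Hw n ltac:(lia)))).
    fold b in St.
    match type of St with ?l = _ => transitivity (/ pfE s n k ^ 2 * l); [ring|] end.
    rewrite St; ring.
  - set (b := / (1 - s n * w)).
    replace (/ (prodC (fun j => 1 - s j * w) n * (1 - s n * w)) ^ 2) with
      (b ^ 2 * / prodC (fun j => 1 - s j * w) n ^ 2).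
    2: { unfold b; field; split; [apply Hw; lia|].
         apply prodC_neq_0; intros; apply Hw; lia. }
    replace (b ^ 2 * / prodC (fun j => 1 - s j * w) n ^ 2 * (sumC (fun j => / (1 - s j * w) - 1) n + (b - 1)))
      with (b ^ 2 * (/ prodC (fun j => 1 - s j * w) n ^ 2 * sumC (fun j => / (1 - s j * w) - 1) n)
       + (b - 1) * b ^ 2 * / prodC (fun j => 1 - s j * w) n ^ 2) by ring.
    rewrite IH2, IH1 by (intros; apply Hw; lia).
    replace (/ pfE s (S n) n ^ 2 * ((b - 1) * (b ^ 2 + pfbeta s (S n) n * b))) with
      ((b - 1) * b ^ 2 * / pfE s (S n) n ^ 2 + ((b - 1) * b) * (/ pfE s (S n) n ^ 2 * pfbeta s (S n) n)) by ring.
    rewrite D2, D1, <- !sumC_scal, <- !sumC_plus.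
    apply sumC_ext; intros k Hk. rewrite HE, Hb by lia.
    assert (St := pf_square_deriv_step _ _ _ (pfbeta s n k) (Hab w k Hk (Hw k ltac:(lia)) (Hw n ltac:(lia)))).
    fold b in St.
    match type of St with ?l = _ => transitivity (/ pfE s n k ^ 2 * l); [ring|] end.
    rewrite St; ring.
Qed.

End PartialFractions.

(** * Zeros of Laguerre polynomials *)

Open Scope R_scope.

(** Synthetic division, with the value at [r] kept as a remainder instead of being assumed zero so
    that the induction applies to the shifted coefficients. *)
Lemma factor_root (n : nat) : forall (a : nat -> C) (r : C),
  exists b : nat -> C, forall w : C,
    (sumC (fun m => a m * w ^ m) (S n) - sumC (fun m => a m * r ^ m) (S n)
     = (w - r) * sumC (fun m => b m * w ^ m) n)%C.
Proof.
  assert (Hshift : forall (a : nat -> C) w m,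
    (sumC (fun m => a m * w ^ m) (S m) = a O + w * sumC (fun m => a (S m) * w ^ m) m)%C).
  { intros a w m. induction m.
    - simpl; ring.
    - rewrite sumC_S, IHm, (sumC_S _ m), Cpow_S. ring. }
  induction n; intros a r.
  - exists (fun _ => RtoC 0). intros w; simpl; ring.
  - destruct (IHn (fun m => a (S m)) r) as [b Hb].
    (* From [p(w) = a_0 + w Q(w)] one has [p(w) - p(r) = (w - r) Q(w) + r (Q(w) - Q(r))], and [b] is
       the quotient for [Q]. *)
    exists (fun m => if lt_dec m n then (a (S m) + r * b m)%C else a (S m)).
    intros w. rewrite !(Hshift a).
    set (Qw := sumC (fun m => (a (S m) * w ^ m)%C) (S n)).
    set (Qr := sumC (fun m => (a (S m) * r ^ m)%C) (S n)).
    specialize (Hb w). fold Qw Qr in Hb.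
    transitivity ((w - r) * Qw + r * (Qw - Qr))%C; [ring|]. rewrite Hb.
    rewrite sumC_S. destruct (lt_dec n n); [lia|].
    rewrite (sumC_ext (fun m => ((if lt_dec m n then a (S m) + r * b m else a (S m)) * w ^ m)%C)
      (fun m => (a (S m) * w ^ m + r * (b m * w ^ m))%C) n).
    2: { intros k Hk. destruct (lt_dec k n); [ring|lia]. }
    rewrite sumC_plus, sumC_scal. unfold Qw; rewrite sumC_S. ring.
Qed.

Lemma factor_all_roots (n : nat) : forall (a : nat -> C) (r : nat -> C),
  (forall i j, (i < j < n)%nat -> r i <> r j) ->
  (forall j, (j < n)%nat -> sumC (fun m => a m * r j ^ m)%C (S n) = 0) ->
  exists c : C, forall w : C,
    sumC (fun m => a m * w ^ m)%C (S n) = (c * prodC (fun j => w - r j) n)%C.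
Proof.
  induction n; intros a r Hd H.
  - exists (a O); intros w; simpl; ring.
  - destruct (factor_root (S n) a (r n)) as [b Hb].
    rewrite (H n) in Hb by lia.
    destruct (IHn b r) as [c Hc].
    + intros i j Hij; apply Hd; lia.
    + intros j Hj. specialize (Hb (r j)). rewrite H in Hb by lia.
      assert (r j - r n <> 0)%C by (apply Cminus_eq_contra, Hd; lia).
      apply Ceq_minus in Hb.
      destruct (classic (sumC (fun m => b m * r j ^ m)%C (S n) = 0)) as [|Hne]; auto.
      exfalso. apply (Cmult_neq_0 _ _ H0 Hne).
      transitivity (- (RtoC 0 - RtoC 0 - (r j - r n) * sumC (fun m => b m * r j ^ m) (S n)))%C; [ring|].
      rewrite Hb; ring.
    + exists c; intros w. specialize (Hb w). rewrite Hc in Hb.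
      rewrite prodC_S. transitivity ((w - r n) * (c * prodC (fun j => w - r j) n))%C; [|ring].
      rewrite <- Hb; ring.
Qed.

Lemma poly_pos_at_infinity (n : nat) : forall (a : nat -> R), 0 < a n ->
  exists c X, 0 < c /\ 0 < X /\
    forall x, X <= x -> c <= sumR (fun m => a m * x ^ m) (S n).
Proof.
  assert (Hshift : forall (a : nat -> R) x m,
    sumR (fun m => a m * x ^ m) (S m) = a O + x * sumR (fun m => a (S m) * x ^ m) m).
  { intros a w m. induction m.
    - simpl; ring.
    - rewrite sumR_S, IHm, (sumR_S _ m). simpl; ring. }
  induction n; intros a Ha.
  - exists (a O), 1. repeat split; try lra. intros x _; simpl; lra.
  - destruct (IHn (fun m => a (S m)) Ha) as (c & X & Hc & HX & H).
    exists c, (Rmax X ((c + Rabs (a O)) / c)). repeat split; auto.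
    + eapply Rlt_le_trans; [exact HX|apply Rmax_l].
    + intros x Hx. rewrite Hshift.
      specialize (H x (Rle_trans _ _ _ (Rmax_l _ _) Hx)).
      assert (Hx2 := Rle_trans _ _ _ (Rmax_r _ _) Hx).
      assert (Hxc : c + Rabs (a O) <= x * c).
      { apply Rmult_le_compat_r with (r := c) in Hx2; [|lra].
        unfold Rdiv in Hx2. rewrite Rmult_assoc, Rinv_l, Rmult_1_r in Hx2; lra. }
      assert (0 <= x) by (eapply Rle_trans; [|exact Hx]; eapply Rle_trans; [|apply Rmax_l]; lra).
      assert (- Rabs (a O) <= a O) by (assert (T := Rle_abs (- a O)); rewrite Rabs_Ropp in T; lra).
      nra.
Qed.

Definition fallf (n m : nat) : R := prodR (fun i => INR n - INR i) m.

(** Coefficients of the Laguerre polynomial [L_n^(q)] divided by its value at 0, so that the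
    constant term is 1; [fallf n m / m!] is a binomial coefficient and vanishes for [m > n]. *)
Definition lagc (q n m : nat) : R :=
  (-1) ^ m * fallf n m / INR (fact m) * (INR (fact q) / INR (fact (m + q))).

Definition lag (q n : nat) (x : R) : R := sumR (fun m => lagc q n m * x ^ m) (S n).

Lemma fallf_S n m : fallf n (S m) = fallf n m * (INR n - INR m).
Proof. reflexivity. Qed.

Lemma fallf_SS n m : fallf (S n) (S m) = (INR n + 1) * fallf n m.
Proof.
  induction m.
  - unfold fallf, prodR; rewrite S_INR; simpl; ring.
  - rewrite fallf_S, IHm, fallf_S, !S_INR. ring.
Qed.

Lemma fallf_pos n m : (m <= n)%nat -> 0 < fallf n m.
Proof.
  induction m; intros H; [unfold fallf; simpl; lra|].
  rewrite fallf_S. apply Rmult_lt_0_compat; [apply IHm; lia|].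
  assert (INR m < INR n) by (apply lt_INR; lia). lra.
Qed.

Lemma lagc_0 q n : lagc q n 0 = 1.
Proof.
  unfold lagc, fallf; simpl. assert (H := INR_fact_neq_0 q). field; auto.
Qed.

Lemma lagc_S q n m :
  lagc q n (S m) = - lagc q n m * (INR n - INR m) / ((INR m + 1) * (INR m + 1 + INR q)).
Proof.
  unfold lagc. rewrite fallf_S. change (S m + q)%nat with (S (m + q)).
  rewrite !fact_simpl, !mult_INR, !S_INR, plus_INR. simpl pow.
  assert (H := INR_fact_neq_0 m). assert (H1 := INR_fact_neq_0 (m + q)).
  assert (H2 := pos_INR m). assert (H3 := pos_INR q).
  field; repeat split; auto; lra.
Qed.

Lemma lagc_SS q n m :
  lagc q (S n) (S m) = - lagc q n m * (INR n + 1) / ((INR m + 1) * (INR m + 1 + INR q)).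
Proof.
  unfold lagc. rewrite fallf_SS. change (S m + q)%nat with (S (m + q)).
  rewrite !fact_simpl, !mult_INR, !S_INR, plus_INR. simpl pow.
  assert (H := INR_fact_neq_0 m). assert (H1 := INR_fact_neq_0 (m + q)).
  assert (H2 := pos_INR m). assert (H3 := pos_INR q).
  field; repeat split; auto; lra.
Qed.

(** In terms of the derivative this reads [(n + 1 + q) g_{n+1} = x g_n' + (n + 1 + q - x) g_n]. At a
    root of [g_n] only [x g_n'] survives, which fixes the sign of [g_{n+1}] there. *)
Lemma lag_rec q n x :
  (INR n + 1 + INR q) * lag q (S n) x =
  sumR (fun m => INR m * lagc q n m * x ^ m) (S n) + (INR n + 1 + INR q - x) * lag q n x.
Proof.
  assert (G : forall M,
   (INR n + 1 + INR q) * sumR (fun m => lagc q (S n) m * x ^ m) (S M) =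
   sumR (fun m => INR m * lagc q n m * x ^ m) (S M) +
   (INR n + 1 + INR q) * sumR (fun m => lagc q n m * x ^ m) (S M) -
   x * sumR (fun m => lagc q n m * x ^ m) M).
  { induction M.
    - simpl. rewrite !lagc_0. ring.
    - rewrite !(sumR_S _ (S M)), Rmult_plus_distr_l, IHM, (sumR_S (fun m => lagc q n m * x ^ m) M).
      rewrite lagc_SS, lagc_S, !S_INR. simpl pow.
      assert (H2 := pos_INR M). assert (H3 := pos_INR q).
      field; split; lra. }
  assert (Z : lagc q n (S n) = 0).
  { rewrite lagc_S. unfold Rdiv. rewrite Rminus_diag. ring. }
  unfold lag. rewrite (G (S n)). rewrite !(sumR_S _ (S n)), Z. ring.
Qed.

Lemma is_derive_sumR_pow (c : nat -> R) n x :
  is_derive (fun x => sumR (fun m => c m * x ^ m) n) x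
    (sumR (fun m => c m * (INR m * x ^ pred m)) n).
Proof.
  induction n; simpl.
  - apply (is_derive_const (K := R_AbsRing) (V := R_NormedModule)).
  - apply (is_derive_plus (K := R_AbsRing) (V := R_NormedModule)); [exact IHn|].
    auto_derive; auto. ring.
Qed.

Lemma sumR_pow_deriv (c : nat -> R) n x :
  x * sumR (fun m => c m * (INR m * x ^ pred m)) n = sumR (fun m => INR m * c m * x ^ m) n.
Proof.
  rewrite <- sumR_scal. apply sumR_ext; intros k _.
  destruct k; simpl pow; simpl pred; [simpl INR|]; ring.
Qed.

Lemma prodR_hole (f : nat -> R) n k : (k < n)%nat ->
  prodR f n = f k * prodR (fun j => if Nat.eq_dec j k then 1 else f j) n.
Proof.
  induction n; intros H; [lia|]. simpl.
  destruct (Nat.eq_dec n k) as [->|].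
  - rewrite Rmult_1_r, Rmult_comm. f_equal. apply prodR_ext; intros j Hj.
    destruct (Nat.eq_dec j k); [lia|easy].
  - rewrite IHn by lia. ring.
Qed.

Lemma ex_derive_prodR (f : nat -> R -> R) n x :
  (forall j, (j < n)%nat -> ex_derive (f j) x) ->
  ex_derive (fun x => prodR (fun j => f j x) n) x.
Proof.
  induction n; intros H; simpl; [apply ex_derive_const|].
  apply @ex_derive_mult; [apply IHn; intros; apply H|apply H]; lia.
Qed.

Lemma is_derive_prod_at_root (s : nat -> R) n k : (k < n)%nat -> s k <> 0 ->
  is_derive (fun x => prodR (fun j => 1 - s j * x) n) (/ s k)
    (- s k * prodR (fun j => if Nat.eq_dec j k then 1 else 1 - s j / s k) n).
Proof.
  intros Hk Hs.
  set (H := fun x => prodR (fun j => if Nat.eq_dec j k then 1 else 1 - s j * x) n).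
  apply is_derive_ext with (fun x => (1 - s k * x) * H x).
  { intros t; unfold H. symmetry. apply (prodR_hole (fun j => 1 - s j * t)); auto. }
  assert (E : ex_derive H (/ s k)).
  { apply (ex_derive_prodR (fun j x => if Nat.eq_dec j k then 1 else 1 - s j * x)).
    intros j _. destruct (Nat.eq_dec j k); [apply ex_derive_const|auto_derive; auto]. }
  apply Derive_correct in E.
  evar_last.
  { apply (is_derive_mult (fun x => 1 - s k * x) H).
    - auto_derive; auto.
    - exact E.
    - intros; apply Rmult_comm. }
  unfold plus, mult; simpl. fold (H (/ s k)).
  rewrite Rinv_r by auto. unfold H, Rdiv. ring.
Qed.

(** At [1 / s_k] the [k] factors with larger [s_j] are negative and the later ones positive. This
    gives the alternating sign of the derivative at consecutive roots, both for Laguerre polynomials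
    and later for the residues. *)
Lemma hole_sign (s : nat -> R) n k : (k < n)%nat ->
  (forall j, (j < n)%nat -> 0 < s j) -> (forall i j, (i < j < n)%nat -> s j < s i) ->
  0 < (-1) ^ k * prodR (fun j => if Nat.eq_dec j k then 1 else 1 - s j / s k) n.
Proof.
  intros Hk Hpos Hdec.
  assert (A : forall m, (m <= k)%nat ->
    0 < (-1) ^ m * prodR (fun j => if Nat.eq_dec j k then 1 else 1 - s j / s k) m).
  { induction m; intros Hm; simpl; [lra|].
    destruct (Nat.eq_dec m k); [lia|].
    specialize (IHm ltac:(lia)).
    assert (1 < s m / s k).
    { apply Rmult_lt_reg_r with (s k); [apply Hpos; lia|].
      unfold Rdiv; rewrite Rmult_assoc, Rinv_l, Rmult_1_l, Rmult_1_r; [apply Hdec; lia|].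
      assert (0 < s k) by (apply Hpos; lia); lra. }
    nra. }
  assert (B : forall m, (S k <= m <= n)%nat ->
    0 < (-1) ^ k * prodR (fun j => if Nat.eq_dec j k then 1 else 1 - s j / s k) m).
  { induction m; intros Hm; [lia|]. rewrite prodR_S.
    destruct (Nat.eq_dec m k) as [->|].
    - rewrite Rmult_1_r. apply A; lia.
    - specialize (IHm ltac:(lia)).
      assert (s m / s k < 1).
      { apply Rmult_lt_reg_r with (s k); [apply Hpos; lia|].
        unfold Rdiv; rewrite Rmult_assoc, Rinv_l, Rmult_1_l, Rmult_1_r; [apply Hdec; lia|].
        assert (0 < s k) by (apply Hpos; lia); lra. }
      rewrite <- Rmult_assoc. apply Rmult_lt_0_compat; lra. }
  apply B; lia.
Qed.

Lemma lag_RtoC q n x :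
  sumC (fun m => RtoC (lagc q n m) * RtoC x ^ m)%C (S n) = RtoC (lag q n x).
Proof.
  unfold lag. rewrite <- sumC_RtoC. apply sumC_ext; intros k _.
  now rewrite <- RtoC_pow, <- RtoC_mult.
Qed.

Lemma lag_at_0 q n : lag q n 0 = 1.
Proof.
  unfold lag. generalize n at 2 as m. induction m.
  - simpl; rewrite lagc_0; ring.
  - rewrite sumR_S, IHm. simpl; ring.
Qed.

(** The roots of [g_{n+1}] interlace with those of [g_n]: its sign alternates along 0, the [n] roots
    of [g_n] and a far point. The intermediate value theorem then supplies [n + 1] distinct roots,
    as many as the degree. *)
Lemma lag_factor q n : exists s : nat -> R,
  (forall j, (j < n)%nat -> 0 < s j) /\ (forall i j, (i < j < n)%nat -> s j < s i) /\
  forall w : C, sumC (fun m => RtoC (lagc q n m) * w ^ m)%C (S n)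
    = prodC (fun j => 1 - RtoC (s j) * w)%C n.
Proof.
  induction n as [|n (s & Hpos & Hdec & Hs)].
  { exists (fun _ => 1). repeat split; try (intros; lia).
    intros w; simpl. rewrite lagc_0. ring. }
  assert (HsR : forall x, lag q n x = prodR (fun j => 1 - s j * x) n).
  { intros x. apply RtoC_inj. rewrite <- lag_RtoC, Hs, <- prodC_RtoC.
    apply prodC_ext; intros k _. now rewrite RtoC_minus, RtoC_mult. }
  assert (Hq : 0 < INR n + 1 + INR q) by (assert (T := pos_INR n); assert (T' := pos_INR q); lra).
  assert (Hsgn : forall j, (j < n)%nat -> 0 < (-1) ^ S j * lag q (S n) (/ s j)).
  { intros j Hj. assert (Hp := Hpos j Hj).
    assert (E := lag_rec q n (/ s j)).
    assert (Z : lag q n (/ s j) = 0).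
    { rewrite HsR. apply prodR_eq_0 with j; auto. rewrite Rinv_r; lra. }
    rewrite Z, Rmult_0_r, Rplus_0_r, <- (sumR_pow_deriv (lagc q n)) in E.
    assert (D1 := is_derive_sumR_pow (lagc q n) (S n) (/ s j)).
    assert (D2 := is_derive_prod_at_root s n j Hj ltac:(lra)).
    apply (is_derive_ext _ (fun x => prodR (fun j => 1 - s j * x) n)) in D1; [|exact HsR].
    apply is_derive_unique in D1. apply is_derive_unique in D2.
    rewrite <- D1 in E.
    replace (Derive _ _) with (- s j * prodR (fun i => if Nat.eq_dec i j then 1 else 1 - s i / s j) n) in E by (symmetry; exact D2).
    clear D1 D2.
    assert (HH := hole_sign s n j Hj Hpos Hdec).
    set (h := prodR _ n) in *.
    replace (/ s j * (- s j * h)) with (- h) in E by (field; lra).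
    apply Rmult_lt_reg_l with (INR n + 1 + INR q); auto.
    rewrite Rmult_0_r. replace ((INR n + 1 + INR q) * ((-1) ^ S j * lag q (S n) (/ s j))) with
      ((-1) ^ S j * ((INR n + 1 + INR q) * lag q (S n) (/ s j))) by ring.
    rewrite E. simpl. lra. }
  destruct (poly_pos_at_infinity (S n) (fun m => (-1) ^ S n * lagc q (S n) m)) as (c & X & Hc & HX & HXp).
  { unfold lagc. assert (F := fallf_pos (S n) (S n) ltac:(lia)).
    unfold Rdiv. rewrite <- !Rmult_assoc, <- Rpow_mult_distr.
    replace (-1 * -1) with 1 by ring. rewrite pow1.
    set (ff := fallf _ _) in *; clearbody ff.
    repeat apply Rmult_lt_0_compat; try apply Rinv_0_lt_compat; try apply INR_fact_lt_0; lra. }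
  assert (HXs : forall x, X <= x -> 0 < (-1) ^ S n * lag q (S n) x).
  { intros x Hx. specialize (HXp x Hx). unfold lag. rewrite <- sumR_scal.
    rewrite (sumR_ext _ (fun m => (-1) ^ S n * lagc q (S n) m * x ^ m)) by (intros; ring). lra. }
  (* The last separating point has to lie beyond the largest old root and beyond [X], from which on
     the sign of the leading coefficient decides; for [n = 0] there is no old root. *)
  set (tau := fun j => match j with O => 0 | S i => if lt_dec i n then / s i else
    match n with O => X | S n' => Rmax X (/ s n' + 1) end end).
  assert (Htau : forall j, (j <= S n)%nat -> 0 < (-1) ^ j * lag q (S n) (tau j)).
  { intros [|i] Hj; unfold tau.
    - replace (lag q (S n) 0) with 1; [simpl; lra|].
      now rewrite lag_at_0.
    - destruct (lt_dec i n); [now apply Hsgn|].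
      replace (S i) with (S n) by lia. apply HXs.
      destruct n; [lra|apply Rmax_l]. }
  assert (Hincr : forall j, (j <= n)%nat -> tau j < tau (S j)).
  { intros [|i] Hj; unfold tau.
    - destruct (lt_dec 0 n); [apply Rinv_0_lt_compat; auto|]. destruct n; [lra|lia].
    - destruct (lt_dec i n); [|lia]. destruct (lt_dec (S i) n).
      + apply Rinv_lt_contravar; [apply Rmult_lt_0_compat; apply Hpos; lia|apply Hdec; lia].
      + destruct n; [lia|]. replace i with n by lia.
        eapply Rlt_le_trans; [|apply Rmax_r]. lra. }
  assert (Hroot : forall j, exists x, (j <= n)%nat -> tau j < x < tau (S j) /\ lag q (S n) x = 0).
  { intros j. destruct (le_lt_dec j n) as [Hj|]; [|exists 0; intros; lia].
    assert (H1 := Htau j ltac:(lia)). assert (H2 := Htau (S j) ltac:(lia)).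
    destruct (IVT (fun x => (-1) ^ S j * lag q (S n) x) (tau j) (tau (S j))) as [x [Hx Hx0]]; auto.
    - intros x. apply derivable_continuous_pt, ex_derive_Reals_0.
      apply (ex_derive_mult (fun _ => (-1) ^ S j) (lag q (S n))); [apply ex_derive_const|]. exists (sumR (fun m => lagc q (S n) m * (INR m * x ^ pred m)) (S (S n))).
      apply (is_derive_sumR_pow (lagc q (S n))).
    - simpl; lra.
    - exists x; intros _.
      assert (Z : lag q (S n) x = 0).
      { apply Rmult_integral in Hx0; destruct Hx0 as [E|]; auto.
        exfalso; revert E; apply pow_nonzero; lra. }
      split; auto. split.
      + destruct (proj1 Hx) as [|E]; auto. rewrite E, Z in H1. lra.
      + destruct (proj2 Hx) as [|E]; auto. rewrite <- E, Z in H2. lra. }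
  apply choice in Hroot; destruct Hroot as [r Hr].
  assert (Hr1 : forall i j, (i < j <= n)%nat -> tau (S i) <= tau j).
  { intros i j. induction j; intros H; [lia|].
    destruct (Nat.eq_dec i j) as [->|]; [lra|].
    specialize (IHj ltac:(lia)). specialize (Hincr j ltac:(lia)). lra. }
  assert (Hrinc : forall i j, (i < j < S n)%nat -> r i < r j).
  { intros i j H. destruct (Hr i ltac:(lia)) as [? _]. destruct (Hr j ltac:(lia)) as [? _].
    specialize (Hr1 i j ltac:(lia)). lra. }
  assert (Hrpos : forall j, (j < S n)%nat -> 0 < r j).
  { intros j H. destruct (Hr 0%nat ltac:(lia)) as [H0 _]. unfold tau at 1 in H0.
    destruct j; [lra|]. specialize (Hrinc 0%nat (S j) ltac:(lia)). lra. }
  exists (fun j => / r j). repeat split.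
  - intros j Hj. apply Rinv_0_lt_compat; auto.
  - intros i j Hij. apply Rinv_lt_contravar; [apply Rmult_lt_0_compat; apply Hrpos; lia|auto].
  - destruct (factor_all_roots (S n) (fun m => RtoC (lagc q (S n) m)) (fun j => RtoC (r j))) as [d Hd].
    + intros i j Hij E. apply RtoC_inj in E. specialize (Hrinc i j Hij); lra.
    + intros j Hj. rewrite lag_RtoC. f_equal. apply Hr; lia.
    + assert (G : forall m w, (m <= S n)%nat ->
        (prodC (fun j => w - RtoC (r j)) m = prodC (fun j => 0 - RtoC (r j)) m * prodC (fun j => 1 - RtoC (/ r j) * w) m)%C).
      { induction m; intros w Hm; [simpl; ring|]. rewrite !prodC_S, IHm by lia.
        assert (RtoC (r m) <> 0) by (apply RtoC_neq_0; specialize (Hrpos m ltac:(lia)); lra).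
        rewrite RtoC_inv by (specialize (Hrpos m ltac:(lia)); lra). field; auto. }
      (* The value 1 at 0 absorbs the leading constant and turns factors [w - r_j] into
         [1 - w / r_j]. *)
      assert (H0 := Hd 0%C). rewrite lag_RtoC in H0.
      intros w. rewrite Hd, G by lia. rewrite Cmult_assoc, <- H0.
      rewrite lag_at_0; ring.
Qed.

(** * The Hadamard product of the normalised Bessel function *)

(* [J_q(z) = z^q / (2^q q!) F(z^2)] with [F = besselF q]. *)
Definition Fcoef (q m : nat) : R :=
  (- / 4) ^ m * INR (fact q) / (INR (fact m) * INR (fact (m + q))).

Definition besselF (q : nat) (w : C) : C :=
  iota (T := C_CompleteNormedModule)
    (is_series (K := C_AbsRing) (V := C_NormedModule)
       (fun m => RtoC (Fcoef q m) * w ^ m)%C).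

Lemma sumR_exp_le x n : 0 <= x -> sumR (fun k => x ^ k / INR (fact k)) n <= exp x.
Proof.
  intros Hx. destruct n; [simpl; left; apply exp_pos|].
  eapply Rle_trans; [|apply (exp_ge_taylor x n Hx)].
  right. clear. induction n; simpl; [lra|]. simpl in IHn. rewrite <- IHn. ring.
Qed.

Lemma fact_mult_le m q : (fact m * fact q <= fact (m + q))%nat.
Proof.
  induction q; simpl.
  - rewrite Nat.add_0_r; lia.
  - rewrite Nat.add_succ_r; simpl. nia.
Qed.

Lemma Fcoef_abs_le q m : Rabs (Fcoef q m) <= (/ 4) ^ m / INR (fact m) ^ 2.
Proof.
  unfold Fcoef, Rdiv. rewrite !Rabs_mult, <- RPow_abs, Rabs_Ropp.
  assert (H := INR_fact_lt_0 m). assert (H1 := INR_fact_lt_0 (m + q)). assert (H2 := INR_fact_lt_0 q).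
  rewrite (Rabs_pos_eq (/ 4)) by lra.
  rewrite (Rabs_pos_eq (INR (fact q))) by lra.
  rewrite Rabs_pos_eq.
  2: { left; apply Rinv_0_lt_compat; nra. }
  rewrite Rmult_assoc. apply Rmult_le_compat_l; [apply pow_le; lra|].
  assert (L := le_INR _ _ (fact_mult_le m q)). rewrite mult_INR in L.
  apply Rmult_le_reg_r with (INR (fact m) * INR (fact (m + q)) * INR (fact m)).
  - repeat apply Rmult_lt_0_compat; auto.
  - replace (INR (fact q) * / (INR (fact m) * INR (fact (m + q))) * (INR (fact m) * INR (fact (m + q)) * INR (fact m)))
      with (INR (fact m) * INR (fact q)) by (field; lra).
    replace (/ INR (fact m) ^ 2 * (INR (fact m) * INR (fact (m + q)) * INR (fact m)))
      with (INR (fact (m + q))) by (field; lra). exact L.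
Qed.

Lemma fact_INR_ge_1 m : 1 <= INR (fact m).
Proof. apply (le_INR 1). apply lt_O_fact. Qed.

Lemma Fcoef_abs_le_exp q m : Rabs (Fcoef q m) <= / INR (fact m).
Proof.
  eapply Rle_trans; [apply Fcoef_abs_le|].
  assert (H := fact_INR_ge_1 m).
  assert (0 <= (/ 4) ^ m <= 1).
  { split; [apply pow_le; lra|]. rewrite <- (pow1 m). apply pow_incr; lra. }
  unfold Rdiv. simpl. rewrite Rmult_1_r, Rinv_mult.
  assert (0 < / INR (fact m) <= 1).
  { split; [apply Rinv_0_lt_compat; lra|]. rewrite <- Rinv_1. apply Rinv_le_contravar; lra. }
  nra.
Qed.

Lemma Fterm_sum_le q (y : R) n : 0 <= y ->
  sumR (fun m => Rabs (Fcoef q m) * y ^ m) n <= exp y.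
Proof.
  intros Hy. eapply Rle_trans; [|apply (sumR_exp_le y n Hy)].
  apply sumR_le; intros k _. unfold Rdiv. rewrite Rmult_comm.
  apply Rmult_le_compat_l; [now apply pow_le|apply Fcoef_abs_le_exp].
Qed.

Lemma sumR_sq_le (f : nat -> R) n : (forall k, 0 <= f k) ->
  sumR (fun k => f k ^ 2) n <= sumR f n ^ 2.
Proof.
  intros H. induction n; simpl; [lra|].
  assert (0 <= sumR f n) by (apply sumR_nonneg; auto). specialize (H n). simpl in IHn. nra.
Qed.

(** By [Fcoef_abs_le] the terms at [(2 y)^2] are at most the squares of the terms of [exp y], and a
    sum of squares of nonnegative numbers is at most the square of the sum. Thus [F] has growth
    order one half. *)
Lemma Fterm_sum_growth q (y : R) n : 0 <= y ->
  sumR (fun m => Rabs (Fcoef q m) * ((2 * y) ^ 2) ^ m) n <= exp (2 * y).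
Proof.
  intros Hy. replace (exp (2 * y)) with (exp y * exp y) by (rewrite <- exp_plus; f_equal; ring).
  assert (E := sumR_exp_le y n Hy).
  assert (P : forall k, 0 <= y ^ k / INR (fact k)).
  { intros k. apply Rmult_le_pos; [now apply pow_le|].
    left; apply Rinv_0_lt_compat, INR_fact_lt_0. }
  assert (S2 := sumR_sq_le (fun k => y ^ k / INR (fact k)) n P).
  assert (P2 := sumR_nonneg (fun k => y ^ k / INR (fact k)) n (fun k _ => P k)).
  apply Rle_trans with (sumR (fun k => (y ^ k / INR (fact k)) ^ 2) n); [|nra].
  apply sumR_le; intros k _.
  assert (F := Fcoef_abs_le q k). assert (Hf := INR_fact_lt_0 k).
  assert (Y : 0 <= ((2 * y) ^ 2) ^ k) by (apply pow_le, pow2_ge_0).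
  apply Rle_trans with ((/ 4) ^ k / INR (fact k) ^ 2 * ((2 * y) ^ 2) ^ k); [nra|].
  right. transitivity ((/ 4 * (2 * y) ^ 2) ^ k / INR (fact k) ^ 2).
  - rewrite (Rpow_mult_distr (/ 4)). unfold Rdiv; ring.
  - replace (/ 4 * (2 * y) ^ 2) with (y ^ 2) by field.
    replace ((y ^ 2) ^ k) with ((y ^ k) ^ 2) by (rewrite <- !pow_mult; f_equal; lia). field; lra.
Qed.

Lemma besselF_lim q w : clim (sumC (fun m => RtoC (Fcoef q m) * w ^ m)%C) (besselF q w).
Proof.
  destruct (clim_dominated (fun m => RtoC (Fcoef q m) * w ^ m)%C
    (fun m => Rabs (Fcoef q m) * Cmod w ^ m) (exp (Cmod w))) as [l Hl].
  - intros k. rewrite Cmod_mult, Cmod_R, Cmod_pow. lra.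
  - intros n; apply Fterm_sum_le, Cmod_ge_0.
  - unfold besselF. erewrite (iota_unique _ l); [exact Hl| |].
    + intros y Hy. apply is_series_clim in Hy. eapply clim_unique; eauto.
    + now apply is_series_clim.
Qed.

Lemma besselF_unique q w l : clim (sumC (fun m => RtoC (Fcoef q m) * w ^ m)%C) l -> besselF q w = l.
Proof. intros H. eapply clim_unique; [apply besselF_lim|exact H]. Qed.

(* The Laguerre polynomial at [w / 4n] has the coefficients of [F] up to these factors. *)
Definition fratio (n m : nat) : R := prodR (fun i => 1 - INR i / INR n) m.

Lemma fratio_bounds n m : (m <= n)%nat -> 0 <= fratio n m <= 1.
Proof.
  induction m; intros H; unfold fratio; simpl; [lra|]. fold (fratio n m).
  specialize (IHm ltac:(lia)).
  assert (0 <= INR m) by apply pos_INR.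
  assert (INR m < INR n) by (apply lt_INR; lia).
  assert (0 <= INR m / INR n <= 1).
  { split; [apply Rle_mult_inv_pos; lra|].
    apply Rmult_le_reg_r with (INR n); [lra|]. unfold Rdiv; rewrite Rmult_assoc, Rinv_l; lra. }
  nra.
Qed.

Lemma fratio_lim m : is_lim_seq (fun n => fratio n m) 1.
Proof.
  induction m; unfold fratio; simpl; [apply is_lim_seq_const|].
  replace (Finite 1) with (Finite (1 * (1 - INR m * 0))) by (f_equal; ring).
  apply is_lim_seq_mult'; [exact IHm|].
  apply is_lim_seq_minus'; [apply is_lim_seq_const|].
  apply (is_lim_seq_mult' (fun _ => INR m)); [apply is_lim_seq_const|].
  apply (is_lim_seq_inv INR p_infty); [apply is_lim_seq_INR|easy].
Qed.

Lemma lagc_scaled q n m : (0 < n)%nat ->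
  lagc q n m * (/ (4 * INR n)) ^ m = fratio n m * Fcoef q m.
Proof.
  intros Hn. assert (Hn' : 0 < INR n) by (apply lt_0_INR; auto).
  assert (E : fallf n m = fratio n m * INR n ^ m).
  { induction m; unfold fallf, fratio; simpl; [ring|]. fold (fallf n m) (fratio n m).
    rewrite IHm. field; lra. }
  unfold lagc, Fcoef. rewrite E.
  assert (H := INR_fact_lt_0 m). assert (H1 := INR_fact_lt_0 (m + q)).
  replace (- / 4) with ((-1) * / 4) by field.
  rewrite Rinv_mult, !Rpow_mult_distr.
  assert (Z : (/ INR n) ^ m * INR n ^ m = 1) by (rewrite <- Rpow_mult_distr, Rinv_l, pow1; lra).
  transitivity ((-1) ^ m * fratio n m * ((/ INR n) ^ m * INR n ^ m) * (/ 4) ^ m * INR (fact q) / (INR (fact m) * INR (fact (m + q)))).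
  - field; lra.
  - rewrite Z. field; lra.
Qed.

(** A Jensen-type count of roots in real terms: a small value of the polynomial on the negative axis
    forbids many large reciprocals [s_j]. The bound is independent of [n], as the compactness
    argument requires. *)
Lemma exists_approx q n : exists s : nat -> R, (0 < n)%nat ->
  (forall j, 0 <= s j <= 2 / (INR j + 1) ^ 2) /\ (forall i j, (i <= j)%nat -> s j <= s i) /\
  forall w : C, prodC (fun j => 1 - RtoC (s j) * w)%C n =
    sumC (fun m => RtoC (fratio n m * Fcoef q m) * w ^ m)%C (S n).
Proof.
  destruct (lag_factor q n) as (s & Hpos & Hdec & Hs).
  (* Padding with zeros beyond the degree makes every sequence total while keeping it nonincreasing
     and bounded. *)
  exists (fun j => if lt_dec j n then s j / (4 * INR n) else 0). intros Hn.
  assert (Hn' : 0 < INR n) by (apply lt_0_INR; auto).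
  assert (HP : forall w : C, prodC (fun j => 1 - RtoC (if lt_dec j n then s j / (4 * INR n) else 0) * w)%C n =
    sumC (fun m => RtoC (fratio n m * Fcoef q m) * w ^ m)%C (S n)).
  { intros w.
    rewrite (prodC_ext _ (fun j => 1 - RtoC (s j) * (RtoC (/ (4 * INR n)) * w))%C).
    2: { intros k Hk. destruct (lt_dec k n); [|lia]. unfold Rdiv. rewrite RtoC_mult. ring. }
    rewrite <- Hs. apply sumC_ext; intros k _.
    rewrite Cpow_mult_l, <- RtoC_pow, Cmult_assoc, <- RtoC_mult, lagc_scaled; auto. }
  assert (Hs0 : forall j, 0 <= if lt_dec j n then s j / (4 * INR n) else 0).
  { intros j; destruct (lt_dec j n); [|lra]. apply Rle_mult_inv_pos; [left; auto|lra]. }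
  assert (Hmono : forall i j, (i <= j)%nat -> (if lt_dec j n then s j / (4 * INR n) else 0) <= (if lt_dec i n then s i / (4 * INR n) else 0)).
  { intros i j Hij. specialize (Hs0 i). destruct (lt_dec j n); [|auto].
    destruct (lt_dec i n); [|lia]. destruct (Nat.eq_dec i j) as [->|]; [lra|].
    apply Rmult_le_compat_r; [left; apply Rinv_0_lt_compat; lra|]. left; apply Hdec; lia. }
  set (t := fun j => if lt_dec j n then s j / (4 * INR n) else 0) in *.
  change (forall j, 0 <= t j) in Hs0. change (forall i j, (i <= j)%nat -> t j <= t i) in Hmono.
  change (forall w : C, prodC (fun j => 1 - RtoC (t j) * w)%C n =
    sumC (fun m => RtoC (fratio n m * Fcoef q m) * w ^ m)%C (S n)) in HP.
  split; [|split; auto].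
  intros j; split; [apply Hs0|].
  assert (J : 0 <= INR j) by apply pos_INR.
  destruct (le_lt_dec n j) as [Hj|Hj].
  { unfold t. destruct (lt_dec j n); [lia|]. apply Rle_mult_inv_pos; [lra|]. apply pow_lt; lra. }
  (* With this [x] the product of the [1 + t_i x] is at most [exp (j + 1)], while its first [j + 1]
     factors are at least [1 + t_j x]. Hence [1 + t_j x <= e <= 3], the origin of the constant 2. *)
  set (x := (INR j + 1) ^ 2).
  assert (Hx : 0 < x) by (apply pow_lt; lra).
  assert (B1 : prodR (fun i => 1 + t i * x) n <= exp (INR j + 1)).
  { specialize (HP (RtoC (- x))).
    rewrite (prodC_ext _ (fun i => RtoC (1 + t i * x))) in HP.
    2: { intros; rewrite RtoC_plus, RtoC_opp, RtoC_mult; ring. }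
    rewrite prodC_RtoC in HP.
    rewrite (sumC_ext _ (fun m => RtoC (fratio n m * Fcoef q m * (- x) ^ m))) in HP.
    2: { intros; now rewrite (RtoC_mult (_ * _)), RtoC_pow. }
    rewrite sumC_RtoC in HP. apply RtoC_inj in HP. rewrite HP.
    assert (G := Fterm_sum_growth q ((INR j + 1) / 2) (S n) ltac:(lra)).
    replace (2 * ((INR j + 1) / 2)) with (INR j + 1) in G by field. fold x in G.
    eapply Rle_trans; [|exact G]. apply sumR_le; intros k Hk.
    eapply Rle_trans; [apply Rle_abs|]. rewrite !Rabs_mult, <- RPow_abs, Rabs_Ropp, (Rabs_pos_eq x) by lra.
    destruct (fratio_bounds n k ltac:(lia)). rewrite (Rabs_pos_eq (fratio n k)) by lra.
    assert (0 <= Rabs (Fcoef q k) * x ^ k) by (apply Rmult_le_pos; [apply Rabs_pos|apply pow_le; lra]).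
    nra. }
  assert (B2 : forall m, (m <= S j)%nat -> (1 + t j * x) ^ m <= prodR (fun i => 1 + t i * x) m).
  { assert (T := Hs0 j). induction m; intros Hm; [simpl; lra|]. specialize (IHm ltac:(lia)).
    rewrite prodR_S. simpl. rewrite Rmult_comm.
    assert (t j <= t m) by (apply Hmono; lia).
    apply Rmult_le_compat; auto; try nra. apply pow_le; nra. }
  assert (B3 : prodR (fun i => 1 + t i * x) (S j) <= prodR (fun i => 1 + t i * x) n).
  { assert (P : forall m, 0 < prodR (fun i => 1 + t i * x) m).
    { induction m; [simpl; lra|]. rewrite prodR_S. specialize (Hs0 m). apply Rmult_lt_0_compat; nra. }
    assert (Q : forall m, (S j <= m)%nat ->
      prodR (fun i => 1 + t i * x) (S j) <= prodR (fun i => 1 + t i * x) m).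
    { induction 1 as [|m Hm IH]; [lra|].
      rewrite (prodR_S _ m). specialize (P m). specialize (Hs0 m).
      assert (0 <= t m * x) by nra. nra. }
    apply Q; lia. }
  assert (B4 : (1 + t j * x) ^ S j <= exp 1 ^ S j).
  { assert (X := B2 (S j) (Nat.le_refl _)); rewrite prodR_S in *.
    replace (exp 1 ^ S j) with (exp (INR j + 1)); [lra|].
    rewrite <- S_INR. clear. induction (S j) as [|k IH]; [simpl; apply exp_0|].
    rewrite S_INR, exp_plus, IH. simpl; ring. }
  assert (B5 : 1 + t j * x <= exp 1).
  { destruct (Rle_lt_dec (1 + t j * x) (exp 1)) as [|L]; auto.
    assert (exp 1 ^ S j < (1 + t j * x) ^ S j).
    { assert (E := exp_pos 1). revert L. generalize (1 + t j * x). intros y L. clear - L E.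
      induction j as [|m IHm]; [simpl; lra|].
      assert (0 < exp 1 ^ S m) by (apply pow_lt; auto).
      change (exp 1 * exp 1 ^ S m < y * y ^ S m).
      apply Rmult_le_0_lt_compat; try assumption; lra. }
    lra. }
  assert (E3 := exp_le_3).
  apply Rmult_le_reg_r with x; auto.
  replace (2 / x * x) with 2 by (field; lra). change (t j * x <= 2). assert (E5 := Rle_trans _ _ _ B5 E3). clear - E5. lra.
Qed.

Lemma bounded_subseq (v : nat -> R) (B : R) : (forall n, 0 <= v n <= B) ->
  exists psi : nat -> nat, (forall m, (m <= psi m)%nat) /\
    exists l : R, is_lim_seq (fun m => v (psi m)) l.
Proof.
  intros H.
  destruct (Bolzano_Weierstrass v _ (compact_P3 0 B) H) as [l Hl].
  assert (P : forall m, exists p, (m <= p)%nat /\ Rabs (v p - l) < / (INR m + 1)).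
  { intros m. assert (J := pos_INR m).
    assert (Hp : 0 < / (INR m + 1)) by (apply Rinv_0_lt_compat; lra).
    apply (Hl (disc l (mkposreal _ Hp)) m).
    exists (mkposreal _ Hp). intros x Hx; exact Hx. }
  apply choice in P; destruct P as [psi Hpsi].
  exists psi; split; [apply Hpsi|]. exists l.
  apply is_lim_seq_spec; intros eps.
  destruct (archimed_cor1 eps (cond_pos eps)) as (N & HN & HN0).
  exists N; intros n Hn. destruct (Hpsi n) as [_ Hd].
  eapply Rlt_trans; [exact Hd|]. eapply Rle_lt_trans; [|exact HN].
  apply Rinv_le_contravar; [now apply lt_0_INR|].
  assert (INR N <= INR n) by (apply le_INR; auto). lra.
Qed.

Lemma is_lim_seq_subseq_ge (v : nat -> R) (l : R) (m : nat -> nat) :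
  (forall n, (n <= m n)%nat) -> is_lim_seq v l -> is_lim_seq (fun n => v (m n)) l.
Proof.
  intros Hm H. apply is_lim_seq_spec; apply is_lim_seq_spec in H.
  intros eps; destruct (H eps) as [N HN]; exists N; intros n Hn.
  apply HN. specialize (Hm n); lia.
Qed.

(** Cantor's diagonal: [ph (S j)] refines [ph j] so that column [j] converges along it, and the
    diagonal is eventually a selection from each [ph j]. *)
Lemma diagonal_subseq (u : nat -> nat -> R) (B : R) : (forall n j, 0 <= u n j <= B) ->
  exists phi : nat -> nat, (forall m, (m <= phi m)%nat) /\
    forall j, exists l : R, is_lim_seq (fun m => u (phi m) j) l.
Proof.
  intros H.
  destruct (choice (fun (v : nat -> R) (psi : nat -> nat) => (forall n, 0 <= v n <= B) ->
    (forall m, (m <= psi m)%nat) /\ exists l : R, is_lim_seq (fun m => v (psi m)) l)) as [bw Hbw].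
  { intros v. destruct (classic (forall n, 0 <= v n <= B)) as [Hv|Hv].
    - destruct (bounded_subseq v B Hv) as [psi Hpsi]. exists psi; auto.
    - exists (fun m => m); intros; contradiction. }
  set (step := fun (phi : nat -> nat) j => bw (fun n => u (phi n) j)).
  set (ph := fix ph (j : nat) : nat -> nat :=
    match j with O => fun m => m | S i => fun m => ph i (step (ph i) i m) end).
  assert (Hstep : forall j m, (m <= step (ph j) j m)%nat) by (intros j; apply Hbw; intros; apply H).
  assert (Hge : forall j m, (m <= ph j m)%nat).
  { induction j; intros m; simpl; [lia|].
    specialize (Hstep j m). specialize (IHj (step (ph j) j m)). lia. }
  assert (Hsub : forall j k m, exists m', (m <= m')%nat /\ ph (j + k)%nat m = ph j m').
  { induction k; intros m.
    - exists m; rewrite Nat.add_0_r; auto.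
    - rewrite Nat.add_succ_r; simpl.
      destruct (IHk (step (ph (j + k)%nat) (j + k)%nat m)) as (m' & H1 & H2).
      exists m'; split; auto. specialize (Hstep (j + k)%nat m); lia. }
  exists (fun m => ph m m); split; [auto|].
  intros j.
  destruct (proj2 (Hbw (fun n => u (ph j n) j) (fun n => H _ _))) as [l Hl].
  exists l.
  (* The diagonal entry of index [m] factors through [ph (S j)] only for [m >= S j], hence the
     shift. *)
  apply (is_lim_seq_incr_n _ (S j)).
  assert (C : forall n, exists m', (n <= m')%nat /\ ph (n + S j)%nat (n + S j)%nat = ph (S j) m').
  { intros n. destruct (Hsub (S j) n (n + S j)%nat) as (m' & H1 & H2).
    exists m'; split; [lia|]. rewrite <- H2. f_equal; lia. }
  apply choice in C; destruct C as [m' Hm'].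
  apply is_lim_seq_ext with (fun n => u (ph (S j) (m' n)) j).
  { intros n. now rewrite (proj2 (Hm' n)). }
  apply (is_lim_seq_subseq_ge (fun n => u (ph (S j) n) j)); [apply Hm'|exact Hl].
Qed.

Lemma Cmod_prodC_le (a : nat -> C) (M : nat -> R) n :
  (forall k, Cmod (a k) <= M k) ->
  Cmod (prodC (fun k => 1 + a k)%C n) <= exp (sumR M n).
Proof.
  intros H; induction n; simpl; [rewrite Cmod_1, exp_0; lra|].
  rewrite Cmod_mult, exp_plus.
  apply Rmult_le_compat; auto using Cmod_ge_0.
  eapply Rle_trans; [apply Cmod_triangle|]. rewrite Cmod_1.
  specialize (H n). assert (E := exp_ineq1_le (M n)). lra.
Qed.

(** The estimate depends on [a] only through the majorant [M], hence is uniform over all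
    approximating polynomials; this permits exchanging their limit with the infinite product. *)
Lemma prodC_tail (a : nat -> C) (M : nat -> R) (B : R) N n :
  (forall k, Cmod (a k) <= M k) -> (forall n, sumR M n <= B) -> (N <= n)%nat ->
  Cmod (prodC (fun k => 1 + a k)%C n - prodC (fun k => 1 + a k)%C N)
    <= exp B * (sumR M n - sumR M N).
Proof.
  intros H HB Hn; induction Hn as [|n Hn IH].
  - rewrite Rminus_diag, Rmult_0_r. replace (_ - _)%C with (RtoC 0) by ring. rewrite Cmod_0; lra.
  - rewrite prodC_S, sumR_S.
    replace (_ - _)%C with ((prodC (fun k => 1 + a k) n - prodC (fun k => 1 + a k) N)
      + prodC (fun k => 1 + a k) n * a n)%C by ring.
    eapply Rle_trans; [apply Cmod_triangle|]. rewrite Cmod_mult.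
    assert (P := Cmod_prodC_le a M n H).
    assert (E : exp (sumR M n) <= exp B) by (destruct (HB n) as [L|<-]; [left; now apply exp_increasing|lra]).
    assert (Cmod (prodC (fun k => (1 + a k)%C) n) * Cmod (a n) <= exp B * M n).
    { apply Rmult_le_compat; auto using Cmod_ge_0. lra. }
    lra.
Qed.

(** Telescoping against [4 - 2 / n], the sum of the first [n] terms without the factor [c]. *)
Lemma sum_inv_sq_le c n : 0 <= c -> sumR (fun k => c * (2 / (INR k + 1) ^ 2)) n <= c * 4.
Proof.
  intros Hc. destruct n; [simpl; lra|].
  assert (G : sumR (fun k => c * (2 / (INR k + 1) ^ 2)) (S n) <= c * (4 - 2 / (INR n + 1))).
  { induction n; [simpl; right; field|].
    rewrite sumR_S. eapply Rle_trans; [apply Rplus_le_compat_r, IHn|].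
    rewrite <- Rmult_plus_distr_l. apply Rmult_le_compat_l; auto.
    rewrite S_INR. assert (J := pos_INR n).
    assert (E : 2 / (INR n + 1) - 2 / (INR n + 1 + 1) - 2 / (INR n + 1 + 1) ^ 2 =
      2 / ((INR n + 1) * (INR n + 1 + 1) ^ 2)) by (field; lra).
    assert (0 < 2 / ((INR n + 1) * (INR n + 1 + 1) ^ 2)); [|lra].
    apply Rdiv_lt_0_compat; [lra|]. apply Rmult_lt_0_compat; [lra|apply pow_lt; lra]. }
  eapply Rle_trans; [exact G|]. apply Rmult_le_compat_l; auto.
  assert (J := pos_INR n).
  assert (0 < 2 / (INR n + 1)) by (apply Rdiv_lt_0_compat; lra). lra.
Qed.

Lemma approx_lim q w :
  clim (fun n => sumC (fun m => RtoC (fratio n m * Fcoef q m) * w ^ m)%C (S n)) (besselF q w).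
Proof.
  (* A polynomial of degree [n] has [n + 1] terms while row [N] of the array has [N], so row [N]
     carries the polynomial of degree [pred N]. *)
  destruct (tannery (fun n m => RtoC (fratio (pred n) m * Fcoef q m) * w ^ m)%C
    (fun m => RtoC (Fcoef q m) * w ^ m)%C (fun m => Rabs (Fcoef q m) * Cmod w ^ m) (exp (Cmod w)))
    as (l & H1 & H2).
  - intros N k Hk. rewrite Cmod_mult, Cmod_R, Cmod_pow, Rabs_mult.
    destruct (fratio_bounds (pred N) k ltac:(lia)).
    rewrite (Rabs_pos_eq (fratio _ _)) by lra.
    apply Rmult_le_compat_r; [apply pow_le, Cmod_ge_0|].
    assert (T := Rabs_pos (Fcoef q k)). nra.
  - intros k. apply clim_mult; [|apply clim_const]. apply clim_RtoC.
    replace (Finite (Fcoef q k)) with (Finite (1 * Fcoef q k)) by (f_equal; ring).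
    apply is_lim_seq_mult'; [|apply is_lim_seq_const].
    apply (is_lim_seq_incr_1 (fun n => fratio (pred n) k)). apply fratio_lim.
  - intros n; apply Fterm_sum_le, Cmod_ge_0.
  - apply besselF_unique in H1. subst l.
    apply (clim_incr_1 (fun N => sumC (fun m => RtoC (fratio (pred N) m * Fcoef q m) * w ^ m)%C N)). exact H2.
Qed.

(** At this stage the limits [sigma j] might vanish or coincide; [roots_product] identifies them
    with the reciprocals of the zeros. *)
Lemma besselF_product q : exists sigma : nat -> R,
  (forall j, 0 <= sigma j <= 2 / (INR j + 1) ^ 2) /\ (forall i j, (i <= j)%nat -> sigma j <= sigma i) /\
  forall w, clim (prodC (fun j => 1 - RtoC (sigma j) * w)%C) (besselF q w).
Proof.
  destruct (choice _ (exists_approx q)) as [s Hs].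
  destruct (diagonal_subseq (fun n => s (S n)) 2) as (phi & Hphi & Hlim).
  { intros n j. destruct (Hs (S n) ltac:(lia)) as [B _]. destruct (B j) as [B1 B2].
    split; auto. eapply Rle_trans; [exact B2|].
    assert (J := pos_INR j).
    assert (1 <= (INR j + 1) ^ 2) by nra.
    apply Rmult_le_reg_r with ((INR j + 1) ^ 2); [lra|].
    replace (2 / (INR j + 1) ^ 2 * (INR j + 1) ^ 2) with 2 by (field; lra). lra. }
  apply choice in Hlim; destruct Hlim as [sigma Hsig].
  exists sigma. split; [|split].
  - intros j. split.
    + apply (is_lim_seq_le (fun _ => 0) _ 0 (sigma j)) with (2 := is_lim_seq_const 0) (3 := Hsig j).
      intros n; apply (Hs (S (phi n))); lia.
    + apply (is_lim_seq_le _ (fun _ => 2 / (INR j + 1) ^ 2) (sigma j) (2 / (INR j + 1) ^ 2)) with (2 := Hsig j) (3 := is_lim_seq_const _).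
      intros n; apply (Hs (S (phi n))); lia.
  - intros i j Hij.
    apply (is_lim_seq_le _ _ (sigma j) (sigma i)) with (2 := Hsig j) (3 := Hsig i).
    intros n; apply (Hs (S (phi n))); lia.
  - intros w.
    set (M := fun k => Cmod w * (2 / (INR k + 1) ^ 2)).
    assert (HM : forall k, 0 <= M k).
    { intros k; apply Rmult_le_pos; [apply Cmod_ge_0|]. apply Rle_mult_inv_pos; [lra|].
      apply pow_lt; assert (J := pos_INR k); lra. }
    assert (HB : forall n, sumR M n <= Cmod w * 4) by (intros; apply sum_inv_sq_le, Cmod_ge_0).
    destruct (bounded_sums_lim M _ HM HB) as (T & HT & HT').
    (* For fixed [N], the full approximating product and its first [N] factors are compared along
       the subsequence; their distance is bounded by the tail of [M] and the bound passes to the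
       limit. *)
    apply clim_squeeze with (fun N => exp (Cmod w * 4) * (T - sumR M N)).
    2: { replace (Finite 0) with (Finite (exp (Cmod w * 4) * (T - T))) by (f_equal; ring).
         apply is_lim_seq_mult'; [apply is_lim_seq_const|].
         apply is_lim_seq_minus'; [apply is_lim_seq_const|exact HT]. }
    intros N.
    assert (L1 : clim (fun n => prodC (fun j => 1 - RtoC (s (S (phi n)) j) * w)%C (S (phi n))) (besselF q w)).
    { apply clim_ext with (fun n => sumC (fun m => RtoC (fratio (S (phi n)) m * Fcoef q m) * w ^ m)%C (S (S (phi n)))).
      { intros n. symmetry. apply (Hs (S (phi n))); lia. }
      unfold clim.
      apply (is_lim_seq_subseq_ge (fun n => Cmod (sumC (fun m => RtoC (fratio n m * Fcoef q m) * w ^ m)%C (S n) - besselF q w)) 0 (fun n => S (phi n))).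
      - intros n. specialize (Hphi n). lia.
      - apply approx_lim. }
    assert (L2 : clim (fun n => prodC (fun j => 1 - RtoC (s (S (phi n)) j) * w)%C N)
       (prodC (fun j => 1 - RtoC (sigma j) * w)%C N)).
    { apply clim_prodC; intros k _. apply clim_minus; [apply clim_const|].
      apply clim_mult; [|apply clim_const]. apply clim_RtoC, Hsig. }
    assert (L := clim_minus _ _ _ _ L2 L1).
    apply (clim_incr_n _ _ N) in L. cbv beta in L.
    apply (clim_Cmod_le _ _ _ L).
    intros n. set (m := S (phi (n + N)%nat)).
    assert (Hm : (N <= m)%nat) by (unfold m; specialize (Hphi (n + N)%nat); lia).
    rewrite <- Cmod_opp, Copp_minus_distr.
    assert (P := prodC_tail (fun j => - (RtoC (s m j) * w))%C M (Cmod w * 4) N m).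
    eapply Rle_trans; [apply P; auto|].
    + intros k. rewrite Cmod_opp, Cmod_mult, Cmod_R.
      destruct (Hs m ltac:(lia)) as [Hb _]. destruct (Hb k). rewrite Rabs_pos_eq by auto.
      unfold M. rewrite Rmult_comm. apply Rmult_le_compat_l; auto using Cmod_ge_0.
    + apply Rmult_le_compat_l; [left; apply exp_pos|]. specialize (HT' m). lra.
Qed.

(** * The real function F *)

Definition Fr (q : nat) : R -> R := PSeries (Fcoef q).
Definition Fr1 (q : nat) : R -> R := PSeries (PS_derive (Fcoef q)).
Definition Fr2 (q : nat) : R -> R := PSeries (PS_derive (PS_derive (Fcoef q))).

Lemma Fcoef_0 q : Fcoef q 0 = 1.
Proof. unfold Fcoef; simpl. assert (H := INR_fact_neq_0 q). field; auto. Qed.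

Lemma Fcoef_S q m :
  Fcoef q (S m) = - Fcoef q m / (4 * (INR m + 1) * (INR m + 1 + INR q)).
Proof.
  unfold Fcoef. change (S m + q)%nat with (S (m + q)).
  rewrite !fact_simpl, !mult_INR, !S_INR, plus_INR. simpl pow.
  assert (H := INR_fact_neq_0 m). assert (H1 := INR_fact_neq_0 (m + q)).
  assert (H2 := pos_INR m). assert (H3 := pos_INR q).
  field; repeat split; auto; lra.
Qed.

Lemma Fcoef_neq_0 q m : Fcoef q m <> 0.
Proof.
  unfold Fcoef, Rdiv. assert (H := INR_fact_neq_0 m). assert (H1 := INR_fact_neq_0 (m + q)).
  assert (H2 := INR_fact_neq_0 q).
  repeat apply Rmult_integral_contrapositive_currified; auto.
  - apply pow_nonzero; lra.
  - apply Rinv_neq_0_compat; auto.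
Qed.

Lemma Fr_radius q : CV_radius (Fcoef q) = p_infty.
Proof.
  apply CV_radius_infinite_DAlembert; [apply Fcoef_neq_0|].
  apply is_lim_seq_le_le with (fun _ => 0) (fun n => / INR (S n)).
  - intros n. rewrite Fcoef_S. assert (N := Fcoef_neq_0 q n).
    assert (H2 := pos_INR n). assert (H3 := pos_INR q).
    split; [apply Rabs_pos|].
    replace (- Fcoef q n / (4 * (INR n + 1) * (INR n + 1 + INR q)) / Fcoef q n)
      with (- / (4 * (INR n + 1) * (INR n + 1 + INR q))) by (field; repeat split; auto; lra).
    rewrite Rabs_Ropp, Rabs_pos_eq, S_INR.
    + apply Rinv_le_contravar; [lra|]. nra.
    + left; apply Rinv_0_lt_compat. nra.
  - apply is_lim_seq_const.
  - apply (is_lim_seq_incr_1 (fun n => / INR n)).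
    apply (is_lim_seq_inv INR p_infty); [apply is_lim_seq_INR|easy].
Qed.

Lemma is_derive_Fr q (x : R) : is_derive (Fr q) x (Fr1 q x).
Proof. apply is_derive_PSeries. now rewrite Fr_radius. Qed.

Lemma is_derive_Fr1 q (x : R) : is_derive (Fr1 q) x (Fr2 q x).
Proof. apply is_derive_PSeries. now rewrite CV_radius_derive, Fr_radius. Qed.

(** Bessel's equation after [w = z^2] and division by [z^q]; coefficientwise it is the recurrence
    [Fcoef_S]. *)
Lemma Fr_ode q x : x * Fr2 q x + (INR q + 1) * Fr1 q x + / 4 * Fr q x = 0.
Proof.
  unfold Fr, Fr1, Fr2.
  assert (R0 : Rbar_lt (Rabs x) (CV_radius (Fcoef q))) by now rewrite Fr_radius.
  assert (E0 : ex_pseries (Fcoef q) x) by now apply CV_radius_inside.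
  assert (E1 : ex_pseries (PS_derive (Fcoef q)) x) by now apply ex_pseries_derive.
  assert (E2 : ex_pseries (PS_derive (PS_derive (Fcoef q))) x)
    by (apply ex_pseries_derive; now rewrite CV_radius_derive).
  rewrite <- PSeries_incr_1, <- !PSeries_scal.
  assert (P1 := ex_pseries_incr_1 _ _ E2).
  assert (P2 := ex_pseries_scal (INR q + 1) _ x (Rmult_comm _ _) E1).
  assert (P3 := ex_pseries_scal (/ 4) _ x (Rmult_comm _ _) E0).
  rewrite <- (PSeries_plus _ _ x P1 P2), <- (PSeries_plus _ _ x (ex_pseries_plus _ _ _ P1 P2) P3).
  rewrite <- (PSeries_const_0 x). apply PSeries_ext. intros n.
  unfold PS_plus, PS_scal, PS_incr_1, PS_derive, plus, scal, mult; simpl; unfold mult; simpl.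
  assert (H2 := pos_INR n). assert (H3 := pos_INR q).
  destruct n as [|n].
  - rewrite Fcoef_S, Fcoef_0. simpl. unfold zero; simpl. field; lra.
  - rewrite (Fcoef_S q (S n)), !S_INR in *.
    replace (match n with 0%nat => 1 | S _ => INR n + 1 end) with (INR n + 1)
      by (destruct n; simpl; ring).
    field; split; lra.
Qed.

Lemma Fr_0 q : Fr q 0 = 1.
Proof. unfold Fr. rewrite PSeries_0. apply Fcoef_0. Qed.

Lemma Fr_lim q x : is_lim_seq (sumR (fun m => Fcoef q m * x ^ m)) (Fr q x).
Proof.
  apply is_series_sumR.
  assert (E0 : ex_pseries (Fcoef q) x) by (apply CV_radius_inside; now rewrite Fr_radius).
  apply PSeries_correct in E0. unfold is_pseries in E0.
  eapply is_series_ext; [|exact E0].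
  intros n; simpl. rewrite pow_n_pow. unfold scal; simpl; unfold mult; simpl. ring.
Qed.

Lemma besselF_RtoC q x : besselF q (RtoC x) = RtoC (Fr q x).
Proof.
  apply besselF_unique.
  eapply clim_ext; [|apply clim_RtoC, (Fr_lim q x)].
  intros n; simpl. rewrite <- sumC_RtoC. apply sumC_ext; intros k _.
  now rewrite RtoC_mult, RtoC_pow.
Qed.

Lemma continuity_pt_of_derive f x l : is_derive f x l -> continuity_pt f x.
Proof. intros H. apply derivable_continuous_pt, ex_derive_Reals_0. now exists l. Qed.

Lemma increasing_of_derive (f df : R -> R) a b : a <= b ->
  (forall x, a <= x <= b -> is_derive f x (df x)) -> (forall x, a <= x <= b -> 0 <= df x) ->
  f a <= f b.
Proof.
  intros Hab Hd Hp.
  destruct (MVT_gen f a b df) as (c & Hc & E);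
    rewrite Rmin_left, Rmax_right in * by auto.
  - intros x Hx; apply Hd; lra.
  - intros x Hx; eapply continuity_pt_of_derive, Hd; lra.
  - specialize (Hp c Hc). nra.
Qed.

(* The quantity [(z J')^2 + (z^2 - q^2) J^2] at [w = z^2], up to a constant factor. *)
Definition Phi (q : nat) (w : R) : R :=
  w ^ S q * (4 * w * Fr1 q w ^ 2 + 4 * INR q * Fr q w * Fr1 q w + Fr q w ^ 2).

Lemma is_derive_Phi q (w : R) : is_derive (Phi q) w (w ^ q * Fr q w ^ 2).
Proof.
  unfold Phi.
  assert (H0 := is_derive_Fr q w). assert (H1 := is_derive_Fr1 q w).
  auto_derive.
  - repeat split; auto; eexists; eauto.
  - change (fun x : R => Fr q x) with (Fr q). change (fun x : R => Fr1 q x) with (Fr1 q).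
    rewrite (is_derive_unique _ _ _ H0), (is_derive_unique _ _ _ H1).
    assert (O := Fr_ode q w).
    set (F := Fr q w) in *. set (F1 := Fr1 q w) in *. set (F2 := Fr2 q w) in *.
    assert (O' : w * F2 = - (INR q + 1) * F1 - / 4 * F) by lra.
    replace (match q with O => 1 | S _ => INR q + 1 end) with (INR q + 1) by (destruct q; simpl; ring).
    simpl pow.
    match goal with |- ?l = ?r => transitivity (w ^ q * ((INR q + 1) * (4 * w * F1 ^ 2 + 4 * INR q * F * F1 + F ^ 2)
      + (4 * w * F1 ^ 2 + 8 * F1 * (w * F2) * w + 4 * INR q * F1 ^ 2 * w + 4 * INR q * F * (w * F2) + 2 * w * F * F1))) end.
    + ring.
    + rewrite O'. field.
Qed.

(** [Phi] vanishes at 0 and its derivative [w^q F^2] is nonnegative; as [F(0) = 1], it is strictly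
    positive on a short interval to the right of 0, which suffices. At a zero of [F] this says that
    the zero is simple. *)
Lemma Phi_pos q w : 0 < w -> 0 < Phi q w.
Proof.
  intros Hw.
  assert (Hc : continuity_pt (Fr q) 0) by (eapply continuity_pt_of_derive, is_derive_Fr).
  destruct (Hc (/ 2) ltac:(lra)) as (d & Hd & HF).
  set (y := Rmin w (d / 2)).
  assert (Hy : 0 < y /\ y <= w /\ y < d).
  { unfold y. assert (M1 := Rmin_l w (d / 2)). assert (M2 := Rmin_r w (d / 2)).
    assert (M3 : 0 < Rmin w (d / 2)) by (apply Rmin_glb_lt; lra). lra. }
  assert (Hmono : forall a b, 0 <= a <= b -> Phi q a <= Phi q b).
  { intros a b Hab. apply increasing_of_derive with (fun w => w ^ q * Fr q w ^ 2); [lra| |].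
    - intros; apply is_derive_Phi.
    - intros x Hx; apply Rmult_le_pos; [apply pow_le; lra|apply pow2_ge_0]. }
  assert (Z : Phi q 0 = 0) by (unfold Phi; simpl; ring).
  assert (H1 := Hmono 0 (y / 2) ltac:(lra)). assert (H2 := Hmono y w ltac:(lra)).
  destruct (MVT_gen (Phi q) (y / 2) y (fun w => w ^ q * Fr q w ^ 2)) as (c & Hcc & E);
    rewrite Rmin_left, Rmax_right in * by lra.
  - intros x _; apply is_derive_Phi.
  - intros x _; eapply continuity_pt_of_derive, is_derive_Phi.
  - assert (0 < Fr q c).
    { assert (D : D_x no_cond 0 c /\ R_dist c 0 < d).
      { split; [split; [exact I|lra]|]. unfold R_dist. rewrite Rminus_0_r, Rabs_pos_eq; lra. }
      specialize (HF c D). simpl in HF. unfold R_dist in HF. rewrite Fr_0 in HF.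
      apply Rabs_def2 in HF. lra. }
    assert (0 < c ^ q * Fr q c ^ 2) by (apply Rmult_lt_0_compat; apply pow_lt; lra).
    nra.
Qed.

Lemma Phi_at_root q r : Fr q r = 0 -> Phi q r = 4 * r ^ q * (r * Fr1 q r) ^ 2.
Proof. intros H; unfold Phi; rewrite H; simpl; ring. Qed.

Lemma Fr_root_simple q r : 0 < r -> Fr q r = 0 -> Fr1 q r <> 0.
Proof.
  intros Hr H E. assert (P := Phi_pos q r Hr). rewrite Phi_at_root, E in P by auto.
  rewrite Rmult_0_r in P. simpl in P. lra.
Qed.

Lemma Phi_increasing q a b : 0 <= a <= b -> Phi q a <= Phi q b.
Proof.
  intros Hab. apply increasing_of_derive with (fun w => w ^ q * Fr q w ^ 2); [lra| |].
  - intros; apply is_derive_Phi.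
  - intros x Hx; apply Rmult_le_pos; [apply pow_le; lra|apply pow2_ge_0].
Qed.

(* In the variable [z] this is [z] times the energy [u'^2 + (1 - (q^2 - 1/4)/z^2) u^2]
   of [u = sqrt z J], which does not decay. *)
Definition Theta (q : nat) (w : R) : R :=
  Phi q w + w ^ q * (INR q * Fr q w ^ 2 + 2 * w * Fr q w * Fr1 q w + Fr q w ^ 2 / 2).

Lemma is_derive_Theta q (w : R) : 0 < w ->
  is_derive (Theta q) w ((Theta q w + (2 * INR q ^ 2 - / 2) * w ^ q * Fr q w ^ 2) / (2 * w)).
Proof.
  intros Hw. unfold Theta at 1.
  assert (HP := is_derive_Phi q w).
  assert (H0 := is_derive_Fr q w). assert (H1 := is_derive_Fr1 q w).
  auto_derive.
  - repeat split; auto; eexists; eauto.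
  - change (fun x : R => Fr q x) with (Fr q). change (fun x : R => Fr1 q x) with (Fr1 q). change (fun x : R => Phi q x) with (Phi q).
    rewrite (is_derive_unique _ _ _ H0), (is_derive_unique _ _ _ H1), (is_derive_unique _ _ _ HP).
    assert (O := Fr_ode q w). unfold Theta, Phi.
    set (F := Fr q w) in *. set (F1 := Fr1 q w) in *. set (F2 := Fr2 q w) in *.
    assert (O' : F2 = (- (INR q + 1) * F1 - / 4 * F) / w) by (field_simplify_eq; lra).
    rewrite O'.
    destruct q as [|q].
    + simpl. field. lra.
    + simpl pred. simpl pow.
      change (match q with O => 1 | S _ => INR q + 1 end) with (INR (S q)). field. lra.
Qed.

Lemma Theta_at_root q r : Fr q r = 0 -> Theta q r = Phi q r.
Proof. intros H; unfold Theta; rewrite H; simpl. field. Qed.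

(** Completing the square in [Theta] leaves [(w - q^2 + 1/4) F^2], whose coefficient exceeds 1 in
    this range. *)
Lemma Theta_lower q w : INR q ^ 2 + 1 <= w -> w ^ q * Fr q w ^ 2 <= Theta q w.
Proof.
  intros Hw. unfold Theta, Phi. change (w ^ S q) with (w * w ^ q).
  assert (0 <= w) by (assert (T := pow2_ge_0 (INR q)); lra).
  set (F := Fr q w). set (F1 := Fr1 q w).
  replace (w * w ^ q * (4 * w * F1 ^ 2 + 4 * INR q * F * F1 + F ^ 2) +
    w ^ q * (INR q * F ^ 2 + 2 * w * F * F1 + F ^ 2 / 2)) with
    (w ^ q * ((INR q * F + 2 * w * F1 + F / 2) ^ 2 + (w - INR q ^ 2 + / 4) * F ^ 2)) by field.
  apply Rmult_le_compat_l; [apply pow_le; auto|].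
  assert (T1 := pow2_ge_0 (INR q * F + 2 * w * F1 + F / 2)).
  nra.
Qed.

(** [Theta] behaves like [sqrt w], but [Theta^2 / w] would have a derivative of the wrong sign for
    [q = 0]. With exponent 4 the derivative involves [Theta + (4 q^2 - 1) w^q F^2], nonnegative by
    [Theta_lower]; growth like [w^(1/4)] is enough for divergence. *)
Lemma Theta_growth q a b : INR q ^ 2 + 1 <= a -> a <= b ->
  Theta q a ^ 4 / a <= Theta q b ^ 4 / b.
Proof.
  intros Ha Hab.
  assert (T0 := pow2_ge_0 (INR q)).
  set (dT := fun w => (Theta q w + (2 * INR q ^ 2 - / 2) * w ^ q * Fr q w ^ 2) / (2 * w)).
  apply increasing_of_derive with
    (f := fun w => Theta q w ^ 4 / w)
    (df := fun w => Theta q w ^ 3 * (4 * w * dT w - Theta q w) / w ^ 2); auto.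
  - intros x Hx. assert (D := is_derive_Theta q x ltac:(lra)).
    auto_derive.
    + split; [eexists; eauto|]. split; auto. lra.
    + change (fun x : R => Theta q x) with (Theta q). rewrite (is_derive_unique _ _ _ D).
      fold (dT x). simpl. field. lra.
  - intros x Hx. assert (L := Theta_lower q x ltac:(lra)).
    assert (P : 0 <= x ^ q * Fr q x ^ 2)
      by (apply Rmult_le_pos; [apply pow_le; lra|apply pow2_ge_0]).
    apply Rmult_le_pos; [apply Rmult_le_pos|].
    + apply pow_le; lra.
    + unfold dT. replace (4 * x * ((Theta q x + (2 * INR q ^ 2 - / 2) * x ^ q * Fr q x ^ 2) / (2 * x)))
        with (2 * Theta q x + (4 * INR q ^ 2 - 1) * (x ^ q * Fr q x ^ 2)) by (field; lra). nra.
    + left; apply Rinv_0_lt_compat, pow_lt; lra.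
Qed.

(** * Tools: infinite products, difference quotients, alternating sums, geometric expansions *)

(** Past the index where the remaining sum is below one half, the inequality
    [1 - sum a_k <= prod (1 - a_k)] keeps the tail of the product at least one half. *)
Lemma prod_lim_neq_0 (a : nat -> R) (B l : R) :
  (forall k, 0 <= a k) -> (forall n, sumR a n <= B) -> (forall k, 1 - a k <> 0) ->
  is_lim_seq (prodR (fun k => 1 - a k)) l -> l <> 0.
Proof.
  intros Ha HB Hne Hl.
  destruct (bounded_sums_lim a B Ha HB) as (T & HT & HT').
  apply is_lim_seq_spec in HT. destruct (HT (mkposreal (/ 2) ltac:(lra))) as [N HN].
  specialize (HN N (Nat.le_refl N)). simpl in HN. apply Rabs_def2 in HN.
  assert (Htail : forall n, sumR (fun k => a (N + k)%nat) n <= / 2).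
  { intros n. assert (E := sumR_split a N n). specialize (HT' (N + n)%nat). lra. }
  assert (G : forall n, 1 - sumR (fun k => a (N + k)%nat) n <= prodR (fun k => 1 - a (N + k)%nat) n
     /\ prodR (fun k => 1 - a (N + k)%nat) n <= 1).
  { induction n; [simpl; lra|].
    specialize (Htail n) as H1. rewrite sumR_S in *. rewrite prodR_S.
    specialize (Ha (N + n)%nat). nra. }
  set (p := Rabs (prodR (fun k => 1 - a k) N)).
  assert (Hp : 0 < p) by (apply Rabs_pos_lt, prodR_neq_0; auto).
  assert (L : forall n, p * / 2 <= Rabs (prodR (fun k => 1 - a k) (N + n))).
  { intros n. rewrite prodR_split, Rabs_mult. fold p. apply Rmult_le_compat_l; [lra|].
    destruct (G n) as [G1 _]. specialize (Htail n). rewrite Rabs_pos_eq; lra. }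
  intros ->. apply is_lim_seq_spec in Hl. destruct (Hl (mkposreal (p * / 2) ltac:(lra))) as [M HM].
  specialize (HM (N + M)%nat ltac:(lia)). simpl in HM. rewrite Rminus_0_r in HM. specialize (L M). lra.
Qed.

(** Only continuity of [U] at [r] is assumed, and differentiability is a conclusion. Here [U] will
    contain an infinite tail product, which thereby need not be differentiated factor by factor. *)
Lemma quotient_derive (F F1 U : R -> R) (r F2 d : R) : 0 < d ->
  (forall x, is_derive F x (F1 x)) -> is_derive F1 r F2 -> F r = 0 ->
  (forall x, Rabs (x - r) < d -> F x = (x - r) * U x) -> continuity_pt U r ->
  U r = F1 r /\ is_derive U r (F2 / 2).
Proof.
  intros Hd HF HF1 H0 HU HUc.
  assert (K : forall eps, 0 < eps -> exists delta, 0 < delta /\ forall h, h <> 0 -> Rabs h < delta ->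
    Rabs (U (r + h) - F1 r - F2 / 2 * h) <= eps * Rabs h).
  { intros eps Heps. apply is_derive_Reals in HF1. destruct (HF1 eps Heps) as [delta Hdel].
    exists (Rmin d delta). split; [apply Rmin_glb_lt; auto; apply cond_pos|].
    intros h Hh Hhd. assert (M1 := Rmin_l d delta). assert (M2 := Rmin_r d delta).
    (* The mean value theorem for [F] minus its second-order Taylor polynomial reduces the error of
       [U] to the first-order error of [F1] at an intermediate point. *)
    destruct (MVT_gen (fun x => F x - F1 r * (x - r) - F2 / 2 * (x - r) ^ 2) r (r + h)
      (fun x => F1 x - F1 r - F2 * (x - r))) as (c & Hc & E).
    - intros x _. assert (D := HF x).
      auto_derive; [eexists; eauto|]. change (fun x : R => F x) with F.
      rewrite (is_derive_unique _ _ _ D). field.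
    - intros x _. apply continuity_pt_of_derive with (F1 x - F1 r - F2 * (x - r)).
      assert (D := HF x).
      auto_derive; [eexists; eauto|]. change (fun x : R => F x) with F.
      rewrite (is_derive_unique _ _ _ D). field.
    - assert (Hcr : Rabs (c - r) <= Rabs h).
      { unfold Rmin, Rmax in Hc. destruct (Rle_dec r (r + h)); unfold Rabs;
        destruct (Rcase_abs (c - r)); destruct (Rcase_abs h); lra. }
      rewrite H0, (HU (r + h)) in E by (replace (r + h - r) with h by ring; lra).
      replace (r + h - r) with h in E by ring.
      assert (E2 : U (r + h) - F1 r - F2 / 2 * h = F1 c - F1 r - F2 * (c - r)).
      { apply Rmult_eq_reg_l with h; auto. lra. }
      rewrite E2. destruct (Req_dec c r) as [->|Hne].
      + rewrite !Rminus_diag, Rmult_0_r, Rminus_0_r, Rabs_R0.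
        apply Rmult_le_pos; [lra|apply Rabs_pos].
      + specialize (Hdel (c - r) ltac:(lra) ltac:(lra)).
        replace (r + (c - r)) with c in Hdel by ring.
        assert (Hcn : c - r <> 0) by lra.
        replace (F1 c - F1 r - F2 * (c - r)) with (((F1 c - F1 r) / (c - r) - F2) * (c - r)) by (field; auto).
        rewrite Rabs_mult. apply Rmult_le_compat; auto using Rabs_pos. lra. }
  assert (E : U r = F1 r).
  { apply cond_eq. intros eps Heps.
    destruct (K 1 ltac:(lra)) as (d1 & Hd1 & K1).
    destruct (HUc (eps / 2) ltac:(lra)) as (d2 & Hd2 & Hc2). simpl in Hc2. unfold R_dist in Hc2.
    set (c0 := 1 + Rabs (F2 / 2)). assert (Hc0 : 0 < c0) by (unfold c0; assert (T := Rabs_pos (F2 / 2)); lra).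
    set (h := Rmin (Rmin d1 d2) (eps / (2 * c0)) / 2).
    assert (P : 0 < Rmin (Rmin d1 d2) (eps / (2 * c0))).
    { repeat apply Rmin_glb_lt; auto. apply Rdiv_lt_0_compat; lra. }
    assert (M1 := Rmin_l (Rmin d1 d2) (eps / (2 * c0))). assert (M2 := Rmin_r (Rmin d1 d2) (eps / (2 * c0))).
    assert (M3 := Rmin_l d1 d2). assert (M4 := Rmin_r d1 d2).
    assert (Hh : 0 < h) by (unfold h; lra).
    assert (Hh2 : h < eps / (2 * c0)) by (unfold h; lra).
    assert (Hhc : h * c0 < eps / 2).
    { apply Rmult_lt_compat_r with (r := c0) in Hh2; auto.
      replace (eps / (2 * c0) * c0) with (eps / 2) in Hh2 by (field; lra). auto. }
    assert (A1 := K1 h ltac:(lra) ltac:(rewrite Rabs_pos_eq; unfold h; lra)).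
    assert (A2 : Rabs (U (r + h) - U r) < eps / 2).
    { apply Hc2. split; [split; [exact I|lra]|]. replace (r + h - r) with h by ring. rewrite Rabs_pos_eq; unfold h; lra. }
    rewrite (Rabs_pos_eq h) in A1 by lra.
    replace (U r - F1 r) with ((U (r + h) - F1 r - F2 / 2 * h) + (F2 / 2 * h + - (U (r + h) - U r))) by ring.
    eapply Rle_lt_trans; [apply Rabs_triang|].
    eapply Rle_lt_trans; [apply Rplus_le_compat_l, Rabs_triang|].
    rewrite Rabs_Ropp, Rabs_mult, (Rabs_pos_eq h) by lra.
    unfold c0 in Hhc. lra. }
  split; auto. apply is_derive_Reals. intros eps Heps.
  destruct (K (eps / 2) ltac:(lra)) as (d1 & Hd1 & K1).
  exists (mkposreal _ Hd1). intros h Hh Hhd. simpl in Hhd. rewrite E.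
  specialize (K1 h Hh Hhd).
  replace ((U (r + h) - F1 r) / h - F2 / 2) with ((U (r + h) - F1 r - F2 / 2 * h) * / h) by (field; auto).
  rewrite Rabs_mult, Rabs_inv. assert (P := Rabs_pos_lt h Hh).
  apply Rmult_lt_reg_r with (Rabs h); auto. rewrite Rmult_assoc, Rinv_l by lra. nra.
Qed.

Lemma derive_right_bounds (f : R -> R) (x d a b delta : R) : 0 < delta ->
  is_derive f x d ->
  (forall h, 0 < h < delta -> a * h <= f (x + h) - f x <= b * h) -> a <= d <= b.
Proof.
  intros Hdel Hf H. apply is_derive_Reals in Hf.
  assert (G : forall eps, 0 < eps -> a - eps < d < b + eps).
  { intros eps Heps. destruct (Hf eps Heps) as [d1 Hd1].
    set (h := Rmin delta d1 / 2).
    assert (P : 0 < Rmin delta d1) by (apply Rmin_glb_lt; auto; apply cond_pos).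
    assert (M1 := Rmin_l delta d1). assert (M2 := Rmin_r delta d1).
    assert (Hh : 0 < h) by (unfold h; lra).
    specialize (Hd1 h ltac:(lra) ltac:(rewrite Rabs_pos_eq; unfold h; lra)).
    specialize (H h ltac:(unfold h in *; lra)).
    assert (Q : a <= (f (x + h) - f x) / h <= b).
    { split; apply Rmult_le_reg_r with h; auto; unfold Rdiv; rewrite Rmult_assoc, Rinv_l; lra. }
    apply Rabs_def2 in Hd1. lra. }
  split; apply Rnot_lt_le; intros L.
  - specialize (G (a - d) ltac:(lra)); lra.
  - specialize (G (d - b) ltac:(lra)); lra.
Qed.

Lemma is_derive_prodR (f : nat -> R -> R) (df : nat -> R) n (x : R) :
  (forall j, (j < n)%nat -> is_derive (f j) x (df j)) ->
  (forall j, (j < n)%nat -> f j x <> 0) ->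
  is_derive (fun x => prodR (fun j => f j x) n) x
    (prodR (fun j => f j x) n * sumR (fun j => df j / f j x) n).
Proof.
  induction n; intros Hd Hn; simpl.
  - rewrite Rmult_0_r. apply (is_derive_const (K := R_AbsRing) (V := R_NormedModule)).
  - evar_last.
    + apply (is_derive_mult (fun x => prodR (fun j => f j x) n) (f n)).
      * apply IHn; intros; [apply Hd|apply Hn]; lia.
      * apply Hd; lia.
      * intros; apply Rmult_comm.
    + unfold plus, mult; simpl. field. apply Hn; lia.
Qed.

Lemma sumR_shift (f : nat -> R) n : sumR f (S n) = f O + sumR (fun k => f (S k)) n.
Proof. induction n; [simpl; ring|]. rewrite sumR_S, IHn, (sumR_S _ n). ring. Qed.

Lemma alternating_bound n : forall f : nat -> R,
  (forall j, (j < n)%nat -> 0 <= f j) -> (forall j, (S j < n)%nat -> f (S j) <= f j) ->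
  (0 < n)%nat -> 0 <= sumR (fun j => (-1) ^ j * f j) n <= f O.
Proof.
  induction n as [|n IH]; intros f Hp Hd Hn; [lia|].
  rewrite sumR_shift.
  rewrite (sumR_ext _ (fun k => (-1) * ((-1) ^ k * f (S k)))) by (intros; simpl; ring).
  rewrite sumR_scal. destruct (Nat.eq_dec n 0) as [->|Hn0].
  - simpl. specialize (Hp O ltac:(lia)). lra.
  - destruct (IH (fun k => f (S k))) as [I1 I2]; [intros; apply Hp; lia|intros; apply Hd; lia|lia|].
    specialize (Hd O ltac:(lia)). simpl pow. lra.
Qed.

(** A substitute for [tannery] without an absolutely convergent majorant: each row decreases in [k],
    so its alternating tail is bounded by its first term, which is at most [a K]. *)
Lemma alternating_tannery (b : nat -> nat -> R) (a : nat -> R) :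
  (forall N k, (k < N)%nat -> 0 <= b N k <= a k) ->
  (forall N k, (S k < N)%nat -> b N (S k) <= b N k) ->
  (forall k, is_lim_seq (fun N => b N k) (a k)) ->
  (forall k, a (S k) <= a k) -> is_lim_seq a 0 ->
  exists L : R, is_lim_seq (sumR (fun k => (-1) ^ k * a k)) L /\
    is_lim_seq (fun N => sumR (fun k => (-1) ^ k * b N k) N) L.
Proof.
  intros Hb Hbd Hl Had Ha.
  destruct (alternated_series a) as [L HL].
  { intros n; apply Had. }
  { now apply is_lim_seq_Reals. }
  exists L.
  assert (HL' : is_lim_seq (sumR (fun k => (-1) ^ k * a k)) L).
  { apply is_lim_seq_Reals in HL. apply is_lim_seq_incr_1. eapply is_lim_seq_ext; [|exact HL].
    intros n. unfold tg_alt. induction n; [simpl; ring|]. rewrite sumR_S, <- IHn. simpl. ring. }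
  split; auto.
  apply is_lim_seq_spec; intros eps.
  assert (He : 0 < eps / 3) by (destruct eps as [e He]; simpl; lra).
  apply is_lim_seq_spec in Ha. destruct (Ha (mkposreal _ He)) as [K1 HK1].
  assert (HLs := HL'). apply is_lim_seq_spec in HLs. destruct (HLs (mkposreal _ He)) as [K2 HK2].
  set (K := (K1 + K2)%nat). specialize (HK1 K ltac:(lia)). specialize (HK2 K ltac:(lia)). simpl in HK1, HK2.
  assert (Hfin : is_lim_seq (fun N => sumR (fun k => (-1) ^ k * b N k) K) (sumR (fun k => (-1) ^ k * a k) K)).
  { generalize K as m. induction m; simpl; [apply is_lim_seq_const|].
    apply is_lim_seq_plus'; auto. apply is_lim_seq_mult'; [apply is_lim_seq_const|apply Hl]. }
  apply is_lim_seq_spec in Hfin. destruct (Hfin (mkposreal _ He)) as [K3 HK3].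
  exists (S K + K3)%nat. intros N HN. specialize (HK3 N ltac:(lia)). simpl in HK3.
  assert (E := sumR_split (fun k => (-1) ^ k * b N k) K (N - K)).
  replace (K + (N - K))%nat with N in E by lia. rewrite E.
  rewrite (sumR_ext (fun k => (-1) ^ (K + k) * b N (K + k)%nat) (fun k => (-1) ^ K * ((-1) ^ k * b N (K + k)%nat))) by (intros; rewrite pow_add; ring).
  rewrite sumR_scal.
  destruct (alternating_bound (N - K) (fun k => b N (K + k)%nat)) as [B1 B2].
  - intros j Hj. apply Hb; lia.
  - intros j Hj. rewrite Nat.add_succ_r. apply Hbd; lia.
  - lia.
  - rewrite Nat.add_0_r in B2.
    set (T := sumR (fun j => (-1) ^ j * b N (K + j)%nat) (N - K)) in *.
    assert (B3 : Rabs ((-1) ^ K * T) < eps / 3).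
    { rewrite Rabs_mult, pow_1_abs, Rmult_1_l, Rabs_pos_eq by auto.
      destruct (Hb N K ltac:(lia)) as [_ H2]. apply Rabs_def2 in HK1. lra. }
    apply Rabs_def2 in HK2. apply Rabs_def2 in HK3. apply Rabs_def2 in B3. apply Rabs_def1; lra.
Qed.

Lemma geometric_split (t : C) n : (1 - t <> 0)%C ->
  (/ (1 - t) = sumC (fun i => t ^ i) n + t ^ n * / (1 - t))%C.
Proof.
  intros H; induction n; [simpl; field; auto|].
  rewrite IHn at 1. rewrite sumC_S, Cpow_S. field; auto.
Qed.

Lemma geometric_square_split (t : C) n : (1 - t <> 0)%C ->
  ((/ (1 - t)) ^ 2 = sumC (fun i => RtoC (INR i + 1) * t ^ i) n
     + t ^ n * ((/ (1 - t)) ^ 2 + RtoC (INR n) * / (1 - t)))%C.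
Proof.
  intros H; induction n; [simpl; field; auto|].
  rewrite IHn at 1. rewrite sumC_S, (Cpow_S t n), S_INR, !RtoC_plus. field; auto.
Qed.

(** The combination on the left is what a node contributes to [1 / F^2] in the limit. Expanding both
    resolvents to order [q + 1] makes the simple-pole remainders cancel, leaving a pure double pole;
    the coefficient of [t^q] is zero. *)
Lemma geometric_combination (t : C) q : (1 - t <> 0)%C ->
  ((/ (1 - t)) ^ 2 - RtoC (INR q + 1) * / (1 - t) =
   sumC (fun i => RtoC (INR i - INR q) * t ^ i) (S q) + t ^ S q * (/ (1 - t)) ^ 2)%C.
Proof.
  intros H. assert (E1 := geometric_square_split t (S q) H).
  assert (E2 := geometric_split t (S q) H). set (A := (/ (1 - t))%C) in *.
  rewrite (sumC_ext (fun i => RtoC (INR i - INR q) * t ^ i)%C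
    (fun i => RtoC (INR i + 1) * t ^ i - RtoC (INR q + 1) * t ^ i)%C).
  2: { intros k _. rewrite !RtoC_plus, RtoC_minus. ring. }
  rewrite sumC_minus, (sumC_scal (RtoC (INR q + 1)) (fun i => t ^ i)%C).
  rewrite S_INR in E1.
  set (S1 := sumC (fun i => RtoC (INR i + 1) * t ^ i)%C (S q)) in *.
  set (S2 := sumC (fun i => t ^ i)%C (S q)) in *. set (T := (t ^ S q)%C) in *.
  transitivity (S1 + T * (A ^ 2 + RtoC (INR q + 1) * A) - RtoC (INR q + 1) * (S2 + T * A))%C.
  - rewrite <- E1, <- E2. reflexivity.
  - ring.
Qed.

(** Interchange of the sum over nodes with the Taylor expansion of [phi]: the Taylor error is
    uniform on [|t| <= 1/2], so it costs at most [B * eps n] after summation over [k]. *)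
Lemma exchange_expansion (b s : nat -> R) (alpha : nat -> R) (phi : C -> C) (eps : nat -> R) (B : R) (w S0 : C) :
  (forall n, sumR (fun k => Rabs (b k)) n <= B) -> (forall k, 0 <= s k) ->
  (forall k, s k * Cmod w <= / 2) ->
  (forall n t, Cmod t <= / 2 -> Cmod (phi t - sumC (fun i => RtoC (alpha i) * t ^ i) n)%C <= eps n) ->
  is_lim_seq eps 0 ->
  clim (sumC (fun k => RtoC (b k) * phi (RtoC (s k) * w))%C) S0 ->
  forall beta : nat -> R,
  (forall i, is_lim_seq (sumR (fun k => b k * (alpha i * s k ^ i))) (beta i)) ->
  clim (sumC (fun i => RtoC (beta i) * w ^ i)%C) S0.
Proof.
  intros HB Hs Hsw Hphi Heps HS beta Hbeta.
  apply clim_squeeze with (fun n => B * eps n).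
  2: { replace (Finite 0) with (Finite (B * 0)) by (f_equal; ring).
       apply is_lim_seq_mult'; [apply is_lim_seq_const|auto]. }
  intros n.
  assert (L : clim (fun N => sumC (fun i => RtoC (sumR (fun k => (b k * (alpha i * s k ^ i))%R) N) * w ^ i)%C n)
    (sumC (fun i => RtoC (beta i) * w ^ i)%C n)).
  { apply clim_sumC; intros i _. apply clim_mult; [|apply clim_const]. apply clim_RtoC, Hbeta. }
  assert (L2 := clim_minus _ _ _ _ L HS).
  apply (clim_Cmod_le _ _ _ L2). intros N.
  rewrite <- Cmod_opp, Copp_minus_distr.
  rewrite (sumC_ext (fun i => RtoC (sumR (fun k => (b k * (alpha i * s k ^ i))%R) N) * w ^ i)%C
    (fun i => sumC (fun k => RtoC (b k * (alpha i * s k ^ i))) N * w ^ i)%C) by (intros; now rewrite sumC_RtoC).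
  rewrite <- (sumC_exchange (fun k i => RtoC (b k * (alpha i * s k ^ i)))), <- sumC_minus.
  eapply Rle_trans; [apply Cmod_sumC|].
  apply Rle_trans with (sumR (fun k => eps n * Rabs (b k)) N).
  2: { rewrite sumR_scal, Rmult_comm. apply Rmult_le_compat_r; auto.
       eapply Rle_trans; [|apply (Hphi n (RtoC 0))]; [apply Cmod_ge_0|rewrite Cmod_0; lra]. }
  apply sumR_le; intros k _.
  replace (sumC (fun i => RtoC (b k * (alpha i * s k ^ i)) * w ^ i)%C n) with
    (RtoC (b k) * sumC (fun i => RtoC (alpha i) * (RtoC (s k) * w) ^ i) n)%C.
  2: { rewrite <- sumC_scal. apply sumC_ext; intros i _.
       rewrite Cpow_mult_l, !RtoC_mult, RtoC_pow. ring. }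
  replace (RtoC (b k) * phi (RtoC (s k) * w) - RtoC (b k) * sumC (fun i => RtoC (alpha i) * (RtoC (s k) * w) ^ i) n)%C
    with (RtoC (b k) * (phi (RtoC (s k) * w) - sumC (fun i => RtoC (alpha i) * (RtoC (s k) * w) ^ i) n))%C by ring.
  rewrite Cmod_mult, Cmod_R, Rmult_comm. apply Rmult_le_compat_r; [apply Rabs_pos|].
  apply Hphi. rewrite Cmod_mult, Cmod_R, Rabs_pos_eq; auto.
Qed.

Lemma half_pow_lim : is_lim_seq (fun n => (/ 2) ^ n) 0.
Proof. apply is_lim_seq_geom. rewrite Rabs_pos_eq; lra. Qed.

Lemma INR_half_pow_lim : is_lim_seq (fun n => INR n * (/ 2) ^ n) 0.
Proof.
  apply is_lim_seq_le_le with (fun _ => 0) (fun n => 2 * (3 / 4) ^ n).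
  - intros n. assert (P := pos_INR n). assert (H : 0 < (/ 2) ^ n) by (apply pow_lt; lra).
    split; [nra|].
    assert (Q := poly n (/ 2) ltac:(lra)).
    (* Bernoulli's inequality bounds [n] by [2 (3/2)^n]. *)
    replace ((3 / 4) ^ n) with ((1 + / 2) ^ n * (/ 2) ^ n) by (rewrite <- Rpow_mult_distr; f_equal; field).
    nra.
  - apply is_lim_seq_const.
  - replace (Finite 0) with (Finite (2 * 0)) by (f_equal; ring).
    apply is_lim_seq_mult'; [apply is_lim_seq_const|]. apply is_lim_seq_geom. rewrite Rabs_pos_eq; lra.
Qed.

Lemma resolvent_small t : Cmod t <= / 2 -> (1 - t <> 0)%C /\ Cmod (/ (1 - t)) <= 2.
Proof.
  intros H. assert (T := Cmod_triangle (1 - t) t).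
  replace (1 - t + t)%C with (RtoC 1) in T by ring. rewrite Cmod_1 in T.
  assert (N : (1 - t <> 0)%C) by (intros E; rewrite E, Cmod_0 in T; lra).
  split; auto. rewrite Cmod_inv by auto.
  apply Rle_trans with (/ / 2); [apply Rinv_le_contravar; lra|rewrite Rinv_inv; lra].
Qed.

Lemma geometric_error n t : Cmod t <= / 2 ->
  Cmod (/ (1 - t) - sumC (fun i => RtoC 1 * t ^ i) n)%C <= 2 * (/ 2) ^ n.
Proof.
  intros H. destruct (resolvent_small t H) as [N B].
  rewrite (geometric_split t n N) at 1.
  rewrite (sumC_ext (fun i => RtoC 1 * t ^ i)%C (fun i => t ^ i)%C) by (intros; ring).
  replace (_ - _)%C with (t ^ n * / (1 - t))%C by ring.
  rewrite Cmod_mult, Cmod_pow, Rmult_comm.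
  apply Rmult_le_compat; auto using Cmod_ge_0, pow_le. apply pow_incr; auto using Cmod_ge_0.
Qed.

Lemma geometric_square_error n t : Cmod t <= / 2 ->
  Cmod ((/ (1 - t)) ^ 2 - sumC (fun i => RtoC (INR i + 1) * t ^ i) n)%C
    <= 4 * (/ 2) ^ n + 2 * (INR n * (/ 2) ^ n).
Proof.
  intros H. destruct (resolvent_small t H) as [N B].
  rewrite (geometric_square_split t n N) at 1.
  replace (_ - _)%C with (t ^ n * ((/ (1 - t)) ^ 2 + RtoC (INR n) * / (1 - t)))%C by ring.
  rewrite Cmod_mult, Cmod_pow.
  replace (4 * (/ 2) ^ n + 2 * (INR n * (/ 2) ^ n)) with ((/ 2) ^ n * (4 + 2 * INR n)) by ring.
  apply Rmult_le_compat; auto using Cmod_ge_0, pow_le.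
  - apply pow_incr; auto using Cmod_ge_0.
  - eapply Rle_trans; [apply Cmod_triangle|].
    rewrite Cmod_mult, Cmod_pow, Cmod_R, Rabs_pos_eq by apply pos_INR.
    assert (P := pos_INR n). assert (G := Cmod_ge_0 (/ (1 - t))).
    apply Rplus_le_compat; nra.
Qed.

(** The terms after the constant 1 total at most [exp (1/2) - 1], which is below 1 because
    [e <= 3]. *)
Lemma besselF_neq_0_small q w : Cmod w <= / 2 -> besselF q w <> 0%C.
Proof.
  intros Hw E.
  assert (L := besselF_lim q w). rewrite E in L. apply clim_incr_1 in L.
  assert (B : forall n, Cmod (sumC (fun m => RtoC (Fcoef q m) * w ^ m)%C (S n) - 1)%C <= exp (/ 2) - 1).
  { intros n.
    apply Rle_trans with (sumR (fun m => Rabs (Fcoef q m) * (/ 2) ^ m) (S n) - 1).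
    2: { assert (T := Fterm_sum_le q (/ 2) (S n) ltac:(lra)). lra. }
    induction n.
    - simpl. rewrite Fcoef_0, Rabs_R1. replace (0 + 1 * 1 - 1)%C with (RtoC 0) by ring.
      rewrite Cmod_0; lra.
    - rewrite sumC_S, sumR_S.
      replace (_ - _)%C with ((sumC (fun m => RtoC (Fcoef q m) * w ^ m)%C (S n) - 1) + RtoC (Fcoef q (S n)) * w ^ (S n))%C by ring.
      eapply Rle_trans; [apply Cmod_triangle|]. rewrite Cmod_mult, Cmod_R, Cmod_pow.
      assert (Cmod w ^ S n <= (/ 2) ^ S n) by (apply pow_incr; split; auto using Cmod_ge_0).
      assert (T := Rabs_pos (Fcoef q (S n))). nra. }
  assert (L2 := clim_minus _ _ _ _ L (clim_const 1%C)).
  assert (X := clim_Cmod_le _ _ _ L2 B).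
  replace (0 - 1)%C with (- (1))%C in X by ring. rewrite Cmod_opp, Cmod_1 in X.
  assert (E2 : exp (/ 2) * exp (/ 2) <= 3).
  { rewrite <- exp_plus. replace (/ 2 + / 2) with 1 by field. apply exp_le_3. }
  nra.
Qed.

Lemma clim_prepend (a b : nat -> C) (p : nat) (w l l' : C) :
  clim (sumC (fun i => b i * w ^ i)%C) l' -> l = (sumC (fun i => a i * w ^ i) p + w ^ p * l')%C ->
  clim (sumC (fun i => (if lt_dec i p then a i else b (i - p)%nat) * w ^ i)%C) l.
Proof.
  intros H ->. apply (clim_incr_n _ _ p).
  eapply clim_ext; [|exact (clim_plus _ _ _ _ (clim_const _) (clim_scal (w ^ p) _ _ H))].
  intros n; simpl. rewrite (Nat.add_comm n p), sumC_split. f_equal.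
  - apply sumC_ext; intros i Hi. destruct (lt_dec i p); [auto|lia].
  - rewrite <- sumC_scal. apply sumC_ext; intros i Hi. destruct (lt_dec (p + i) p); [lia|].
    replace (p + i - p)%nat with i by lia. rewrite Cpow_add_r. ring.
Qed.

(** * Partial fractions of 1/F and 1/F^2 *)

Definition positive_zeros (q : nat) (r : nat -> R) : Prop :=
  (forall k, 0 < r k) /\ (forall k, r k < r (S k)) /\ (forall k, Fr q (r k) = 0) /\
  (forall x, 0 < x -> Fr q x = 0 -> exists k, x = r k).

Section Zeros.
Variables (q : nat) (r : nat -> R).
Hypothesis Hr : positive_zeros q r.

Lemma r_pos k : 0 < r k.
Proof. apply Hr. Qed.

Lemma r_incr k : r k < r (S k).
Proof. apply Hr. Qed.

Lemma r_root k : Fr q (r k) = 0.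
Proof. apply Hr. Qed.

Lemma r_all x : 0 < x -> Fr q x = 0 -> exists k, x = r k.
Proof. apply Hr. Qed.

Lemma r_lt i j : (i < j)%nat -> r i < r j.
Proof. induction 1; [apply r_incr|]. eapply Rlt_trans; [exact IHle|apply r_incr]. Qed.

(** The limits [sigma j] of [besselF_product] are exactly the [1 / r j]: every positive one is the
    reciprocal of a zero ([H1]), every zero arises ([H2]), and no positive value is repeated
    ([H3]). *)
Lemma roots_product :
  (forall j, / r j <= 2 / (INR j + 1) ^ 2) /\
  (forall w, clim (prodC (fun j => 1 - RtoC (/ r j) * w)%C) (besselF q w)).
Proof.
  destruct (besselF_product q) as (sigma & Hb & Hmono & Hlim).
  assert (HlimR : forall x, is_lim_seq (prodR (fun j => 1 - sigma j * x)) (Fr q x)).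
  { intros x. apply clim_RtoC_inv. rewrite <- besselF_RtoC.
    eapply clim_ext; [|apply Hlim]. intros n; simpl. rewrite <- prodC_RtoC.
    apply prodC_ext; intros k _. now rewrite RtoC_minus, RtoC_mult. }
  assert (Hsum : forall x, 0 <= x -> forall n, sumR (fun k => sigma k * x) n <= x * 4).
  { intros x Hx n. eapply Rle_trans; [|apply (sum_inv_sq_le x n Hx)].
    apply sumR_le; intros k _. rewrite Rmult_comm. apply Rmult_le_compat_l; auto. apply Hb. }
  assert (H1 : forall j, 0 < sigma j -> Fr q (/ sigma j) = 0).
  { intros j Hj.
    assert (Z : is_lim_seq (prodR (fun i => 1 - sigma i * / sigma j)) 0).
    { apply is_lim_seq_ext_loc with (fun _ => 0); [|apply is_lim_seq_const].
      exists (S j). intros n Hn. symmetry. apply prodR_eq_0 with j; [lia|]. field; lra. }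
    assert (U := is_lim_seq_unique _ _ (HlimR (/ sigma j))). rewrite (is_lim_seq_unique _ _ Z) in U.
    now injection U. }
  assert (H2 : forall x, 0 < x -> Fr q x = 0 -> exists j, sigma j * x = 1).
  { intros x Hx E. destruct (classic (exists j, sigma j * x = 1)) as [|N]; auto. exfalso.
    refine (prod_lim_neq_0 (fun k => sigma k * x) (x * 4) (Fr q x) _ _ _ (HlimR x) E).
    - intros k; apply Rmult_le_pos; [apply Hb|lra].
    - apply Hsum; lra.
    - intros k Z. apply N; exists k; lra. }
  (* A repeated factor would give [|F(x)| <= B (1 - sigma_k x)^2] near [x0 = 1 / sigma_k], so
     [F'(x0) = 0], contrary to the simplicity of zeros. *)
  assert (H3 : forall i k, (i < k)%nat -> 0 < sigma k -> sigma i = sigma k -> False).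
  { intros i k Hik Hk E.
    apply (Fr_root_simple q (/ sigma k)); auto using Rinv_0_lt_compat.
    set (x0 := / sigma k). assert (Hx0 : 0 < x0) by (apply Rinv_0_lt_compat; auto).
    set (B := exp (2 * x0 * 4)).
    assert (Hbound : forall x, Rabs x <= 2 * x0 -> Rabs (Fr q x) <= (1 - sigma k * x) ^ 2 * B).
    { intros x Hx.
      assert (L := is_lim_seq_abs _ _ (HlimR x)). simpl in L.
      apply (is_lim_seq_incr_n _ (S k)) in L.
      apply (is_lim_seq_le _ (fun _ => (1 - sigma k * x) ^ 2 * B) (Rabs (Fr q x)) ((1 - sigma k * x) ^ 2 * B)) with (2 := L) (3 := is_lim_seq_const _).
      intros n. rewrite (prodR_hole _ _ k) by lia.
      rewrite (prodR_hole _ _ i) by lia.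
      destruct (Nat.eq_dec i k); [lia|]. rewrite E, !Rabs_mult, <- Rmult_assoc, <- Rabs_mult.
      replace ((1 - sigma k * x) * (1 - sigma k * x)) with ((1 - sigma k * x) ^ 2) by ring.
      rewrite (Rabs_pos_eq ((1 - sigma k * x) ^ 2)) by apply pow2_ge_0.
      apply Rmult_le_compat_l; [apply pow2_ge_0|].
      set (m := (n + S k)%nat).
      eapply Rle_trans with (exp (sumR (fun j => sigma j * (2 * x0)) m)).
      - clear -Hx Hb Hx0. induction m; [simpl; rewrite Rabs_R1, exp_0; lra|].
        rewrite prodR_S, sumR_S, Rabs_mult, exp_plus.
        apply Rmult_le_compat; auto using Rabs_pos.
        assert (I := exp_ineq1_le (sigma m * (2 * x0))).
        assert (0 <= sigma m * (2 * x0)) by (apply Rmult_le_pos; [apply Hb|lra]).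
        destruct (Nat.eq_dec m i); [rewrite Rabs_R1; lra|].
        destruct (Nat.eq_dec m k); [rewrite Rabs_R1; lra|].
        eapply Rle_trans; [|exact I].
        eapply Rle_trans; [apply Rabs_triang|]. rewrite Rabs_R1, Rabs_Ropp, Rabs_mult.
        rewrite (Rabs_pos_eq (sigma m)) by apply Hb.
        apply Rplus_le_compat_l, Rmult_le_compat_l; auto. apply Hb.
      - assert (S4 := Hsum (2 * x0) ltac:(lra) m). unfold B.
        destruct S4 as [S4|S4]; [left; now apply exp_increasing|rewrite S4; lra]. }
    assert (D := is_derive_Fr q x0).
    apply is_derive_unique in D. rewrite <- D. apply is_derive_unique.
    apply is_derive_Reals. intros eps Heps.
    assert (HB : 0 < B) by apply exp_pos.
    assert (Hd : 0 < Rmin x0 (eps / (sigma k ^ 2 * B))).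
    { apply Rmin_glb_lt; auto. apply Rdiv_lt_0_compat; auto. apply Rmult_lt_0_compat; auto. apply pow_lt; auto. }
    exists (mkposreal _ Hd). intros h Hh Hhd. change (Rabs h < Rmin x0 (eps / (sigma k ^ 2 * B))) in Hhd.
    assert (M1 := Rmin_l x0 (eps / (sigma k ^ 2 * B))). assert (M2 := Rmin_r x0 (eps / (sigma k ^ 2 * B))).
    unfold x0 at 2. rewrite H1 by auto. rewrite !Rminus_0_r.
    unfold Rdiv. rewrite Rabs_mult, Rabs_inv.
    assert (Hah := Rabs_pos_lt h Hh).
    apply Rmult_lt_reg_r with (Rabs h); auto. rewrite Rmult_assoc, Rinv_l, Rmult_1_r by lra.
    eapply Rle_lt_trans; [apply Hbound|].
    - eapply Rle_trans; [apply Rabs_triang|]. rewrite (Rabs_pos_eq x0); lra.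
    - replace (1 - sigma k * (x0 + h)) with (- (sigma k * h)) by (unfold x0; field; lra).
      replace ((- (sigma k * h)) ^ 2 * B) with ((sigma k ^ 2 * B) * Rabs h * Rabs h).
      2: { rewrite Rmult_assoc. replace (Rabs h * Rabs h) with (h ^ 2) by (rewrite <- (pow2_abs h); ring). ring. }
      apply Rmult_lt_compat_r; auto.
      assert (Hsb : 0 < sigma k ^ 2 * B) by (apply Rmult_lt_0_compat; auto; apply pow_lt; auto).
      apply Rmult_lt_reg_r with (/ (sigma k ^ 2 * B)); [apply Rinv_0_lt_compat; auto|].
      replace (sigma k ^ 2 * B * Rabs h * / (sigma k ^ 2 * B)) with (Rabs h) by (field; lra).
      unfold Rdiv in M2. lra. }
  (* Strong induction. The value [1 / r k] is some [sigma j], and [j < k] is excluded by the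
     induction hypothesis, so [1 / r k <= sigma k]. Conversely [sigma k = 1 / r i], where [i < k]
     would be a repetition and [i > k] would contradict this bound. *)
  assert (Heq : forall k, sigma k = / r k).
  { intros k; induction k as [k IH] using lt_wf_ind.
    assert (Hrk := r_pos k).
    assert (Hpos : / r k <= sigma k).
    { destruct (H2 (r k)) as [j Hj]; auto using r_root.
      assert (Ej : sigma j = / r k) by (apply Rmult_eq_reg_r with (r k); [rewrite Rinv_l|]; lra).
      rewrite <- Ej. apply Hmono. destruct (le_lt_dec k j) as [|L]; auto. exfalso.
      rewrite IH in Ej by auto. apply Rinv_eq_reg in Ej. assert (T := r_lt j k L). lra. }
    assert (Hsp : 0 < sigma k) by (eapply Rlt_le_trans; [apply Rinv_0_lt_compat, Hrk|auto]).
    destruct (r_all (/ sigma k)) as [i Hi]; auto using Rinv_0_lt_compat.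
    assert (Es : sigma k = / r i) by (rewrite <- Hi, Rinv_inv; auto).
    destruct (lt_eq_lt_dec i k) as [[L| ->]|L]; auto; exfalso.
    - apply (H3 i k); auto. rewrite Es. auto.
    - assert (T := r_lt k i L). rewrite Es in Hpos.
      assert (/ r i < / r k) by (apply Rinv_lt_contravar; auto; apply Rmult_lt_0_compat; auto using r_pos). lra. }
  split.
  - intros j; rewrite <- Heq; apply Hb.
  - intros w. eapply clim_ext; [|apply Hlim]. intros n; apply prodC_ext; intros; now rewrite Heq.
Qed.
Lemma pz_s_pos k : 0 < / r k.
Proof. apply Rinv_0_lt_compat, r_pos. Qed.

Lemma pz_s_lt i j : (i < j)%nat -> / r j < / r i.
Proof.
  intros H. apply Rinv_lt_contravar; [apply Rmult_lt_0_compat; apply r_pos|now apply r_lt].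
Qed.

Lemma pz_s_inj i j : i <> j -> / r i <> / r j.
Proof. intros H. destruct (Nat.lt_gt_cases i j) as [[L|L] _]; auto; apply pz_s_lt in L; lra. Qed.

Lemma pz_product w : clim (prodC (fun j => 1 - RtoC (/ r j) * w)%C) (besselF q w).
Proof. apply roots_product. Qed.

Lemma pz_sum_le n : sumR (fun k => / r k) n <= 4.
Proof.
  destruct roots_product as [B _].
  eapply Rle_trans; [|replace 4 with (1 * 4) by ring; apply (sum_inv_sq_le 1 n); lra].
  apply sumR_le; intros k _. rewrite Rmult_1_l. apply B.
Qed.

Lemma pz_product_R x : is_lim_seq (prodR (fun j => 1 - / r j * x)) (Fr q x).
Proof.
  apply clim_RtoC_inv. rewrite <- besselF_RtoC.
  eapply clim_ext; [|apply pz_product]. intros n; simpl. rewrite <- prodC_RtoC.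
  apply prodC_ext; intros k _. now rewrite RtoC_minus, RtoC_mult.
Qed.

(** * Tail products *)

(** Used on [[0, r N]], where all factors lie in [[0, 1]] and the partial products decrease, so that
    the limit exists and is finite. *)
Definition tailprod (N : nat) (x : R) : R :=
  real (Lim_seq (prodR (fun j => 1 - / r (N + j) * x))).

Lemma tail_factor N j x : 0 <= x <= r N -> 0 <= 1 - / r (N + j) * x <= 1.
Proof.
  intros Hx. assert (P := pz_s_pos (N + j)).
  assert (r N <= r (N + j)).
  { destruct j; [rewrite Nat.add_0_r; lra|]. left; apply r_lt; lia. }
  assert (/ r (N + j) * x <= / r (N + j) * r (N + j)) by (apply Rmult_le_compat_l; lra).
  rewrite Rinv_l in H0 by (assert (T := r_pos (N + j)); lra). nra.
Qed.

Lemma tail_partial N x n : 0 <= x <= r N -> 0 <= prodR (fun j => 1 - / r (N + j) * x) n <= 1.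
Proof.
  intros Hx; induction n; simpl; [lra|]. assert (T := tail_factor N n x Hx). nra.
Qed.

Lemma tailprod_lim N x : 0 <= x <= r N ->
  is_lim_seq (prodR (fun j => 1 - / r (N + j) * x)) (tailprod N x).
Proof.
  intros Hx. unfold tailprod. apply Lim_seq_correct', (ex_finite_lim_seq_decr _ 0).
  - intros n. rewrite prodR_S. assert (T := tail_factor N n x Hx). assert (T2 := tail_partial N x n Hx). nra.
  - intros n; apply tail_partial, Hx.
Qed.

Lemma tailprod_bounds N x : 0 <= x <= r N -> 0 <= tailprod N x <= 1.
Proof.
  intros Hx. assert (L := tailprod_lim N x Hx). split.
  - apply (is_lim_seq_le (fun _ => 0) _ 0 (tailprod N x)) with (2 := is_lim_seq_const 0) (3 := L).
    intros n; apply tail_partial, Hx.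
  - apply (is_lim_seq_le _ (fun _ => 1) (tailprod N x) 1) with (2 := L) (3 := is_lim_seq_const 1).
    intros n; apply tail_partial, Hx.
Qed.

(** The factors are affine, nonnegative and decreasing, so the product is convex; as it equals 1 at
    0, it descends on [[x, y]] no more steeply than on [[0, x]]. This one inequality yields
    continuity as well as the bound on the derivative. *)
Lemma tailprod_secant N x y : 0 <= x <= y -> y <= r N ->
  tailprod N y <= tailprod N x /\
  x * (tailprod N x - tailprod N y) <= (y - x) * (1 - tailprod N x).
Proof.
  intros Hxy Hy.
  assert (Lx := tailprod_lim N x ltac:(lra)). assert (Ly := tailprod_lim N y ltac:(lra)).
  set (Px := prodR (fun j => 1 - / r (N + j) * x)) in *.
  set (Py := prodR (fun j => 1 - / r (N + j) * y)) in *.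
  assert (G : forall n, Py n <= Px n /\ x * (Px n - Py n) <= (y - x) * (1 - Px n)).
  { induction n as [|n [IH1 IH2]]; [unfold Px, Py; simpl; lra|].
    assert (T2 := tail_factor N n y ltac:(lra)).
    assert (P1 := tail_partial N x n ltac:(lra)). assert (P2 := tail_partial N y n ltac:(lra)).
    fold Px in P1. fold Py in P2.
    change (Px (S n)) with (Px n * (1 - / r (N + n) * x)). change (Py (S n)) with (Py n * (1 - / r (N + n) * y)).
    assert (Hs := pz_s_pos (N + n)). set (t := / r (N + n)) in *.
    assert (t * x <= t * y) by (apply Rmult_le_compat_l; lra).
    split; [apply Rmult_le_compat; lra|].
    replace (x * (Px n * (1 - t * x) - Py n * (1 - t * y))) with
      ((1 - t * y) * (x * (Px n - Py n)) + Px n * (t * x) * (y - x)) by ring.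
    replace ((y - x) * (1 - Px n * (1 - t * x))) with
      ((y - x) * (1 - Px n) + Px n * (t * x) * (y - x)) by ring.
    apply Rplus_le_compat_r.
    eapply Rle_trans; [apply Rmult_le_compat_l; [lra|exact IH2]|].
    assert (0 <= (y - x) * (1 - Px n)) by (apply Rmult_le_pos; lra). nra. }
  split.
  - apply (is_lim_seq_le Py Px (tailprod N y) (tailprod N x)); auto. intros n; apply G.
  - apply (is_lim_seq_le (fun n => x * (Px n - Py n)) (fun n => (y - x) * (1 - Px n))
      (x * (tailprod N x - tailprod N y)) ((y - x) * (1 - tailprod N x))).
    + intros n; apply G.
    + apply is_lim_seq_mult'; [apply is_lim_seq_const|]. now apply is_lim_seq_minus'.
    + apply is_lim_seq_mult'; [apply is_lim_seq_const|].
      apply is_lim_seq_minus'; [apply is_lim_seq_const|auto].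
Qed.

Lemma tailprod_split N x : 0 <= x <= r N ->
  Fr q x = prodR (fun j => 1 - / r j * x) N * tailprod N x.
Proof.
  intros Hx.
  assert (L1 := pz_product_R x). apply (is_lim_seq_incr_n _ N) in L1.
  assert (L2 : is_lim_seq (fun n => prodR (fun j => 1 - / r j * x) (n + N)) (prodR (fun j => 1 - / r j * x) N * tailprod N x)).
  { eapply is_lim_seq_ext; [|apply is_lim_seq_mult'; [apply is_lim_seq_const|apply (tailprod_lim N x Hx)]].
    intros n; simpl. rewrite Nat.add_comm, prodR_split. reflexivity. }
  apply is_lim_seq_unique in L1. apply is_lim_seq_unique in L2. rewrite L1 in L2. now injection L2.
Qed.

(** More than [4 x] zeros up to [x] would have reciprocals of sum above 4, against [pz_sum_le]. *)
Lemma pz_eventually_gt x : exists N0, forall N, (N0 <= N)%nat -> x < r N.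
Proof.
  destruct (nfloor_ex (Rmax x 0 * 4)) as [n Hn]; [apply Rmult_le_pos; [apply Rmax_r|lra]|].
  exists (S n). intros N HN. apply Rnot_le_lt. intros L.
  assert (Hx : 0 < x) by (assert (T := r_pos N); lra).
  rewrite Rmax_left in Hn by lra.
  assert (B : INR (S n) * / x <= sumR (fun k => / r k) (S n)).
  { assert (A : forall m, (m <= S n)%nat -> INR m * / x <= sumR (fun k => / r k) m).
    { induction m; intros Hm; [simpl; lra|]. rewrite S_INR, sumR_S, Rmult_plus_distr_r, Rmult_1_l.
      apply Rplus_le_compat; [apply IHm; lia|]. apply Rinv_le_contravar; [apply r_pos|].
      assert (r m < r N) by (apply r_lt; lia). lra. }
    apply A; lia. }
  assert (C := pz_sum_le (S n)). rewrite S_INR in B.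
  assert (D : (INR n + 1) * / x <= 4) by lra.
  apply Rmult_le_compat_r with (r := x) in D; [|lra].
  rewrite Rmult_assoc, Rinv_l, Rmult_1_r in D; lra.
Qed.

Lemma tailprod_to_1 x : 0 <= x -> is_lim_seq (fun N => tailprod N x) 1.
Proof.
  intros Hx. destruct (pz_eventually_gt x) as [N0 HN0].
  destruct (bounded_sums_lim (fun k => / r k) 4) as (T & HT & HT').
  { intros k; left; apply pz_s_pos. }
  { apply pz_sum_le. }
  apply is_lim_seq_le_le_loc with (fun N => 1 - x * (T - sumR (fun k => / r k) N)) (fun _ => 1).
  - exists N0; intros N HN. specialize (HN0 N HN).
    assert (B := tailprod_bounds N x ltac:(lra)). split; [|lra].
    assert (L := tailprod_lim N x ltac:(lra)).
    apply (is_lim_seq_le (fun _ => 1 - x * (T - sumR (fun k => / r k) N)) _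
      (1 - x * (T - sumR (fun k => / r k) N)) (tailprod N x)) with (2 := is_lim_seq_const _) (3 := L).
    intros n. assert (E := sumR_split (fun k => / r k) N n). specialize (HT' (N + n)%nat).
    assert (G : 1 - x * sumR (fun k => / r (N + k)) n <= prodR (fun j => 1 - / r (N + j) * x) n).
    { clear E HT'. induction n; [simpl; lra|]. rewrite sumR_S, prodR_S.
      assert (T1 := tail_partial N x n ltac:(lra)). assert (T2 := pz_s_pos (N + n)).
      assert (0 <= / r (N + n) * x) by (apply Rmult_le_pos; lra). nra. }
    nra.
  - replace (Finite 1) with (Finite (1 - x * (T - T))) by (f_equal; ring).
    apply is_lim_seq_minus'; [apply is_lim_seq_const|].
    apply is_lim_seq_mult'; [apply is_lim_seq_const|].
    apply is_lim_seq_minus'; [apply is_lim_seq_const|exact HT].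
  - apply is_lim_seq_const.
Qed.

(** To first order [F(w) = pz_e k * (1 - w / r k)] at its zero, so [1 / pz_e k] is the coefficient
    of [1 / (1 - w / r k)] in [1 / F]. The next two definitions are the real forms of [pfE] and
    [pfbeta] for the partial product. *)
Definition pz_e (k : nat) : R := - r k * Fr1 q (r k).
Definition pz_E (N k : nat) : R :=
  prodR (fun j => if Nat.eq_dec j k then 1 else 1 - / r j / / r k) N.
Definition pz_beta (N k : nat) : R :=
  sumR (fun j => if Nat.eq_dec j k then 0 else / r j / (/ r j - / r k)) N.

Lemma tailprod_continuity N x : 0 < x < r N -> continuity_pt (tailprod N) x.
Proof.
  intros Hx eps Heps.
  set (d := Rmin (Rmin (x / 2) (r N - x)) (eps * (x / 2))).
  assert (M1 := Rmin_l (Rmin (x / 2) (r N - x)) (eps * (x / 2))).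
  assert (M2 := Rmin_r (Rmin (x / 2) (r N - x)) (eps * (x / 2))).
  assert (M3 := Rmin_l (x / 2) (r N - x)). assert (M4 := Rmin_r (x / 2) (r N - x)).
  exists d. split.
  { repeat apply Rmin_glb_lt; try lra. apply Rmult_lt_0_compat; lra. }
  intros y [_ Hy]. simpl in *. unfold R_dist in *. fold d in M1, M2.
  assert (G : forall a b, x / 2 <= a <= b -> b <= r N -> b - a < d ->
    Rabs (tailprod N b - tailprod N a) < eps).
  { intros a b Hab Hb Hd. destruct (tailprod_secant N a b ltac:(lra) Hb) as [S1 S2].
    assert (B := tailprod_bounds N a ltac:(lra)).
    rewrite Rabs_left1 by lra.
    apply Rmult_lt_reg_l with (x / 2); [lra|].
    apply Rle_lt_trans with (a * (tailprod N a - tailprod N b)); [|].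
    - nra.
    - eapply Rle_lt_trans; [exact S2|]. nra. }
  apply Rabs_def2 in Hy.
  destruct (Rle_dec x y).
  - apply G; lra.
  - rewrite Rabs_minus_sym. apply G; lra.
Qed.

Lemma pz_E_neq_0 N k : pz_E N k <> 0.
Proof.
  apply prodR_neq_0. intros j _. destruct (Nat.eq_dec j k) as [|H]; [lra|].
  apply pz_s_inj in H. assert (P := pz_s_pos k). intros E. apply H.
  apply Rmult_eq_reg_r with (/ / r k); [|apply Rinv_neq_0_compat; lra].
  rewrite Rinv_r by lra. unfold Rdiv in E. lra.
Qed.

(* [pz_E N k] tends to [pz_e k] and [pz_beta N k] to [-(q + 1)/2]; the tail
   product at [r k] gives the exact discrepancies. The value [-(q + 1)/2] comes
   from the differential equation at a zero. *)
Lemma tail_relations N k : (k < N)%nat ->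
  pz_e k = pz_E N k * tailprod N (r k) /\
  exists v, 0 <= v <= 1 - tailprod N (r k) /\
    pz_beta N k * tailprod N (r k) = v - (INR q + 1) / 2 * tailprod N (r k).
Proof.
  intros Hk. assert (Hrk := r_pos k). assert (HrN := r_lt k N Hk).
  set (H := fun x => prodR (fun j => if Nat.eq_dec j k then 1 else 1 - / r j * x) N).
  assert (HE : H (r k) = pz_E N k).
  { apply prodR_ext; intros j _. destruct (Nat.eq_dec j k); auto. field. split; [lra|]. assert (T := r_pos j); lra. }
  assert (DH : is_derive H (r k) (H (r k) * (pz_beta N k / r k))).
  { evar_last.
    - apply (is_derive_prodR (fun j x => if Nat.eq_dec j k then 1 else 1 - / r j * x)
        (fun j => if Nat.eq_dec j k then 0 else - / r j)).
      + intros j _. destruct (Nat.eq_dec j k); [apply (is_derive_const (K := R_AbsRing) (V := R_NormedModule))|].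
        auto_derive; auto. ring.
      + intros j _. destruct (Nat.eq_dec j k) as [|n]; [lra|]. apply pz_s_inj in n.
        intros Z. apply n. apply Rmult_eq_reg_r with (r k); [|lra]. rewrite Rinv_l; lra.
    - f_equal. unfold pz_beta, Rdiv. rewrite (Rmult_comm (sumR _ _)), <- sumR_scal. apply sumR_ext; intros j _.
      destruct (Nat.eq_dec j k) as [|n]; [ring|]. assert (n' := pz_s_inj _ _ n).
      assert (T := r_pos j). assert (Hne : r j <> r k) by (intros Z; apply n'; now rewrite Z).
      field. repeat split; lra. }
  (* This function is [F(x) / (x - r k)] near [r k], because the factor of index [k] equals
     [- (x - r k) / r k]. *)
  assert (HUc : continuity_pt (fun x => - / r k * (H x * tailprod N x)) (r k)).
  { apply continuity_pt_mult; [apply continuity_pt_const; intros ? ?; auto|].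
    apply continuity_pt_mult; [eapply continuity_pt_of_derive, DH|]. apply tailprod_continuity; lra. }
  destruct (quotient_derive (Fr q) (Fr1 q) (fun x => - / r k * (H x * tailprod N x)) (r k) (Fr2 q (r k)) (Rmin (r k) (r N - r k))) as [E1 E2].
  - apply Rmin_glb_lt; lra.
  - apply is_derive_Fr.
  - apply is_derive_Fr1.
  - apply Hr.
  - intros x Hx. assert (M1 := Rmin_l (r k) (r N - r k)). assert (M2 := Rmin_r (r k) (r N - r k)).
    apply Rabs_def2 in Hx. rewrite (tailprod_split N x) by lra.
    rewrite (prodR_hole _ N k) by auto. fold (H x). field. lra.
  - exact HUc.
  - assert (Ee : pz_e k = pz_E N k * tailprod N (r k)).
    { unfold pz_e. rewrite <- E1, HE. field; lra. }
    split; auto.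
    assert (HEn := pz_E_neq_0 N k).
    (* Dividing by [H] near [r k] transfers the differentiability obtained from [quotient_derive] to
       the tail product. *)
    assert (Hloc : locally (r k) (fun x => H x <> 0)).
    { assert (C : continuity_pt H (r k)) by (eapply continuity_pt_of_derive, DH).
      destruct (C (Rabs (H (r k)))) as (d & Hd & HC); [apply Rabs_pos_lt; rewrite HE; auto|].
      exists (mkposreal d Hd). intros y Hy Z. destruct (Req_dec y (r k)) as [->|Hne]; [rewrite HE in Z; auto|].
      assert (X := HC y). simpl in X. unfold R_dist in X. rewrite Z, Rminus_0_l, Rabs_Ropp in X.
      assert (Rabs (H (r k)) < Rabs (H (r k))); [|lra]. apply X. split; [split; [exact I|auto]|exact Hy]. }
    set (W := tailprod N (r k)) in *.
    assert (DW : is_derive (tailprod N) (r k)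
      (- r k * (Fr2 q (r k) / 2) / H (r k) - W * pz_beta N k / r k)).
    { apply is_derive_ext_loc with (fun x => (- r k) * (- / r k * (H x * tailprod N x)) / H x).
      - apply filter_imp with (2 := Hloc). intros x Hx.
        match goal with |- ?a = ?b => change (@eq R a b) end. field. split; auto. lra.
      - evar_last.
        + apply is_derive_div; [|exact DH|rewrite HE; auto].
          apply is_derive_scal. exact E2.
        + match goal with |- ?a = ?b => change (@eq R a b) end. cbv beta. rewrite !HE. fold W. field. split; [lra|auto]. }
    (* The witness [v] is [- r k] times the derivative of the tail product at [r k]; the chord
       inequality places it between 0 and [1 - W]. *)
    exists (- r k * (- r k * (Fr2 q (r k) / 2) / H (r k) - W * pz_beta N k / r k)).
    split.
    + destruct (derive_right_bounds _ _ _ (- (1 - W) / r k) 0 (r N - r k) ltac:(lra) DW) as [B1 B2].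
      * intros h Hh. destruct (tailprod_secant N (r k) (r k + h) ltac:(lra) ltac:(lra)) as [S1 S2].
        fold W in S1, S2. fold W. split; [|lra].
        apply Rmult_le_reg_l with (r k); auto.
        replace (r k * (- (1 - W) / r k * h)) with (- (h * (1 - W))) by (field; lra).
        replace (r k + h - r k) with h in S2 by ring. lra.
      * set (d := - r k * (Fr2 q (r k) / 2) / H (r k) - W * pz_beta N k / r k) in *.
        split; [nra|]. apply Rmult_le_compat_l with (r := r k) in B1; [|lra].
        replace (r k * (- (1 - W) / r k)) with (- (1 - W)) in B1 by (field; lra). lra.
    (* At a zero the equation reduces to [r F'' = -(q + 1) F'], which is where the limit
       [-(q + 1) / 2] of [pz_beta] originates. *)
    + rewrite HE. assert (O := Fr_ode q (r k)).
      replace (Fr q (r k)) with 0 in O by (symmetry; apply Hr).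
      assert (EF : Fr1 q (r k) = - (pz_E N k * W) / r k) by (rewrite <- Ee; unfold pz_e; field; lra).
      assert (EF2 : Fr2 q (r k) = (INR q + 1) * (pz_E N k * W) / r k ^ 2).
      { apply Rmult_eq_reg_l with (r k); [|lra]. rewrite EF in O.
        replace (r k * ((INR q + 1) * (pz_E N k * W) / r k ^ 2)) with ((INR q + 1) * (pz_E N k * W) / r k) by (field; lra).
        lra. }
      rewrite EF2. field. split; auto. lra.
Qed.

(** * Signs, monotonicity and decay of the residues *)

Lemma pz_e_neq_0 k : pz_e k <> 0.
Proof.
  unfold pz_e. assert (P := r_pos k).
  assert (N : Fr1 q (r k) <> 0) by (apply Fr_root_simple; auto; apply Hr).
  apply Rmult_integral_contrapositive_currified; auto. lra.
Qed.

Lemma pz_Phi k : Phi q (r k) = 4 * r k ^ q * pz_e k ^ 2.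
Proof. rewrite Phi_at_root by apply Hr. unfold pz_e. ring. Qed.

Lemma pz_Phi_pos k : 0 < Phi q (r k).
Proof. apply Phi_pos, r_pos. Qed.

Lemma pz_Phi_ge i j : (i <= j)%nat -> Phi q (r i) <= Phi q (r j).
Proof.
  intros H. apply Phi_increasing. assert (P := r_pos i).
  destruct (Nat.eq_dec i j) as [->|]; [lra|]. assert (L := r_lt i j ltac:(lia)). lra.
Qed.

(** [Phi] and [Theta] agree at the zeros, so [Theta_growth] gives [Phi(r_k)^4 >= c r_k] for all
    large [k]. Monotonicity of [Phi] alone would not exclude a finite limit. *)
Lemma pz_Phi_infty M : exists K, forall k, (K <= k)%nat -> M < Phi q (r k).
Proof.
  destruct (pz_eventually_gt (INR q ^ 2 + 1)) as [K1 HK1].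
  set (c := Phi q (r K1) ^ 4 / r K1).
  assert (P1 := r_pos K1). assert (P2 := pz_Phi_pos K1).
  assert (Hc : 0 < c) by (apply Rdiv_lt_0_compat; auto; apply pow_lt; auto).
  destruct (pz_eventually_gt (Rabs M ^ 4 / c)) as [K2 HK2].
  exists (K1 + K2)%nat. intros k Hk.
  specialize (HK2 k ltac:(lia)). specialize (HK1 K1 (Nat.le_refl _)).
  assert (Hrk : r K1 <= r k).
  { destruct (Nat.eq_dec K1 k) as [<-|]; [lra|]. left; apply r_lt; lia. }
  assert (G := Theta_growth q (r K1) (r k) ltac:(lra) Hrk).
  rewrite !Theta_at_root in G by apply Hr. fold c in G.
  assert (G2 : c * r k <= Phi q (r k) ^ 4).
  { apply Rmult_le_compat_r with (r := r k) in G; [|lra].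
    replace (Phi q (r k) ^ 4 / r k * r k) with (Phi q (r k) ^ 4) in G by (field; lra). auto. }
  assert (G3 : Rabs M ^ 4 < c * r k).
  { apply Rmult_lt_compat_l with (r := c) in HK2; auto.
    replace (c * (Rabs M ^ 4 / c)) with (Rabs M ^ 4) in HK2 by (field; lra). auto. }
  assert (P3 := pz_Phi_pos k). assert (A := Rle_abs M). apply Rnot_le_lt. intros L.
  assert (Phi q (r k) ^ 4 <= Rabs M ^ 4) by (apply pow_incr; lra). lra.
Qed.

Lemma pz_e_sign k : 0 < (-1) ^ k * pz_e k.
Proof.
  destruct (tail_relations (S k) k ltac:(lia)) as [E _].
  assert (N := pz_e_neq_0 k).
  assert (B := tailprod_bounds (S k) (r k)).
  assert (L := r_lt k (S k) ltac:(lia)). assert (P := r_pos k).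
  specialize (B ltac:(lra)).
  assert (H := hole_sign (fun k => / r k) (S k) k ltac:(lia) (fun j _ => pz_s_pos j)
    (fun i j H => pz_s_lt i j (proj1 H))).
  fold (pz_E (S k) k) in H. rewrite E in *.
  rewrite <- Rmult_assoc. apply Rmult_lt_0_compat; auto.
  destruct (proj1 B) as [|Z]; auto. rewrite <- Z, Rmult_0_r in N. lra.
Qed.

(** The ceiling of [q / 2]. Since [|pz_e k| = sqrt (Phi (r k)) / (2 r_k^(q/2))], it is the least
    integer power of [1 / r_k] that always offsets the factor [r_k^(q/2)] in the residue. It is also
    the number of powers [z^(-n)] in the principal part of [1 / J_q] allowed by parity. *)
Definition half_up : nat := Nat.div (q + 1) 2.

Lemma half_up_cases : (q = 2 * half_up)%nat \/ (q + 1 = 2 * half_up)%nat.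
Proof.
  unfold half_up. assert (H := Nat.div_mod (q + 1) 2 ltac:(lia)).
  assert (H2 := Nat.mod_upper_bound (q + 1) 2 ltac:(lia)). lia.
Qed.

Definition pz_a (k : nat) : R := (/ r k) ^ half_up / ((-1) ^ k * pz_e k).

Lemma sign_sq k : (-1) ^ k * (-1) ^ k = 1.
Proof. rewrite <- Rpow_mult_distr. replace (-1 * -1) with 1 by ring. apply pow1. Qed.

Lemma pz_a_alt k : (-1) ^ k * pz_a k = (/ r k) ^ half_up / pz_e k.
Proof.
  unfold pz_a. assert (N := pz_e_neq_0 k).
  assert (N1 : (-1) ^ k <> 0) by (apply pow_nonzero; lra).
  field. auto.
Qed.

Lemma pz_a_pos k : 0 < pz_a k.
Proof. apply Rdiv_lt_0_compat; [apply pow_lt, pz_s_pos|apply pz_e_sign]. Qed.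

(** Squares avoid half-integer powers: according to the parity of [q], division by [r_k^half_up]
    removes the power of [r_k] exactly or leaves an extra [1 / r_k]. Either expression decreases to
    0. *)
Lemma pz_a_parity : (forall k, pz_a k ^ 2 = 4 / Phi q (r k)) \/
  (forall k, pz_a k ^ 2 = 4 * / r k / Phi q (r k)).
Proof.
  assert (E : forall k, pz_a k ^ 2 = (/ r k) ^ (2 * half_up) / pz_e k ^ 2).
  { intros k. assert (N := pz_e_neq_0 k). replace (pz_a k ^ 2) with (((-1) ^ k * pz_a k) ^ 2).
    - rewrite pz_a_alt. rewrite Nat.mul_comm, pow_mult. field; auto.
    - replace (((-1) ^ k * pz_a k) ^ 2) with ((-1) ^ k * (-1) ^ k * pz_a k ^ 2) by ring.
      rewrite sign_sq; ring. }
  destruct half_up_cases as [H|H]; [left|right]; intros k; rewrite E, pz_Phi, <- H;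
    assert (N := pz_e_neq_0 k); assert (P := r_pos k);
    assert (Hq : r k ^ q <> 0) by (apply pow_nonzero; lra).
  - rewrite pow_inv. field; auto.
  - replace (q + 1)%nat with (S q) by lia. simpl. rewrite pow_inv. field. repeat split; auto. lra.
Qed.

Lemma pz_inv_Phi_le i j : (i <= j)%nat -> 4 / Phi q (r j) <= 4 / Phi q (r i).
Proof.
  intros H. apply Rmult_le_compat_l; [lra|]. apply Rinv_le_contravar; [apply pz_Phi_pos|now apply pz_Phi_ge].
Qed.

Lemma pz_a_decr k : pz_a (S k) <= pz_a k.
Proof.
  assert (P1 := pz_a_pos k).
  apply Rnot_lt_le; intros L.
  assert (L2 : pz_a k ^ 2 < pz_a (S k) ^ 2) by nra.
  assert (D := pz_inv_Phi_le k (S k) ltac:(lia)).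
  destruct pz_a_parity as [H|H]; rewrite !H in L2; [lra|].
  assert (S1 := pz_s_lt k (S k) ltac:(lia)). assert (S2 := pz_s_pos (S k)).
  assert (0 < 4 / Phi q (r (S k))) by (apply Rdiv_lt_0_compat; [lra|apply pz_Phi_pos]).
  replace (4 * / r k / Phi q (r k)) with (4 / Phi q (r k) * / r k) in L2 by (unfold Rdiv; ring).
  replace (4 * / r (S k) / Phi q (r (S k))) with (4 / Phi q (r (S k)) * / r (S k)) in L2 by (unfold Rdiv; ring).
  assert (4 / Phi q (r (S k)) * / r (S k) <= 4 / Phi q (r k) * / r k) by (apply Rmult_le_compat; lra).
  lra.
Qed.

Lemma pz_s_le_0 k : / r k <= / r 0%nat.
Proof. destruct k; [lra|]. left; apply pz_s_lt; lia. Qed.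

Lemma pz_a_lim : is_lim_seq pz_a 0.
Proof.
  apply is_lim_seq_spec; intros eps. set (c := 1 + / r 0%nat).
  assert (S0 := pz_s_pos 0). assert (He := cond_pos eps).
  destruct (pz_Phi_infty (4 * c / eps ^ 2)) as [K HK].
  exists K; intros k Hk. specialize (HK k Hk). rewrite Rminus_0_r, Rabs_pos_eq by (left; apply pz_a_pos).
  assert (PP := pz_Phi_pos k).
  assert (A : pz_a k ^ 2 <= 4 * c / Phi q (r k)).
  { assert (0 < / Phi q (r k)) by (apply Rinv_0_lt_compat; auto).
    assert (Sk := pz_s_le_0 k).
    destruct pz_a_parity as [H'|H']; rewrite H'; unfold Rdiv, c; nra. }
  assert (B : 4 * c / Phi q (r k) < eps ^ 2).
  { assert (0 < pos eps ^ 2) by (apply pow_lt; auto).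
    apply Rmult_lt_reg_r with (Phi q (r k)); auto.
    replace (4 * c / Phi q (r k) * Phi q (r k)) with (4 * c) by (field; lra).
    apply Rmult_lt_compat_l with (r := eps ^ 2) in HK; auto.
    replace (eps ^ 2 * (4 * c / eps ^ 2)) with (4 * c) in HK by (field; lra). auto. }
  apply Rnot_le_lt; intros L. nra.
Qed.

Lemma F_factor_neq_0 w : besselF q w <> 0%C -> forall k, (1 - RtoC (/ r k) * w <> 0)%C.
Proof.
  intros HF k E. apply HF.
  apply (clim_unique (prodC (fun j => 1 - RtoC (/ r j) * w)%C)); [apply pz_product|].
  apply clim_ext_loc with (fun _ => RtoC 0) (S k); [|apply clim_const].
  intros n Hn. symmetry. apply prodC_eq_0 with k; [lia|auto].
Qed.

Lemma resolvent_bound w : (forall k, (1 - RtoC (/ r k) * w <> 0)%C) ->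
  exists D, 0 < D /\ forall k, Cmod (/ (1 - RtoC (/ r k) * w)) <= D.
Proof.
  intros Hw.
  destruct (pz_eventually_gt (2 * Cmod w)) as [K HK].
  assert (Fin : forall n, exists D, 0 < D /\ forall k, (k < n)%nat -> Cmod (/ (1 - RtoC (/ r k) * w)) <= D).
  { induction n as [|n (D & HD & H)]; [exists 1; split; [lra|intros; lia]|].
    exists (D + Cmod (/ (1 - RtoC (/ r n) * w))).
    assert (P := Cmod_ge_0 (/ (1 - RtoC (/ r n) * w))).
    split; [lra|]. intros k Hk. destruct (Nat.eq_dec k n) as [->|]; [lra|].
    specialize (H k ltac:(lia)). lra. }
  destruct (Fin K) as (D & HD & H). exists (D + 2). split; [lra|].
  intros k. destruct (le_lt_dec K k) as [L|L]; [|specialize (H k L); lra].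
  specialize (HK k L).
  assert (P := r_pos k). assert (P2 := pz_s_pos k).
  assert (B : Cmod (RtoC (/ r k) * w) <= / 2).
  { rewrite Cmod_mult, Cmod_R, Rabs_pos_eq by lra.
    apply Rmult_le_reg_l with (r k); auto. rewrite <- Rmult_assoc, Rinv_r; lra. }
  assert (B2 : / 2 <= Cmod (1 - RtoC (/ r k) * w)).
  { assert (T := Cmod_triangle (1 - RtoC (/ r k) * w) (RtoC (/ r k) * w)).
    replace (1 - RtoC (/ r k) * w + RtoC (/ r k) * w)%C with (RtoC 1) in T by ring.
    rewrite Cmod_1 in T. lra. }
  rewrite Cmod_inv by auto.
  apply Rle_trans with (/ / 2); [apply Rinv_le_contravar; lra|]. rewrite Rinv_inv. lra.
Qed.

Lemma tail_at_root_bounds N k : (k < N)%nat -> 0 <= tailprod N (r k) <= 1.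
Proof.
  intros H. apply tailprod_bounds. assert (P := r_pos k).
  assert (L := r_lt k N H). lra.
Qed.

Lemma pfE_RtoC N k : pfE (fun j => RtoC (/ r j)) N k = RtoC (pz_E N k).
Proof.
  unfold pfE, pz_E. rewrite <- prodC_RtoC. apply prodC_ext; intros j _.
  destruct (Nat.eq_dec j k); auto.
  assert (P := pz_s_pos k). rewrite RtoC_minus, RtoC_div by lra. reflexivity.
Qed.

Lemma pfbeta_RtoC N k : pfbeta (fun j => RtoC (/ r j)) N k = RtoC (pz_beta N k).
Proof.
  unfold pfbeta, pz_beta. rewrite <- sumC_RtoC. apply sumC_ext; intros j _.
  destruct (Nat.eq_dec j k) as [|n]; auto.
  apply pz_s_inj in n. rewrite RtoC_div, RtoC_minus by lra. reflexivity.
Qed.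

Lemma RtoC_s_neq_0 k : RtoC (/ r k) <> 0%C.
Proof. apply RtoC_neq_0. assert (P := pz_s_pos k); lra. Qed.

Lemma RtoC_s_inj i j : i <> j -> RtoC (/ r i) <> RtoC (/ r j).
Proof. intros H E; apply RtoC_inj in E. revert E. now apply pz_s_inj. Qed.

Lemma inv_pz_E N k : (k < N)%nat -> / pz_E N k = tailprod N (r k) / pz_e k.
Proof.
  intros H. destruct (tail_relations N k H) as [E _].
  assert (N1 := pz_e_neq_0 k). assert (N2 := pz_E_neq_0 N k).
  assert (N3 : tailprod N (r k) <> 0) by (intros Z; rewrite Z, Rmult_0_r in E; auto).
  rewrite E. field; auto.
Qed.

Lemma small_real_F x : 0 < x < r 0%nat -> besselF q (RtoC x) <> 0%C.
Proof.
  intros Hx E. rewrite besselF_RtoC in E. apply RtoC_inj in E.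
  destruct Hr as (_ & _ & _ & H4). destruct (H4 x) as [k Hk]; [lra|auto|].
  assert (S1 := r_lt 0 k). destruct k; [lra|]. specialize (S1 ltac:(lia)). lra.
Qed.

(** * Passage to the limit in the finite expansions *)

Lemma inv_prod_lim w : besselF q w <> 0%C ->
  clim (fun N => / prodC (fun j => 1 - RtoC (/ r j) * w)%C N)%C (/ besselF q w)%C.
Proof.
  intros HF. apply clim_inv; auto.
  - intros N. apply prodC_neq_0; intros. now apply F_factor_neq_0.
  - apply pz_product.
Qed.

(** Each resolvent is split as [1 + s w / (1 - s w)] with [s = 1 / r_k]. The constant parts form an
    alternating real series independent of [w]; the others gain a factor [1 / r_k] and converge
    absolutely. *)
Lemma inv_F_remainder w : besselF q w <> 0%C -> exists S0 : C,
  clim (sumC (fun k => RtoC ((/ r k) ^ half_up / pz_e k) * / (1 - RtoC (/ r k) * w))%C) S0 /\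
  clim (fun N => sumC (fun k => RtoC ((/ r k) ^ half_up / pz_e k * tailprod N (r k))
    * / (1 - RtoC (/ r k) * w))%C N) S0.
Proof.
  intros HF. assert (Hne := F_factor_neq_0 w HF).
  destruct (resolvent_bound w Hne) as (D & HD & HDb).
  (* Rows decrease in [k] because both [pz_a] and the tail product at [r k] do. *)
  destruct (alternating_tannery (fun N k => pz_a k * tailprod N (r k)) pz_a) as (L & L1 & L2).
  - intros N k Hk. assert (P := pz_a_pos k). assert (B := tail_at_root_bounds N k Hk). nra.
  - intros N k Hk. assert (P' := pz_a_pos (S k)). assert (Dc := pz_a_decr k).
    assert (B2 := tail_at_root_bounds N (S k) ltac:(lia)).
    assert (R1 := r_pos k). assert (R2 := r_lt k (S k) ltac:(lia)).
    assert (R3 := r_lt (S k) N ltac:(lia)).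
    destruct (tailprod_secant N (r k) (r (S k)) ltac:(lra) ltac:(lra)) as [T _].
    apply Rmult_le_compat; lra.
  - intros k. replace (Finite (pz_a k)) with (Finite (pz_a k * 1)) by (f_equal; ring).
    apply is_lim_seq_mult'; [apply is_lim_seq_const|].
    apply tailprod_to_1. left; apply r_pos.
  - apply pz_a_decr.
  - apply pz_a_lim.
  - destruct (tannery
      (fun N k => RtoC ((/ r k) ^ half_up / pz_e k * tailprod N (r k)) * (RtoC (/ r k) * w * / (1 - RtoC (/ r k) * w)))%C
      (fun k => RtoC ((/ r k) ^ half_up / pz_e k) * (RtoC (/ r k) * w * / (1 - RtoC (/ r k) * w)))%C
      (fun k => (pz_a 0 * (Cmod w * D)) * / r k) ((pz_a 0 * (Cmod w * D)) * 4)) as (T & T1 & T2).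
    + intros N k Hk. rewrite !Cmod_mult, !Cmod_R.
      rewrite <- pz_a_alt, !Rabs_mult, pow_1_abs, Rmult_1_l.
      assert (B := tail_at_root_bounds N k Hk). assert (P := pz_a_pos k).
      assert (P2 := pz_s_pos k).
      rewrite !Rabs_pos_eq by lra.
      assert (Pa : pz_a k <= pz_a 0%nat).
      { clear -r Hr. induction k; [lra|]. eapply Rle_trans; [apply pz_a_decr|auto]. }
      replace (pz_a 0 * (Cmod w * D) * / r k) with ((pz_a 0 * 1) * (/ r k * Cmod w * D)) by ring.
      assert (W := Cmod_ge_0 w). assert (Z := Cmod_ge_0 (/ (1 - RtoC (/ r k) * w))).
      apply Rmult_le_compat; try apply Rmult_le_compat; try lra; auto.
      * apply Rmult_le_pos; lra.
      * repeat apply Rmult_le_pos; lra.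
      * apply Rmult_le_pos; lra.
    + intros k. apply clim_mult; [|apply clim_const]. apply clim_RtoC.
      replace (Finite ((/ r k) ^ half_up / pz_e k)) with (Finite ((/ r k) ^ half_up / pz_e k * 1)) by (f_equal; ring).
      apply is_lim_seq_mult'; [apply is_lim_seq_const|].
      apply tailprod_to_1. left; apply r_pos.
    + intros n. rewrite sumR_scal. apply Rmult_le_compat_l; [|apply pz_sum_le].
      apply Rmult_le_pos; [left; apply pz_a_pos|]. apply Rmult_le_pos; [apply Cmod_ge_0|lra].
    + exists (RtoC L + T)%C. split.
      * eapply clim_ext; [|exact (clim_plus _ _ _ _ (clim_RtoC _ _ L1) T1)].
        intros n; simpl. rewrite <- sumC_RtoC, <- sumC_plus. apply sumC_ext; intros k _.
        rewrite pz_a_alt. field. apply Hne.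
      * eapply clim_ext; [|exact (clim_plus _ _ _ _ (clim_RtoC _ _ L2) T2)].
        intros n; simpl. rewrite <- sumC_RtoC, <- sumC_plus. apply sumC_ext; intros k _.
        rewrite <- Rmult_assoc, pz_a_alt. field. apply Hne.
Qed.

(** The coefficients [c i] are limits of weighted sums [cN N i] to which no dominated convergence is
    applied; they are obtained as what remains when the two other parts of the identity converge. *)
Lemma inv_F_expansion : exists c : nat -> C, forall w, besselF q w <> 0%C -> exists S0 : C,
  clim (sumC (fun k => RtoC ((/ r k) ^ half_up / pz_e k) * / (1 - RtoC (/ r k) * w))%C) S0 /\
  (/ besselF q w = sumC (fun i => c i * w ^ i) half_up + w ^ half_up * S0)%C.
Proof.
  set (cN := fun N i => sumC (fun k => RtoC ((/ r k) ^ i / pz_e k * tailprod N (r k))) N).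
  assert (Hid : forall w N, besselF q w <> 0%C -> (0 < N)%nat ->
    (/ prodC (fun j => 1 - RtoC (/ r j) * w) N = sumC (fun i => cN N i * w ^ i) half_up +
     w ^ half_up * sumC (fun k => RtoC ((/ r k) ^ half_up / pz_e k * tailprod N (r k))
        * / (1 - RtoC (/ r k) * w)) N)%C).
  { intros w N HF HN. assert (Hne := F_factor_neq_0 w HF).
    rewrite (partial_fractions (fun j => RtoC (/ r j)) RtoC_s_neq_0 RtoC_s_inj N HN w) by auto.
    rewrite (sumC_ext _ (fun k => sumC (fun i => RtoC ((/ r k) ^ i / pz_e k * tailprod N (r k)) * w ^ i) half_up
      + w ^ half_up * (RtoC ((/ r k) ^ half_up / pz_e k * tailprod N (r k)) * / (1 - RtoC (/ r k) * w)))%C).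
    - rewrite sumC_plus, sumC_scal. f_equal. unfold cN. now rewrite sumC_exchange.
    - intros k Hk. rewrite pfE_RtoC.
      assert (NE := pz_E_neq_0 N k).
      assert (NE' : RtoC (pz_E N k) <> 0%C) by (apply RtoC_neq_0; auto).
      replace (/ (RtoC (pz_E N k) * (1 - RtoC (/ r k) * w)))%C with (RtoC (/ pz_E N k) * / (1 - RtoC (/ r k) * w))%C
        by (rewrite RtoC_inv by auto; field; split; auto).
      rewrite inv_pz_E by auto.
      rewrite (geometric_split (RtoC (/ r k) * w) half_up (Hne k)) at 1.
      rewrite Cmult_plus_distr_l, <- sumC_scal. f_equal.
      + apply sumC_ext; intros i _. rewrite Cpow_mult_l, <- RtoC_pow, Cmult_assoc, <- RtoC_mult.
        f_equal. f_equal. unfold Rdiv; ring.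
      + rewrite Cpow_mult_l, <- RtoC_pow.
        replace (RtoC ((/ r k) ^ half_up / pz_e k * tailprod N (r k))) with
          (RtoC (tailprod N (r k) / pz_e k) * RtoC ((/ r k) ^ half_up))%C
          by (rewrite <- RtoC_mult; f_equal; unfold Rdiv; ring). ring. }
  assert (Hlim : forall w S0, besselF q w <> 0%C ->
    clim (fun N => sumC (fun k => RtoC ((/ r k) ^ half_up / pz_e k * tailprod N (r k))
    * / (1 - RtoC (/ r k) * w))%C N) S0 ->
    clim (fun N => sumC (fun i => cN N i * w ^ i)%C half_up) (/ besselF q w - w ^ half_up * S0)%C).
  { intros w S0 HF HS.
    apply clim_ext_loc with (fun N => / prodC (fun j => 1 - RtoC (/ r j) * w) N - w ^ half_up *
      sumC (fun k => RtoC ((/ r k) ^ half_up / pz_e k * tailprod N (r k)) * / (1 - RtoC (/ r k) * w)) N)%C 1%nat.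
    - intros N HN. rewrite Hid by (auto; lia). ring.
    - apply clim_minus; [now apply inv_prod_lim|]. now apply clim_scal. }
  (* On [(0, r 0)] the function [F] has no zero, so the polynomial parts converge there and
     [poly_coef_clim] applies. *)
  assert (Hc : forall i, exists c, (i < half_up)%nat -> clim (fun N => cN N i) c).
  { intros i. destruct (le_lt_dec half_up i); [exists 0%C; intros; lia|].
    destruct (poly_coef_clim half_up cN (r 0%nat)) with i as [c Hc]; auto.
    - apply r_pos.
    - intros x Hx. assert (HF := small_real_F x Hx).
      destruct (inv_F_remainder (RtoC x) HF) as (S0 & _ & H2). eexists. apply Hlim; eauto.
    - exists c; auto. }
  apply choice in Hc; destruct Hc as [c Hc].
  exists c. intros w HF. destruct (inv_F_remainder w HF) as (S0 & H1 & H2). exists S0; split; auto.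
  assert (L1 := Hlim w S0 HF H2).
  assert (L2 : clim (fun N => sumC (fun i => cN N i * w ^ i)%C half_up) (sumC (fun i => c i * w ^ i) half_up)%C).
  { apply clim_sumC; intros k Hk. apply clim_mult; [auto|apply clim_const]. }
  rewrite <- (clim_unique _ _ _ L1 L2). ring.
Qed.

Lemma pz_e_sq k : (/ r k) ^ S q / pz_e k ^ 2 = 4 / Phi q (r k) * / r k.
Proof.
  assert (N := pz_e_neq_0 k). assert (P := r_pos k).
  assert (Hq : r k ^ q <> 0) by (apply pow_nonzero; lra).
  rewrite pz_Phi. simpl. rewrite pow_inv. field. repeat split; auto. lra.
Qed.

Lemma sq_coef_bounds k : 0 <= (/ r k) ^ S q / pz_e k ^ 2 <= 4 / Phi q (r 0%nat) * / r k.
Proof.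
  rewrite pz_e_sq. assert (P := pz_s_pos k). assert (D := pz_inv_Phi_le 0 k ltac:(lia)).
  assert (0 < 4 / Phi q (r k)) by (apply Rdiv_lt_0_compat; [lra|apply pz_Phi_pos]). nra.
Qed.

(** With [W] the tail product and [v] from [tail_relations], a node contributes
    [W^2 (A^2 - (q + 1) A) + 2 W v A] up to the factor [1 / pz_e^2]. The bracket leaves only double
    poles after [q + 1] geometric terms, and the rest vanishes since [0 <= v <= 1 - W]. *)
Lemma inv_F2_expansion : exists d : nat -> C, forall w, besselF q w <> 0%C -> exists S0 : C,
  clim (sumC (fun k => RtoC ((/ r k) ^ S q / pz_e k ^ 2) * (/ (1 - RtoC (/ r k) * w)) ^ 2)%C) S0 /\
  (/ besselF q w ^ 2 = sumC (fun i => d i * w ^ i) (S q) + w ^ S q * S0)%C.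
Proof.
  (* Turns the existential of [tail_relations] into a function of [N] and [k], so that it can be
     used under sums. *)
  destruct (choice (fun (Nk : nat * nat) v => (snd Nk < fst Nk)%nat ->
    0 <= v <= 1 - tailprod (fst Nk) (r (snd Nk)) /\
    pz_beta (fst Nk) (snd Nk) * tailprod (fst Nk) (r (snd Nk)) =
      v - (INR q + 1) / 2 * tailprod (fst Nk) (r (snd Nk)))) as [v' Hv'].
  { intros [N k]; simpl. destruct (lt_dec k N) as [L|L]; [|exists 0; intros; lia].
    destruct (tail_relations N k L) as (_ & v & Hv). exists v; auto. }
  set (v := fun N k => v' (N, k)).
  assert (Hv : forall N k, (k < N)%nat -> 0 <= v N k <= 1 - tailprod N (r k) /\
     pz_beta N k * tailprod N (r k) = v N k - (INR q + 1) / 2 * tailprod N (r k))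
    by (intros N k H; exact (Hv' (N, k) H)).
  clearbody v. clear v' Hv'.
  set (b := fun k => (/ r k) ^ S q / pz_e k ^ 2).
  set (W := fun N k => tailprod N (r k)).
  set (A := fun w k => (/ (1 - RtoC (/ r k) * w))%C).
  assert (HW1 : forall k, is_lim_seq (fun N => W N k) 1)
    by (intros k; apply tailprod_to_1; left; apply r_pos).
  assert (Hv0 : forall k, is_lim_seq (fun N => v N k) 0).
  { intros k. apply is_lim_seq_le_le_loc with (fun _ => 0) (fun N => 1 - W N k).
    - exists (S k). intros N HN. apply (Hv N k); lia.
    - apply is_lim_seq_const.
    - replace (Finite 0) with (Finite (1 - 1)) by (f_equal; ring).
      apply is_lim_seq_minus'; [apply is_lim_seq_const|apply HW1]. }
  assert (Hrem : forall w, besselF q w <> 0%C -> exists S0,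
    clim (sumC (fun k => RtoC (b k) * A w k ^ 2)%C) S0 /\
    clim (fun N => sumC (fun k => RtoC (b k * W N k ^ 2) * A w k ^ 2
      + RtoC (b k * (2 * W N k * v N k)) * A w k)%C N) S0).
  { intros w HF. destruct (resolvent_bound w (F_factor_neq_0 w HF)) as (D & HD & HDb).
    set (c0 := 4 / Phi q (r 0%nat)).
    assert (Hc0 : 0 < c0) by (apply Rdiv_lt_0_compat; [lra|apply pz_Phi_pos]).
    apply tannery with (M := fun k => c0 * (D ^ 2 + 2 * D) * / r k) (B := c0 * (D ^ 2 + 2 * D) * 4).
    - intros N k Hk. eapply Rle_trans; [apply Cmod_triangle|].
      rewrite !Cmod_mult, !Cmod_R, Cmod_pow.
      destruct (Hv N k Hk) as [V _]. assert (T := tail_at_root_bounds N k Hk).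
      destruct (sq_coef_bounds k) as [B1 B2]. fold (b k) c0 in B1, B2. fold (W N k) in T, V.
      specialize (HDb k). fold (A w k) in HDb. assert (G := Cmod_ge_0 (A w k)).
      assert (P1 : 0 <= b k * W N k ^ 2) by (apply Rmult_le_pos; [auto|apply pow2_ge_0]).
      assert (P2 : 0 <= b k * (2 * W N k * v N k)) by (apply Rmult_le_pos; [auto|nra]).
      rewrite (Rabs_pos_eq _ P1), (Rabs_pos_eq _ P2).
      assert (X1 : Cmod (A w k) ^ 2 <= D ^ 2) by (apply pow_incr; lra).
      assert (X2 : b k * W N k ^ 2 <= c0 * / r k) by (assert (0 <= W N k ^ 2 <= 1) by nra; nra).
      assert (X3 : b k * (2 * W N k * v N k) <= 2 * (c0 * / r k)).
      { assert (0 <= W N k * v N k <= 1) by nra. nra. }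
      assert (X4 := pow2_ge_0 (Cmod (A w k))).
      replace (c0 * (D ^ 2 + 2 * D) * / r k) with ((c0 * / r k) * D ^ 2 + 2 * (c0 * / r k) * D) by ring.
      apply Rplus_le_compat; apply Rmult_le_compat; auto.
    - intros k.
      (* The limit is written with [W = 1] and [v = 0] inserted, to match the terms of the row one
         by one. *)
      replace (RtoC (b k) * A w k ^ 2)%C with (RtoC (b k * 1 ^ 2) * A w k ^ 2 + RtoC (b k * (2 * 1 * 0)) * A w k)%C.
      2: { replace (b k * 1 ^ 2) with (b k) by ring. replace (b k * (2 * 1 * 0)) with 0 by ring. ring. }
      apply clim_plus; (apply clim_mult; [apply clim_RtoC|apply clim_const]);
        (apply is_lim_seq_mult'; [apply is_lim_seq_const|]).
      + simpl. apply is_lim_seq_mult'; [apply HW1|]. apply is_lim_seq_mult'; [apply HW1|apply is_lim_seq_const].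
      + apply is_lim_seq_mult'; [|apply Hv0]. apply is_lim_seq_mult'; [apply is_lim_seq_const|apply HW1].
    - intros n. rewrite sumR_scal. apply Rmult_le_compat_l; [|apply pz_sum_le].
      apply Rmult_le_pos; [lra|nra]. }
  (* The factor [INR i - INR q] comes from [geometric_combination], the other summand from the
     expansion of the simple pole carrying [v]. *)
  set (dN := fun N i => sumC (fun k => RtoC ((/ r k) ^ i / pz_e k ^ 2 *
     (W N k ^ 2 * (INR i - INR q) + 2 * W N k * v N k))) N).
  assert (Hid : forall w N, besselF q w <> 0%C -> (0 < N)%nat ->
    (/ prodC (fun j => 1 - RtoC (/ r j) * w) N ^ 2 = sumC (fun i => dN N i * w ^ i) (S q) +
     w ^ S q * sumC (fun k => RtoC (b k * W N k ^ 2) * A w k ^ 2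
      + RtoC (b k * (2 * W N k * v N k)) * A w k) N)%C).
  { intros w N HF HN. assert (Hne := F_factor_neq_0 w HF).
    rewrite (proj1 (partial_fractions_square (fun j => RtoC (/ r j)) RtoC_s_neq_0 RtoC_s_inj N HN) w) by auto.
    rewrite (sumC_ext _ (fun k => sumC (fun i => RtoC ((/ r k) ^ i / pz_e k ^ 2 *
       (W N k ^ 2 * (INR i - INR q) + 2 * W N k * v N k)) * w ^ i) (S q)
      + w ^ S q * (RtoC (b k * W N k ^ 2) * A w k ^ 2 + RtoC (b k * (2 * W N k * v N k)) * A w k))%C).
    - rewrite sumC_plus, sumC_scal. f_equal. unfold dN. now rewrite sumC_exchange.
    - intros k Hk. rewrite pfE_RtoC, pfbeta_RtoC.
      assert (NE := pz_E_neq_0 N k). assert (Ne := pz_e_neq_0 k).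
      destruct (Hv N k Hk) as [_ V]. fold (W N k) in V.
      assert (IE := inv_pz_E N k Hk). fold (W N k) in IE.
      transitivity (RtoC (/ pz_e k ^ 2 * W N k ^ 2) * (A w k ^ 2 - RtoC (INR q + 1) * A w k)
        + RtoC (/ pz_e k ^ 2 * (2 * W N k * v N k)) * A w k)%C.
      { rewrite <- RtoC_pow, <- RtoC_inv by (apply pow_nonzero; auto).
        change (/ (1 - RtoC (/ r k) * w))%C with (A w k).
        replace (/ pz_E N k ^ 2) with (/ pz_e k ^ 2 * W N k ^ 2)
          by (rewrite <- (pow_inv (pz_E N k)), IE; field; auto).
        assert (E2 : / pz_e k ^ 2 * W N k ^ 2 * (2 * pz_beta N k) =
          / pz_e k ^ 2 * (2 * W N k * v N k) - / pz_e k ^ 2 * W N k ^ 2 * (INR q + 1)).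
        { transitivity (2 * / pz_e k ^ 2 * W N k * (pz_beta N k * W N k)); [ring|].
          rewrite V. field; auto. }
        transitivity (RtoC (/ pz_e k ^ 2 * W N k ^ 2) * A w k ^ 2 +
           RtoC (/ pz_e k ^ 2 * W N k ^ 2 * (2 * pz_beta N k)) * A w k)%C.
        - rewrite (RtoC_mult _ (2 * pz_beta N k)), (RtoC_mult 2). ring.
        - rewrite E2, RtoC_minus, (RtoC_mult _ (INR q + 1)). ring. }
      assert (Gc := geometric_combination (RtoC (/ r k) * w)%C q (Hne k)).
      assert (Gs := geometric_split (RtoC (/ r k) * w)%C (S q) (Hne k)).
      change (/ (1 - RtoC (/ r k) * w))%C with (A w k) in Gc, Gs.
      rewrite Gc. rewrite Gs at 2. unfold b.
      rewrite !Cmult_plus_distr_l, <- !sumC_scal.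
      rewrite (sumC_ext (fun i => RtoC ((/ r k) ^ i / pz_e k ^ 2 * (W N k ^ 2 * (INR i - INR q) + 2 * W N k * v N k)) * w ^ i)%C
       (fun i => RtoC (/ pz_e k ^ 2 * W N k ^ 2) * (RtoC (INR i - INR q) * (RtoC (/ r k) * w) ^ i) +
          RtoC (/ pz_e k ^ 2 * (2 * W N k * v N k)) * (RtoC (/ r k) * w) ^ i)%C).
      2: { intros i _. rewrite !Cpow_mult_l, <- RtoC_pow. unfold Rdiv.
           repeat rewrite ?RtoC_mult, ?RtoC_plus. ring. }
      rewrite sumC_plus. rewrite !Cpow_mult_l, <- !RtoC_pow. unfold Rdiv.
      repeat rewrite ?RtoC_mult, ?RtoC_plus. ring. }
  assert (Hlim : forall w S0, besselF q w <> 0%C ->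
    clim (fun N => sumC (fun k => RtoC (b k * W N k ^ 2) * A w k ^ 2
      + RtoC (b k * (2 * W N k * v N k)) * A w k)%C N) S0 ->
    clim (fun N => sumC (fun i => dN N i * w ^ i)%C (S q)) (/ besselF q w ^ 2 - w ^ S q * S0)%C).
  { intros w S0 HF HS.
    apply clim_ext_loc with (fun N => / prodC (fun j => 1 - RtoC (/ r j) * w) N ^ 2 - w ^ S q *
      sumC (fun k => RtoC (b k * W N k ^ 2) * A w k ^ 2
      + RtoC (b k * (2 * W N k * v N k)) * A w k) N)%C 1%nat.
    - intros N HN. rewrite Hid by (auto; lia). ring.
    - apply clim_minus; [|now apply clim_scal].
      apply clim_ext with (fun N => / prodC (fun j => 1 - RtoC (/ r j) * w) N * / prodC (fun j => 1 - RtoC (/ r j) * w) N)%C.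
      + intros N. field. apply prodC_neq_0; intros; now apply F_factor_neq_0.
      + replace (/ besselF q w ^ 2)%C with (/ besselF q w * / besselF q w)%C by (field; auto).
        apply clim_mult; now apply inv_prod_lim. }
  assert (Hc : forall i, exists d, (i < S q)%nat -> clim (fun N => dN N i) d).
  { intros i. destruct (le_lt_dec (S q) i); [exists 0%C; intros; lia|].
    destruct (poly_coef_clim (S q) dN (r 0%nat)) with i as [d Hd]; auto.
    - apply r_pos.
    - intros x Hx. assert (HF := small_real_F x Hx).
      destruct (Hrem (RtoC x) HF) as (S0 & _ & H2). eexists. apply Hlim; eauto.
    - exists d; auto. }
  apply choice in Hc; destruct Hc as [d Hd].
  exists d. intros w HF. destruct (Hrem w HF) as (S0 & H1 & H2). exists S0; split; auto.
  assert (L1 := Hlim w S0 HF H2).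
  assert (L2 : clim (fun N => sumC (fun i => dN N i * w ^ i)%C (S q)) (sumC (fun i => d i * w ^ i) (S q))%C).
  { apply clim_sumC; intros k Hk. apply clim_mult; [auto|apply clim_const]. }
  rewrite <- (clim_unique _ _ _ L1 L2). ring.
Qed.

(** * Identification of the polynomial parts with Taylor polynomials *)

Lemma small_s (w : C) : Cmod w < Rmin (/ 2) (r 0%nat / 2) -> forall k, / r k * Cmod w <= / 2.
Proof.
  intros Hw k. assert (M := Rmin_r (/ 2) (r 0%nat / 2)).
  assert (S1 := pz_s_le_0 k).
  assert (G := Cmod_ge_0 w). assert (S2 := pz_s_pos k).
  apply Rle_trans with (/ r 0%nat * (r 0%nat / 2)); [apply Rmult_le_compat; lra|].
  right; field; lra.
Qed.

Lemma abs_summable_coefs (b : nat -> R) (alpha : nat -> R) (B : R) :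
  (forall n, sumR (fun k => Rabs (b k)) n <= B) ->
  exists beta : nat -> R, forall i, is_lim_seq (sumR (fun k => b k * (alpha i * (/ r k) ^ i))) (beta i).
Proof.
  intros HB. apply (choice (fun i l => is_lim_seq (sumR (fun k => b k * (alpha i * (/ r k) ^ i))) (Finite l))).
  intros i. set (c := Rabs (alpha i) * (/ r 0%nat) ^ i).
  assert (ex_series (fun k => b k * (alpha i * (/ r k) ^ i))).
  { apply (ex_series_le (K := R_AbsRing) (V := R_CompleteNormedModule) _ (fun k => c * Rabs (b k))).
    - intros k. unfold norm; simpl. unfold abs; simpl. rewrite !Rabs_mult, Rmult_comm.
      apply Rmult_le_compat_r; [apply Rabs_pos|].
      unfold c. apply Rmult_le_compat_l; [apply Rabs_pos|].
      assert (Sk := pz_s_pos k). rewrite Rabs_pos_eq by (apply pow_le; lra).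
      apply pow_incr; split; [lra|apply pz_s_le_0].
    - destruct (bounded_sums_lim (fun k => Rabs (b k)) B (fun k => Rabs_pos _) HB) as (l & Hl & _).
      exists (c * l). apply is_series_sumR.
      eapply is_lim_seq_ext; [|apply (is_lim_seq_mult' (fun _ => c) _ c l (is_lim_seq_const c) Hl)].
      intros n; simpl. now rewrite sumR_scal. }
  destruct H as [l Hl]. exists l. now apply is_series_sumR.
Qed.

(** Expanding the remainder in powers of [w] shows that the polynomial split off is the start of the
    Taylor series of [1 / F]. The constant term of the remainder is treated apart, being the only
    one whose series over the nodes need not converge absolutely. *)
Lemma inv_F_taylor : exists gamma : nat -> C,
  (forall w, Cmod w < Rmin (/ 2) (r 0%nat / 2) -> clim (sumC (fun i => gamma i * w ^ i)%C) (/ besselF q w)%C) /\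
  forall w, besselF q w <> 0%C -> exists S0 : C,
    clim (sumC (fun k => RtoC ((/ r k) ^ half_up / pz_e k) * / (1 - RtoC (/ r k) * w))%C) S0 /\
    (/ besselF q w = sumC (fun i => gamma i * w ^ i) (half_up) + w ^ (half_up) * S0)%C.
Proof.
  destruct (inv_F_expansion) as [c Hc].
  set (b0 := fun k => (/ r k) ^ half_up / pz_e k).
  (* The extra [1 / r k] makes the coefficients absolutely summable, since [pz_a] is bounded by
     [pz_a 0]. *)
  set (b := fun k => b0 k * / r k).
  assert (HB : forall n, sumR (fun k => Rabs (b k)) n <= pz_a 0 * 4).
  { intros n. apply Rle_trans with (sumR (fun k => pz_a 0 * / r k) n).
    - apply sumR_le; intros k _. unfold b, b0. rewrite <- pz_a_alt, !Rabs_mult, pow_1_abs, Rmult_1_l.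
      assert (P := pz_a_pos k). assert (S1 := pz_s_pos k). rewrite !Rabs_pos_eq by lra.
      apply Rmult_le_compat_r; [lra|].
      clear -Hr. induction k; [lra|]. eapply Rle_trans; [apply pz_a_decr|auto].
    - rewrite sumR_scal. apply Rmult_le_compat_l; [left; apply pz_a_pos|apply pz_sum_le]. }
  destruct (abs_summable_coefs b (fun _ => 1) _ HB) as [beta Hbeta].
  (* [L0], the remainder at [w = 0], becomes the Taylor coefficient of index [half_up]; subtracting
     it frees a factor [w / r k]. *)
  destruct (Hc 0%C (besselF_neq_0_small q 0%C ltac:(rewrite Cmod_0; lra))) as (L0 & HL0 & _).
  exists (fun i => if lt_dec i (half_up) then c i else
     (fun j => if lt_dec j 1 then L0 else RtoC (beta (j - 1)%nat)) (i - half_up)%nat).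
  split.
  - intros w Hw. assert (M := Rmin_l (/ 2) (r 0%nat / 2)).
    assert (HF := besselF_neq_0_small q w ltac:(lra)).
    destruct (Hc w HF) as (S0 & HS & E).
    apply (clim_prepend c (fun j => if lt_dec j 1 then L0 else RtoC (beta (j - 1)%nat)) (half_up) w _ S0); [|exact E].
    assert (Hne := F_factor_neq_0 w HF).
    assert (D : clim (sumC (fun k => RtoC (b k) * (w * / (1 - RtoC (/ r k) * w)))%C) (S0 - L0)%C).
    { eapply clim_ext; [|exact (clim_minus _ _ _ _ HS HL0)].
      intros n; simpl. rewrite <- sumC_minus. apply sumC_ext; intros k _.
      unfold b. fold (b0 k). rewrite RtoC_mult.
      replace (1 - RtoC (/ r k) * 0)%C with (RtoC 1) by ring.
      field. apply Hne. }
    destruct (classic (w = 0%C)) as [->|Hw0].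
    + assert (E0 : S0 = L0) by (eapply clim_unique; eauto). subst S0.
      apply (clim_ext_loc (fun _ => L0) _ _ 1); [|apply clim_const].
      intros n Hn. destruct n; [lia|]. clear. induction n.
      * simpl. ring.
      * rewrite sumC_S, <- IHn. rewrite Cpow_S. ring.
    + apply (clim_prepend (fun _ => L0) (fun j => RtoC (beta j)) 1 w S0 (/ w * (S0 - L0))%C).
      * apply (exchange_expansion b (fun k => / r k) (fun _ => 1) (fun t => / (1 - t))%C (fun n => 2 * (/ 2) ^ n) (pz_a 0 * 4) w); auto.
        -- intros k; left; apply pz_s_pos.
        -- now apply small_s.
        -- intros n t Ht. now apply geometric_error.
        -- replace (Finite 0) with (Finite (2 * 0)) by (f_equal; ring).
           apply is_lim_seq_mult'; [apply is_lim_seq_const|apply half_pow_lim].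
        -- eapply clim_ext; [|exact (clim_scal (/ w)%C _ _ D)].
           intros n; simpl. rewrite <- sumC_scal. apply sumC_ext; intros k _.
           field. split; [apply Hne|auto].
      * simpl. field; auto.
  - intros w HF. destruct (Hc w HF) as (S0 & HS & E). exists S0; split; auto. rewrite E. f_equal.
    apply sumC_ext; intros i Hi. destruct (lt_dec i (half_up)); [auto|lia].
Qed.

Lemma inv_F2_taylor : exists delta : nat -> C,
  (forall w, Cmod w < Rmin (/ 2) (r 0%nat / 2) -> clim (sumC (fun i => delta i * w ^ i)%C) (/ besselF q w ^ 2)%C) /\
  forall w, besselF q w <> 0%C -> exists S0 : C,
    clim (sumC (fun k => RtoC ((/ r k) ^ S q / pz_e k ^ 2) * (/ (1 - RtoC (/ r k) * w)) ^ 2)%C) S0 /\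
    (/ besselF q w ^ 2 = sumC (fun i => delta i * w ^ i) (S q) + w ^ S q * S0)%C.
Proof.
  destruct (inv_F2_expansion) as [d Hd].
  set (b := fun k => (/ r k) ^ S q / pz_e k ^ 2).
  set (c0 := 4 / Phi q (r 0%nat)).
  assert (Hc0 : 0 < c0) by (apply Rdiv_lt_0_compat; [lra|apply pz_Phi_pos]).
  assert (HB : forall n, sumR (fun k => Rabs (b k)) n <= c0 * 4).
  { intros n. apply Rle_trans with (sumR (fun k => c0 * / r k) n).
    - apply sumR_le; intros k _. destruct (sq_coef_bounds k) as [B1 B2].
      unfold b. rewrite Rabs_pos_eq; auto.
    - rewrite sumR_scal. apply Rmult_le_compat_l; [lra|apply pz_sum_le]. }
  destruct (abs_summable_coefs b (fun i => INR i + 1) _ HB) as [beta Hbeta].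
  exists (fun i => if lt_dec i (S q) then d i else RtoC (beta (i - S q)%nat)).
  split.
  - intros w Hw. assert (M := Rmin_l (/ 2) (r 0%nat / 2)).
    assert (HF := besselF_neq_0_small q w ltac:(lra)).
    destruct (Hd w HF) as (S0 & HS & E).
    apply (clim_prepend d (fun j => RtoC (beta j)) (S q) w _ S0); [|exact E].
    apply (exchange_expansion b (fun k => / r k) (fun i => INR i + 1) (fun t => (/ (1 - t)) ^ 2)%C
      (fun n => 4 * (/ 2) ^ n + 2 * (INR n * (/ 2) ^ n)) (c0 * 4) w); auto.
    + intros k; left; apply pz_s_pos.
    + now apply small_s.
    + intros n t Ht. now apply geometric_square_error.
    + replace (Finite 0) with (Finite (4 * 0 + 2 * 0)) by (f_equal; ring).
      apply is_lim_seq_plus'; apply is_lim_seq_mult'; auto using is_lim_seq_const, half_pow_lim, INR_half_pow_lim.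
  - intros w HF. destruct (Hd w HF) as (S0 & HS & E). exists S0; split; auto. rewrite E. f_equal.
    apply sumC_ext; intros i Hi. destruct (lt_dec i (S q)); [auto|lia].
Qed.
End Zeros.

(** * The coefficient of w^q in 1/F^2 *)

(** Fixing the interval lets products and derivatives of such functions be formed without computing
    radii of convergence each time. *)
Definition PSon (rho : R) (a : nat -> R) (f : R -> R) : Prop :=
  forall x, Rabs x < rho -> is_pseries a x (f x).

Lemma PSon_lim rho a f : PSon rho a f <->
  forall x, Rabs x < rho -> is_lim_seq (sumR (fun m => a m * x ^ m)) (f x).
Proof.
  unfold PSon, is_pseries. split; intros H x Hx; specialize (H x Hx).
  - apply is_series_sumR. eapply is_series_ext; [|exact H].
    intros n; simpl. rewrite pow_n_pow. unfold scal; simpl; unfold mult; simpl. ring.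
  - apply is_series_sumR in H. eapply is_series_ext; [|exact H].
    intros n. change (a n * x ^ n = pow_n (K := R_AbsRing) x n * a n). apply Rmult_comm.
Qed.

Lemma PSon_radius rho a f x : PSon rho a f -> Rabs x < rho -> Rbar_lt (Rabs x) (CV_radius a).
Proof.
  intros H Hx. set (y := (Rabs x + rho) / 2).
  assert (P := Rabs_pos x).
  assert (Hy : Rabs y < rho) by (rewrite Rabs_pos_eq; unfold y; lra).
  apply Rbar_lt_le_trans with (Rabs y); [simpl; rewrite (Rabs_pos_eq y); unfold y; lra|].
  apply Rbar_not_lt_le. intros L. apply CV_disk_outside in L. apply L.
  specialize (H y Hy). assert (E : ex_series (fun n => a n * y ^ n)).
  { exists (f y). eapply is_series_ext; [|exact H].
    intros n; simpl. rewrite pow_n_pow. unfold scal; simpl; unfold mult; simpl. ring. }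
  apply ex_series_lim_0 in E. exact E.
Qed.

Lemma PSon_ext rho a f g : (forall x, Rabs x < rho -> f x = g x) -> PSon rho a f -> PSon rho a g.
Proof. intros E H x Hx. rewrite <- E by auto. now apply H. Qed.

Lemma PSon_unique rho a b f n : 0 < rho -> PSon rho a f -> PSon rho b f -> a n = b n.
Proof.
  intros Hr Ha Hb. assert (R0 : Rabs 0 < rho) by (rewrite Rabs_R0; auto).
  apply PSeries_ext_recip.
  - assert (T := PSon_radius _ _ _ _ Ha R0). rewrite Rabs_R0 in T. exact T.
  - assert (T := PSon_radius _ _ _ _ Hb R0). rewrite Rabs_R0 in T. exact T.
  - exists (mkposreal _ Hr). intros x Hx.
    assert (Hx' : Rabs x < rho).
    { unfold ball in Hx; simpl in Hx; unfold AbsRing_ball, abs, minus, plus, opp in Hx; simpl in Hx.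
      now rewrite Ropp_0, Rplus_0_r in Hx. }
    rewrite (is_pseries_unique _ _ _ (Ha x Hx')), (is_pseries_unique _ _ _ (Hb x Hx')). auto.
Qed.

Lemma PSon_plus rho a b f g : PSon rho a f -> PSon rho b g ->
  PSon rho (fun n => a n + b n) (fun x => f x + g x).
Proof. intros Ha Hb x Hx. apply (is_pseries_plus a b x (f x) (g x)); auto. Qed.

Lemma PSon_scal rho c a f : PSon rho a f -> PSon rho (fun n => c * a n) (fun x => c * f x).
Proof. intros Ha x Hx. apply (is_pseries_scal c a x (f x)); [apply Rmult_comm|auto]. Qed.

Lemma PSon_incr rho a f : PSon rho a f -> PSon rho (PS_incr_1 a) (fun x => x * f x).
Proof. intros Ha x Hx. apply (is_pseries_incr_1 a x (f x)); auto. Qed.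

Lemma PSon_mult rho a b f g : PSon rho a f -> PSon rho b g ->
  PSon rho (PS_mult a b) (fun x => f x * g x).
Proof. intros Ha Hb x Hx. apply is_pseries_mult; auto; eapply PSon_radius; eauto. Qed.

Lemma PSon_derive rho a f f' : PSon rho a f -> (forall x, Rabs x < rho -> is_derive f x (f' x)) ->
  PSon rho (PS_derive a) f'.
Proof.
  intros Ha Hd x Hx.
  replace (f' x) with (Derive (PSeries a) x).
  - apply is_pseries_derive. eapply PSon_radius; eauto.
  - rewrite (Derive_ext_loc _ f).
    + apply is_derive_unique, Hd, Hx.
    + assert (Hd0 : 0 < rho - Rabs x) by lra.
      exists (mkposreal _ Hd0). intros y Hy. apply is_pseries_unique, Ha.
      unfold ball in Hy; simpl in Hy; unfold AbsRing_ball, abs, minus, plus, opp in Hy; simpl in Hy.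
      replace y with ((y + - x) + x) by ring. eapply Rle_lt_trans; [apply Rabs_triang|]. lra.
Qed.

Lemma PSon_coef_0 rho a f : 0 < rho -> PSon rho a f -> a O = f 0.
Proof.
  intros Hr H. specialize (H 0 ltac:(rewrite Rabs_R0; auto)).
  assert (H2 := is_pseries_0 (K := R_AbsRing) (V := R_NormedModule) a).
  apply is_pseries_unique in H. apply (is_pseries_unique a 0) in H2. now rewrite <- H, <- H2.
Qed.

Lemma PSon_finite rho a n : (forall m, (n <= m)%nat -> a m = 0) ->
  PSon rho a (fun x => sumR (fun m => a m * x ^ m) n).
Proof.
  intros H. apply PSon_lim. intros x _.
  apply is_lim_seq_ext_loc with (fun _ => sumR (fun m => a m * x ^ m) n); [|apply is_lim_seq_const].
  exists n. intros m Hm. induction Hm; [auto|]. rewrite sumR_S, <- IHHm, H by lia. ring.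
Qed.

Lemma sum_f_R0_single (f : nat -> R) n k : (k <= n)%nat ->
  (forall i, (i <= n)%nat -> i <> k -> f i = 0) -> sum_f_R0 f n = f k.
Proof.
  revert k. induction n; intros k Hk H; simpl.
  - f_equal; lia.
  - destruct (Nat.eq_dec k (S n)) as [->|].
    + rewrite (sum_eq_R0 f n); [ring|]. intros i Hi; apply H; lia.
    + rewrite (IHn k), (H (S n)); [ring|lia|lia|lia|]. intros; apply H; lia.
Qed.

(* The coefficients of the polynomial [G] in the second solution
   [w^(-q) G + (const) F log w + ...] of the equation of [F]. With [H = G / F], one has
   [w H' - q H = N / F^2] for a Wronskian [N], whose derivative is a multiple of
   [w^(q-1) F]; the coefficient of [w^q] on the left is zero. *)
Section Wronskian.
Variable p : nat.

Definition wronG (m : nat) : R :=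
  if lt_dec m (S p) then INR (fact (p - m)) / (INR (fact m) * 4 ^ m) else 0.

(** With order [q = S p], this is [w G'' + (1 - q) G' + G / 4 = c w^p] in coefficients. Truncating
    [G] at degree [p] leaves one monomial, at the index where [m + 1 - q] vanishes and the
    recurrence cannot continue. *)
Lemma wronG_rec m :
  (INR m + 1) * (INR m + 1 - INR (S p)) * wronG (S m) + / 4 * wronG m =
  if Nat.eq_dec m p then / (INR (fact p) * 4 ^ S p) else 0.
Proof.
  unfold wronG. assert (F4 : forall n, 4 ^ n <> 0) by (intros; apply pow_nonzero; lra).
  destruct (Nat.eq_dec m p) as [->|Hne].
  - destruct (lt_dec (S p) (S p)); [lia|]. destruct (lt_dec p (S p)); [|lia].
    rewrite Nat.sub_diag. simpl. assert (H := INR_fact_neq_0 p). field; auto.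
  - destruct (lt_dec (S m) (S p)); destruct (lt_dec m (S p)); try lia; [|ring].
    replace (p - m)%nat with (S (p - S m)) by lia.
    rewrite !fact_simpl, !mult_INR, !S_INR, minus_INR, S_INR by lia.
    assert (H := INR_fact_neq_0 m). assert (P := pos_INR m).
    simpl pow. field. repeat split; auto. lra.
Qed.

Lemma inv_F2_central_coef (rho : R) (g d : nat -> R) : 0 < rho ->
  (forall x, Rabs x < rho -> Fr (S p) x <> 0) ->
  PSon rho g (fun x => / Fr (S p) x) -> PSon rho d (fun x => / Fr (S p) x ^ 2) ->
  d (S p) = / (4 ^ S p * INR (fact (S p)) ^ 2).
Proof.
  intros Hrho HF Hg Hd.
  assert (PF : PSon rho (Fcoef (S p)) (Fr (S p))) by (apply PSon_lim; intros x _; apply Fr_lim).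
  assert (PF1 := PSon_derive _ _ _ _ PF (fun x _ => is_derive_Fr (S p) x)).
  set (G := PSeries wronG). set (G1 := PSeries (PS_derive wronG)). set (G2 := PSeries (PS_derive (PS_derive wronG))).
  assert (HGf : forall R0, PSon R0 wronG (fun x => sumR (fun m => wronG m * x ^ m) (S p))).
  { intros R0. apply PSon_finite. intros m Hm. unfold wronG. destruct (lt_dec m (S p)); [lia|auto]. }
  assert (HGrad : CV_radius wronG = p_infty).
  { assert (L : forall R0, 0 < R0 -> Rbar_lt R0 (CV_radius wronG)).
    { intros R0 H0. assert (T := PSon_radius (R0 + 1) _ _ R0 (HGf (R0 + 1))).
      rewrite Rabs_pos_eq in T by lra. apply T; lra. }
    destruct (CV_radius wronG) as [c| |]; auto.
    - specialize (L (Rabs c + 1)). assert (T := Rle_abs c). assert (T2 := Rabs_pos c). simpl in L. lra.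
    - specialize (L 1 ltac:(lra)). contradiction. }
  assert (DG : forall x : R, is_derive G x (G1 x)) by (intros; apply is_derive_PSeries; now rewrite HGrad).
  assert (DG1 : forall x : R, is_derive G1 x (G2 x)) by (intros; apply is_derive_PSeries; now rewrite CV_radius_derive, HGrad).
  assert (PG : PSon rho wronG G).
  { intros x Hx. unfold G. apply PSeries_correct, CV_radius_inside. now rewrite HGrad. }
  assert (PG1 := PSon_derive _ _ _ _ PG (fun x _ => DG x)).
  assert (PG2 := PSon_derive _ _ _ _ PG1 (fun x _ => DG1 x)).
  (* [N = w (G' F - G F') - q G F] is the Wronskian of [F] and [w^(-q) G] up to a power of [w].
     Combining the two equations gives [N' = F K] with [K = c w^p]. *)
  set (N := fun x => x * (G1 x * Fr (S p) x) + (-1) * (x * (G x * Fr1 (S p) x)) + (- INR (S p)) * (G x * Fr (S p) x)).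
  assert (Hn : exists n, PSon rho n N).
  { eexists. unfold N.
    refine (PSon_plus rho _ _ (fun x => x * (G1 x * Fr (S p) x) + (-1) * (x * (G x * Fr1 (S p) x))) (fun x => - INR (S p) * (G x * Fr (S p) x)) _ _).
    - refine (PSon_plus rho _ _ (fun x => x * (G1 x * Fr (S p) x)) (fun x => -1 * (x * (G x * Fr1 (S p) x))) _ _).
      + exact (PSon_incr _ _ _ (PSon_mult _ _ _ _ _ PG1 PF)).
      + exact (PSon_scal _ (-1) _ _ (PSon_incr _ _ _ (PSon_mult _ _ _ _ _ PG PF1))).
    - exact (PSon_scal _ (- INR (S p)) _ _ (PSon_mult _ _ _ _ _ PG PF)). }
  destruct Hn as [n Hn].
  set (K := fun x => x * G2 x + (1 - INR (S p)) * G1 x + / 4 * G x).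
  set (c := / (INR (fact p) * 4 ^ S p)).
  assert (PK : PSon rho (fun m => if Nat.eq_dec m p then c else 0) K).
  { intros x Hx. eapply is_pseries_ext.
    2: { exact (PSon_plus _ _ _ _ _ (PSon_plus _ _ _ _ _ (PSon_incr _ _ _ PG2)
           (PSon_scal _ (1 - INR (S p)) _ _ PG1)) (PSon_scal _ (/ 4) _ _ PG) x Hx). }
    intros m. cbv beta. unfold c. rewrite <- wronG_rec.
    unfold PS_incr_1, PS_derive. destruct m as [|m]; match goal with |- ?a = ?b => change (@eq R a b) end.
    - unfold zero; simpl. ring.
    - rewrite !S_INR. ring. }
  assert (DN : forall x : R, is_derive N x (Fr (S p) x * K x)).
  { intros x. unfold N.
    assert (H0 := is_derive_Fr (S p) x). assert (H1 := is_derive_Fr1 (S p) x).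
    assert (H2 := DG x). assert (H3 := DG1 x).
    auto_derive.
    - repeat split; auto; eexists; eauto.
    - change (fun x : R => Fr (S p) x) with (Fr (S p)). change (fun x : R => Fr1 (S p) x) with (Fr1 (S p)).
      change (fun x : R => G x) with G. change (fun x : R => G1 x) with G1.
      rewrite (is_derive_unique _ _ _ H0), (is_derive_unique _ _ _ H1), (is_derive_unique _ _ _ H2), (is_derive_unique _ _ _ H3).
      assert (O := Fr_ode (S p) x). unfold K.
      set (F := Fr (S p) x) in *. set (F1 := Fr1 (S p) x) in *. set (F2 := Fr2 (S p) x) in *.
      change (match p with O => 1 | S _ => INR p + 1 end) with (INR (S p)).
      assert (O' : x * F2 = - (INR (S p) + 1) * F1 - / 4 * F) by lra.
      match goal with |- ?l = ?r => transitivity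
        (F * (x * G2 x) + (1 - INR (S p)) * (G1 x * F) - G x * (x * F2) - (1 + INR (S p)) * (G x * F1)) end.
      + ring.
      + rewrite O'. ring. }
  assert (Pn' := PSon_derive _ _ _ _ Hn (fun x _ => DN x)).
  assert (PFK := PSon_mult _ _ _ _ _ PF PK).
  assert (En : forall m, INR (S m) * n (S m) = PS_mult (Fcoef (S p)) (fun m => if Nat.eq_dec m p then c else 0) m).
  { intros m. apply (PSon_unique rho (PS_derive n) _ _ m Hrho Pn' PFK). }
  (* Since [N'] starts at order [p], the series of [N] has no terms strictly between [w^0] and
     [w^q]. *)
  assert (En0 : forall m, (m < p)%nat -> n (S m) = 0).
  { intros m Hm. specialize (En m). unfold PS_mult in En. rewrite sum_eq_R0 in En.
    - apply Rmult_integral in En. destruct En as [E|]; auto. rewrite S_INR in E. assert (P := pos_INR m). lra.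
    - intros i Hi. destruct (Nat.eq_dec (m - i) p); [lia|ring]. }
  assert (Enq : INR (S p) * n (S p) = c).
  { rewrite En. unfold PS_mult. rewrite (sum_f_R0_single _ p 0).
    - rewrite Nat.sub_0_r, Fcoef_0. destruct (Nat.eq_dec p p); [ring|lia].
    - lia.
    - intros i Hi Hi0. destruct (Nat.eq_dec (p - i) p); [lia|ring]. }
  assert (N0 : n O = - INR (S p) * INR (fact p)).
  { rewrite (PSon_coef_0 rho n N Hrho Hn). unfold N. rewrite Fr_0.
    replace (G 0) with (INR (fact p)); [ring|].
    unfold G. rewrite PSeries_0. unfold wronG. destruct (lt_dec 0 (S p)); [|lia].
    rewrite Nat.sub_0_r. simpl. field. }
  set (H := fun x => G x * / Fr (S p) x).
  assert (PH : PSon rho (PS_mult wronG g) H) by (apply PSon_mult; auto).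
  set (H1 := fun x => (G1 x * Fr (S p) x - G x * Fr1 (S p) x) * / Fr (S p) x ^ 2).
  assert (PH1 : PSon rho (PS_derive (PS_mult wronG g)) H1).
  { apply (PSon_derive rho _ H); auto. intros x Hx. unfold H, H1.
    assert (A0 := is_derive_Fr (S p) x). assert (A2 := DG x). specialize (HF x Hx).
    auto_derive.
    - split; [eexists; eauto|]. split; [eexists; eauto|]. auto.
    - change (fun x : R => Fr (S p) x) with (Fr (S p)). change (fun x : R => G x) with G.
      rewrite (is_derive_unique _ _ _ A0), (is_derive_unique _ _ _ A2). field. auto. }
  assert (PL := PSon_plus _ _ _ _ _ (PSon_incr _ _ _ PH1) (PSon_scal _ (- INR (S p)) _ _ PH)).
  assert (PR := PSon_mult _ _ _ _ _ Hn Hd).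
  assert (EN : forall x, Rabs x < rho -> x * H1 x + - INR (S p) * H x = N x * / Fr (S p) x ^ 2).
  { intros x Hx. specialize (HF x Hx). unfold H, H1, N. field. auto. }
  assert (E := PSon_unique rho _ _ _ (S p) Hrho (PSon_ext rho _ _ _ EN PL) PR).
  cbv beta in E.
  change (INR (S p) * PS_mult wronG g (S p) + - INR (S p) * PS_mult wronG g (S p) = PS_mult n d (S p)) in E.
  (* The operator [w d/dw - q] annihilates [w^q], so what remains is [n_0 d_q + n_q d_0 = 0], with
     [n_0], [n_q] and [d_0 = 1] known. *)
  replace (INR (S p) * PS_mult wronG g (S p) + - INR (S p) * PS_mult wronG g (S p)) with 0 in E by ring.
  unfold PS_mult in E. rewrite tech5, Nat.sub_diag in E.
  rewrite (sum_f_R0_single _ p 0) in E.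
  2: lia.
  2: { intros i Hi Hi0. destruct i as [|i]; [lia|]. rewrite En0 by lia. ring. }
  rewrite Nat.sub_0_r in E.
  assert (D0 : d O = 1) by (rewrite (PSon_coef_0 rho d _ Hrho Hd), Fr_0; field).
  rewrite D0, N0 in E.
  assert (Hf := INR_fact_lt_0 p). assert (HS := pos_INR p). assert (H4 : 0 < 4 ^ S p) by (apply pow_lt; lra).
  rewrite fact_simpl, mult_INR. rewrite S_INR in *.
  assert (En' : n (S p) = c / (INR p + 1)) by (rewrite <- Enq; field; lra).
  rewrite En' in E. unfold c in E.
  apply Rmult_eq_reg_l with ((INR p + 1) * INR (fact p)); [|apply Rgt_not_eq, Rmult_lt_0_compat; lra].
  replace ((INR p + 1) * INR (fact p) * d (S p)) with (/ (INR (fact p) * 4 ^ S p) / (INR p + 1)) by lra.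
  field. repeat split; lra.
Qed.
End Wronskian.

Lemma clim_Re (u : nat -> C) (l : C) : clim u l -> is_lim_seq (fun n => Re (u n)) (Re l).
Proof.
  intros H. assert (H0 : is_lim_seq (fun n => Re (u n) - Re l) 0).
  { apply is_lim_seq_abs_0. apply is_lim_seq_le_le with (fun _ => 0) (fun n => Cmod (u n - l)).
    - intros n; split; [apply Rabs_pos|]. exact (re_le_Cmod (u n - l)).
    - apply is_lim_seq_const.
    - exact H. }
  apply is_lim_seq_ext with (fun n => (Re (u n) - Re l) + Re l); [intros; ring|].
  replace (Finite (Re l)) with (Finite (0 + Re l)) by (f_equal; ring).
  apply is_lim_seq_plus'; auto using is_lim_seq_const.
Qed.

Lemma Re_sumC f n : Re (sumC f n) = sumR (fun k => Re (f k)) n.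
Proof. induction n; [easy|]. rewrite sumC_S, sumR_S, <- IHn. reflexivity. Qed.

Lemma PSon_Re rho (a : nat -> C) (f : R -> R) :
  (forall x, Rabs x < rho -> clim (sumC (fun i => a i * RtoC x ^ i)%C) (RtoC (f x))) ->
  PSon rho (fun i => Re (a i)) f.
Proof.
  intros H. apply PSon_lim. intros x Hx. specialize (H x Hx). apply clim_Re in H.
  eapply is_lim_seq_ext; [|exact H]. intros n; simpl. rewrite Re_sumC. apply sumR_ext; intros k _.
  rewrite <- RtoC_pow. apply re_scal_r.
Qed.

Lemma PSon_Im rho (a : nat -> C) (f : R -> R) :
  (forall x, Rabs x < rho -> clim (sumC (fun i => a i * RtoC x ^ i)%C) (RtoC (f x))) ->
  PSon rho (fun i => Im (a i)) (fun _ => 0).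
Proof.
  intros H. apply PSon_lim. intros x Hx. specialize (H x Hx).
  apply (clim_scal (- Ci)%C), clim_Re in H.
  replace (Re (- Ci * RtoC (f x))) with 0 in H by (unfold Re; simpl; ring).
  eapply is_lim_seq_ext; [|exact H]. intros n; simpl.
  change (Re (- Ci * sumC (fun i => a i * RtoC x ^ i)%C n) = sumR (fun m => Im (a m) * x ^ m) n).
  rewrite <- sumC_scal, Re_sumC. apply sumR_ext; intros k _.
  rewrite <- RtoC_pow. unfold Re, Im; simpl. ring.
Qed.

(** The complex coefficients are real because the sums are real on the real axis, which reduces the
    claim to the real Wronskian computation; for [q = 0] it is just the value at 0. The expansion of
    [1 / F] serves to make [G / F] a power series. *)
Lemma central_coef q rho (gamma delta : nat -> C) : 0 < rho ->
  (forall x, Rabs x < rho -> Fr q x <> 0) ->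
  (forall w, Cmod w < rho -> clim (sumC (fun i => gamma i * w ^ i)%C) (/ besselF q w)%C) ->
  (forall w, Cmod w < rho -> clim (sumC (fun i => delta i * w ^ i)%C) (/ besselF q w ^ 2)%C) ->
  delta q = RtoC (/ (4 ^ q * INR (fact q) ^ 2)).
Proof.
  intros Hrho HF Hg Hd.
  assert (Hg' : forall x, Rabs x < rho -> clim (sumC (fun i => gamma i * RtoC x ^ i)%C) (RtoC (/ Fr q x))).
  { intros x Hx. rewrite RtoC_inv, <- besselF_RtoC by auto. apply Hg. now rewrite Cmod_R. }
  assert (Hd' : forall x, Rabs x < rho -> clim (sumC (fun i => delta i * RtoC x ^ i)%C) (RtoC (/ Fr q x ^ 2))).
  { intros x Hx. rewrite RtoC_inv, RtoC_pow, <- besselF_RtoC by (apply pow_nonzero; auto). apply Hd. now rewrite Cmod_R. }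
  assert (PI := PSon_Im _ _ _ Hd').
  assert (I0 : Im (delta q) = 0).
  { apply (PSon_unique rho _ (fun _ => 0) _ q Hrho PI).
    apply PSon_lim. intros x _. apply is_lim_seq_ext with (fun _ => 0); [|apply is_lim_seq_const].
    intros n. induction n; simpl; [auto|]. rewrite <- IHn. ring. }
  assert (R1 : Re (delta q) = / (4 ^ q * INR (fact q) ^ 2)).
  { assert (PD := PSon_Re _ _ _ Hd'). destruct q as [|p].
    - rewrite (PSon_coef_0 rho (fun i => Re (delta i)) _ Hrho PD), Fr_0. simpl. field.
    - apply (inv_F2_central_coef p rho (fun i => Re (gamma i)) (fun i => Re (delta i)) Hrho HF); auto.
      apply PSon_Re, Hg'. }
  rewrite (surjective_pairing (delta q)). change (fst (delta q)) with (Re (delta q)).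
  change (snd (delta q)) with (Im (delta q)). rewrite R1, I0. reflexivity.
Qed.

(** * Laurent coefficients *)

Definition Cis (x : R) : C := (cos x, sin x).

Lemma Cmod_Cis x : Cmod (Cis x) = 1.
Proof.
  unfold Cmod, Cis; simpl. replace (cos x * (cos x * 1) + sin x * (sin x * 1)) with 1.
  - apply sqrt_1.
  - assert (H := sin2_cos2 x). unfold Rsqr in H. lra.
Qed.

Lemma Cis_pow x n : (Cis x ^ n)%C = Cis (INR n * x).
Proof.
  induction n.
  - simpl. unfold Cis. rewrite Rmult_0_l, cos_0, sin_0. reflexivity.
  - rewrite Cpow_S, IHn, S_INR, Rmult_plus_distr_r, Rmult_1_l, Rplus_comm.
    unfold Cis, Cmult; simpl. rewrite cos_plus, sin_plus. f_equal. ring.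
Qed.

Lemma Cis_neq_1 x : 0 < x < 2 * PI -> Cis x <> 1%C.
Proof.
  intros Hx E. injection E as E1 E2.
  assert (S := sin_gt_0 (x / 2) ltac:(lra) ltac:(lra)).
  replace x with (2 * (x / 2)) in E1 by field. rewrite cos_2a_sin in E1. nra.
Qed.

Lemma geometric_sum_root (eta : C) M : eta <> 1%C -> (eta ^ M = 1)%C -> sumC (fun j => eta ^ j)%C M = 0%C.
Proof.
  intros H1 HM.
  assert (N : (1 - eta <> 0)%C).
  { apply Cminus_eq_contra. auto. }
  assert (G := geometric_split eta M N). rewrite HM in G.
  assert (E : (sumC (fun j => eta ^ j) M = / (1 - eta) - 1 * / (1 - eta))%C) by (rewrite G at 1; ring).
  rewrite E. ring.
Qed.

(** A discrete Fourier coefficient, in the role of Cauchy's integral formula: for a polynomial with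
    fewer than [M + 1] coefficients the average over [M] equally spaced points of a circle is
    exact. *)
Lemma roots_of_unity_filter (a : nat -> C) (Rad : R) M n : (n < M)%nat ->
  sumC (fun j => Cis (- (INR n * (INR j * (2 * PI / INR M)))) *
     sumC (fun m => a m * (RtoC Rad * Cis (INR j * (2 * PI / INR M))) ^ m) M)%C M
  = (RtoC (INR M) * (a n * RtoC Rad ^ n))%C.
Proof.
  intros Hn. assert (HM : 0 < INR M) by (apply lt_0_INR; lia).
  set (th := 2 * PI / INR M).
  assert (HP := PI_RGT_0).
  assert (Cadd : forall x y, (Cis x * Cis y)%C = Cis (x + y)).
  { intros x y. unfold Cis, Cmult; simpl. rewrite cos_plus, sin_plus. f_equal; ring. }
  rewrite (sumC_ext _ (fun j => sumC (fun m => (Cis (INR j * (INR m * th - INR n * th))) * (a m * RtoC Rad ^ m)) M)%C).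
  2: { intros j _. rewrite <- sumC_scal. apply sumC_ext; intros m _.
       rewrite Cpow_mult_l, Cis_pow.
       replace (INR j * (INR m * th - INR n * th)) with (- (INR n * (INR j * th)) + INR m * (INR j * th)) by ring.
       rewrite <- Cadd. ring. }
  rewrite (sumC_exchange (fun j m => Cis (INR j * (INR m * th - INR n * th)))).
  assert (Z : forall m, (m < M)%nat -> sumC (fun j => Cis (INR j * (INR m * th - INR n * th))) M =
     if Nat.eq_dec m n then RtoC (INR M) else 0%C).
  { intros m Hm. destruct (Nat.eq_dec m n) as [->|Hne].
    - rewrite (sumC_ext _ (fun _ => RtoC 1)).
      + clear. induction M; [reflexivity|]. rewrite sumC_S, IHM, S_INR, RtoC_plus. reflexivity.
      + intros k _. rewrite Rminus_diag, Rmult_0_r. unfold Cis. now rewrite cos_0, sin_0.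
    - rewrite (sumC_ext _ (fun j => Cis (INR m * th - INR n * th) ^ j)%C) by (intros; now rewrite Cis_pow).
      apply geometric_sum_root.
      + assert (Hlt : forall m n, (n < m < M)%nat -> 0 < INR m * th - INR n * th < 2 * PI).
        { intros m' n' H'. replace (INR m' * th - INR n' * th) with ((INR m' - INR n') * th) by ring.
          assert (1 <= INR m' - INR n') by (rewrite <- minus_INR by lia; apply (le_INR 1); lia).
          assert (INR m' < INR M) by (apply lt_INR; lia). assert (0 <= INR n') by apply pos_INR.
          assert (E : INR M * th = 2 * PI) by (unfold th; field; lra). nra. }
        destruct (lt_dec n m).
        * apply Cis_neq_1, Hlt; lia.
        * intros E. apply (Cis_neq_1 (INR n * th - INR m * th)); [apply Hlt; lia|].
          replace (INR n * th - INR m * th) with (- (INR m * th - INR n * th)) by ring.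
          unfold Cis in *. injection E as E1 E2. rewrite cos_neg, sin_neg, E1, E2, Ropp_0. reflexivity.
      + rewrite Cis_pow. replace (INR M * (INR m * th - INR n * th)) with ((INR m - INR n) * 2 * PI) by (unfold th; field; lra).
        unfold Cis. rewrite <- (Rplus_0_l ((INR m - INR n) * 2 * PI)).
        replace (0 + (INR m - INR n) * 2 * PI) with ((0 + 2 * INR m * PI) - (0 + 2 * INR n * PI)) by ring.
        rewrite cos_minus, sin_minus, !cos_period, !sin_period, cos_0, sin_0.
        unfold RtoC. f_equal; ring. }
  rewrite (sumC_ext _ (fun m => if Nat.eq_dec m n then RtoC (INR M) * (a n * RtoC Rad ^ n) else 0)%C).
  2: { intros m Hm. rewrite Z by auto. destruct (Nat.eq_dec m n) as [->|]; [reflexivity|ring]. }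
  clear - Hn. generalize (RtoC (INR M) * (a n * RtoC Rad ^ n))%C. intros X.
  induction M; [lia|]. rewrite sumC_S. destruct (Nat.eq_dec M n) as [->|Hne].
  - rewrite (sumC_ext _ (fun _ => 0%C)).
    + clear. replace (sumC (fun _ => RtoC 0) n) with (RtoC 0); [ring|].
      induction n; [reflexivity|]. rewrite sumC_S, <- IHn. ring.
    + intros k Hk. destruct (Nat.eq_dec k n); [lia|auto].
  - rewrite IHM by lia. ring.
Qed.

(** The exact filter is applied to the truncation after [M] terms, which differs from [g] on the
    circle by at most the tail of the absolute series; that error disappears as [M] grows. *)
Lemma cauchy_estimate (a : nat -> C) (g : C -> C) (Rad B T : R) n : 0 < Rad ->
  (forall m, sumR (fun k => Cmod (a k) * Rad ^ k) m <= T) ->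
  (forall u, Cmod u = Rad -> clim (sumC (fun m => a m * u ^ m)%C) (g u) /\ Cmod (g u) <= B) ->
  Cmod (a n) * Rad ^ n <= B.
Proof.
  intros HR HT Hg.
  set (t := fun k => Cmod (a k) * Rad ^ k) in *.
  assert (Ht : forall k, 0 <= t k) by (intros; apply Rmult_le_pos; [apply Cmod_ge_0|apply pow_le; lra]).
  destruct (bounded_sums_lim t T Ht HT) as (L & HL & HL').
  assert (Htail : forall M u, Cmod u = Rad -> Cmod (sumC (fun m => a m * u ^ m)%C M) <= B + (L - sumR t M)).
  { intros M u Hu. destruct (Hg u Hu) as [Hc Hb].
    assert (D : Cmod (sumC (fun m => a m * u ^ m)%C M - g u)%C <= L - sumR t M).
    { assert (Hc2 := proj2 (clim_incr_n _ _ M) Hc).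
      assert (Hd := clim_minus _ _ _ _ (clim_const (sumC (fun m => a m * u ^ m)%C M)) Hc2).
      apply (clim_Cmod_le _ _ _ Hd). intros k.
      rewrite Nat.add_comm, sumC_split.
      replace (_ - _)%C with (- sumC (fun k0 => a (M + k0)%nat * u ^ (M + k0)) k)%C by ring.
      rewrite Cmod_opp. eapply Rle_trans; [apply Cmod_sumC|].
      assert (E := sumR_split t M k). specialize (HL' (M + k)%nat).
      rewrite (sumR_ext _ (fun k0 => t (M + k0)%nat)); [lra|].
      intros j _. unfold t. now rewrite Cmod_mult, Cmod_pow, Hu. }
    replace (sumC (fun m => a m * u ^ m)%C M) with ((sumC (fun m => a m * u ^ m) M - g u) + g u)%C by ring.
    eapply Rle_trans; [apply Cmod_triangle|]. lra. }
  assert (K : forall M, (n < M)%nat -> t n <= B + (L - sumR t M)).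
  { intros M HM. assert (HM0 : 0 < INR M) by (apply lt_0_INR; lia).
    apply Rmult_le_reg_l with (INR M); auto.
    assert (F := roots_of_unity_filter a Rad M n HM). apply (f_equal Cmod) in F.
    rewrite !Cmod_mult, Cmod_pow, !Cmod_R, !Rabs_pos_eq in F by lra.
    unfold t at 1. rewrite <- F.
    eapply Rle_trans; [apply Cmod_sumC|].
    apply Rle_trans with (sumR (fun _ => B + (L - sumR t M)) M).
    - apply sumR_le; intros j _. rewrite Cmod_mult, Cmod_Cis, Rmult_1_l. apply Htail.
      rewrite Cmod_mult, Cmod_Cis, Cmod_R, Rabs_pos_eq; lra.
    - right. generalize (B + (L - sumR t M)) as X. clear. intros X. induction M; [simpl; ring|].
      rewrite sumR_S, IHM, S_INR. ring. }
  change (t n <= B).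
  apply (is_lim_seq_le_loc (fun _ => t n) (fun M => B + (L - sumR t M)) (t n) B).
  - exists (S n). intros M HM. apply K; lia.
  - apply is_lim_seq_const.
  - replace (Finite B) with (Finite (B + (L - L))) by (f_equal; ring).
    apply is_lim_seq_plus'; [apply is_lim_seq_const|].
    apply is_lim_seq_minus'; [apply is_lim_seq_const|auto].
Qed.

Lemma clim_terms_bounded (a : nat -> C) l : clim (sumC a) l -> exists K, 0 < K /\ forall n, Cmod (a n) <= K.
Proof.
  intros H. apply clim_Cmod in H.
  destruct (filterlim_bounded (K := R_AbsRing) (V := R_NormedModule) (fun n => Cmod (sumC a n))) as [K HK].
  { exists (Cmod l). exact H. }
  assert (HK' : forall n, Cmod (sumC a n) <= K).
  { intros n. specialize (HK n). eapply Rle_trans; [apply Rle_abs|exact HK]. }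
  exists (K + K + 1).
  assert (K0 : 0 <= K) by (eapply Rle_trans; [apply Cmod_ge_0|apply (HK' O)]).
  split; [lra|]. intros n.
  replace (a n) with (sumC a (S n) + - sumC a n)%C by (rewrite sumC_S; ring).
  eapply Rle_trans; [apply Cmod_triangle|]. rewrite Cmod_opp.
  assert (A := HK' n). assert (B := HK' (S n)). lra.
Qed.

Lemma geometric_sum_le (x : R) n : 0 <= x < 1 -> sumR (fun k => x ^ k) n <= / (1 - x).
Proof.
  intros Hx. assert (E : sumR (fun k => x ^ k) n = (1 - x ^ n) / (1 - x)).
  { induction n; [simpl; field; lra|]. rewrite sumR_S, IHn. simpl. field; lra. }
  rewrite E. assert (0 <= x ^ n) by (apply pow_le; lra).
  unfold Rdiv. rewrite <- (Rmult_1_l (/ (1 - x))) at 2. apply Rmult_le_compat_r; [|lra].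
  left; apply Rinv_0_lt_compat; lra.
Qed.

Lemma power_series_geometric_bound (a : nat -> C) (x y K : R) n : 0 <= x -> 0 < y -> 2 * x <= y ->
  (forall k, Cmod (a k) * y ^ k <= K) ->
  sumR (fun k => Cmod (a k) * x ^ k) n <= 2 * K.
Proof.
  intros Hx Hy Hxy HK.
  apply Rle_trans with (sumR (fun k => K * (/ 2) ^ k) n).
  - apply sumR_le; intros k _. eapply Rle_trans; [|apply Rmult_le_compat_r; [apply pow_le; lra|apply (HK k)]].
    rewrite Rmult_assoc, <- Rpow_mult_distr. apply Rmult_le_compat_l; [apply Cmod_ge_0|].
    apply pow_incr; lra.
  - rewrite sumR_scal. assert (G := geometric_sum_le (/ 2) n ltac:(lra)).
    replace (/ (1 - / 2)) with 2 in G by field.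
    assert (K0 := HK O). simpl in K0. assert (C0 := Cmod_ge_0 (a O)). rewrite (Rmult_comm 2). apply Rmult_le_compat_l; [lra|exact G].
Qed.

(* Where both expansions converge, the difference of the principal parts is a
   power series in [1/z], entire and bounded as [1/z] tends to infinity. *)
Lemma laurent_principal_unique (f : C -> C) (c c' : Z -> C) n :
  is_laurent f 0%C c -> is_laurent f 0%C c' -> c (- Z.of_nat (S n))%Z = c' (- Z.of_nat (S n))%Z.
Proof.
  intros (r1 & Hr1 & H1) (r2 & Hr2 & H2).
  set (rho := Rmin r1 r2). assert (Hrho : 0 < rho) by (apply Rmin_glb_lt; auto).
  set (a := fun m : nat => (c (Z.of_nat m) - c' (Z.of_nat m))%C).
  (* Difference of the principal parts as a power series in [u = 1 / z], with zero constant term;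
     where both expansions hold it is the negative of the difference [a] of the regular parts. *)
  set (b := fun m : nat => match m with O => RtoC 0 | S k => (c (- Z.of_nat (S k))%Z - c' (- Z.of_nat (S k))%Z)%C end).
  assert (H : forall z : C, 0 < Cmod z < rho -> exists l,
    clim (sumC (fun m => a m * z ^ m)%C) l /\ clim (sumC (fun m => b m * (/ z) ^ m)%C) (- l)%C).
  { intros z Hz. assert (M1 := Rmin_l r1 r2). assert (M2 := Rmin_r r1 r2). fold rho in M1, M2.
    assert (Hz0 : z <> 0%C) by (apply Cmod_gt_0; lra).
    replace z with (z - 0)%C in Hz by ring.
    destruct (H1 z ltac:(lra)) as (s1 & p1 & S1 & P1 & E1).
    destruct (H2 z ltac:(lra)) as (s2 & p2 & S2 & P2 & E2).
    apply is_series_clim in S1. apply is_series_clim in S2. apply is_series_clim in P1. apply is_series_clim in P2.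
    exists (s1 - s2)%C. split.
    - eapply clim_ext; [|exact (clim_minus _ _ _ _ S1 S2)]. intros m; simpl.
      rewrite <- sumC_minus. apply sumC_ext; intros k _. unfold a.
      replace (z - 0)%C with z by ring. ring.
    - replace (- (s1 - s2))%C with (p1 - p2)%C.
      2: { replace p1 with (f z - s1)%C by (rewrite E1; ring). replace p2 with (f z - s2)%C by (rewrite E2; ring). ring. }
      apply clim_incr_1.
      eapply clim_ext; [|exact (clim_minus _ _ _ _ P1 P2)]. intros m;
      cbv beta.       rewrite <- sumC_minus. clear - Hz0.
      replace (z - 0)%C with z by ring.
      induction m as [|m IH]; [simpl; ring|].
      rewrite (sumC_S _ m), (sumC_S _ (S m)), IH. f_equal. unfold b. rewrite Cpow_inv by auto.
      assert (z ^ S m <> 0)%C by (apply Cpow_nz; auto). field. auto. }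
  assert (Hmod : forall u : C, 0 < Cmod u -> Cmod (/ u) = / Cmod u).
  { intros u Hu. apply Cmod_inv. now apply Cmod_gt_0. }
  destruct (H (RtoC (rho * (3 / 4)))) as (l0 & Hl0 & _); [rewrite Cmod_R, Rabs_pos_eq; lra|].
  destruct (clim_terms_bounded _ _ Hl0) as (K & HK & HKb).
  assert (HKb' : forall k, Cmod (a k) * (rho * (3 / 4)) ^ k <= K).
  { intros k. specialize (HKb k). rewrite Cmod_mult, Cmod_pow, Cmod_R, Rabs_pos_eq in HKb by lra. exact HKb. }
  (* The bound [2 * K] is independent of [Rad]: on [|u| = Rad] the regular series is evaluated at
     [|1 / u| <= rho / 4], less than half of the point [3 rho / 4] at which its terms are bounded by
     [K]. *)
  assert (Hest : forall Rad, 4 / rho <= Rad -> Cmod (b (S n)) * Rad ^ S n <= 2 * K).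
  { intros Rad HRad. assert (H4 : 0 < 4 / rho) by (apply Rdiv_lt_0_compat; lra).
    destruct (choice (fun u l => Cmod u = Rad -> clim (sumC (fun m => a m * (/ u) ^ m)%C) l /\ clim (sumC (fun m => b m * u ^ m)%C) (- l)%C)) as [g Hg].
    { intros u. destruct (Req_dec (Cmod u) Rad) as [E|E]; [|exists 0%C; intros; contradiction].
      assert (Hu0 : u <> 0%C) by (apply Cmod_gt_0; lra).
      destruct (H (/ u)%C) as (l & Hl1 & Hl2).
      - rewrite Hmod by lra. rewrite E. split; [apply Rinv_0_lt_compat; lra|].
        apply Rle_lt_trans with (rho / 4); [|lra].
        replace (rho / 4) with (/ (4 / rho)) by (field; lra). apply Rinv_le_contravar; lra.
      - exists l. intros _. split; auto. replace (/ / u)%C with u in Hl2 by (field; auto). exact Hl2. }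
    destruct (H (RtoC (/ (2 * Rad)))) as (l1 & _ & Hl1).
    { rewrite Cmod_R, Rabs_pos_eq by (left; apply Rinv_0_lt_compat; lra).
      split; [apply Rinv_0_lt_compat; lra|].
      apply Rle_lt_trans with (rho / 8); [|lra].
      replace (rho / 8) with (/ (2 * (4 / rho))) by (field; lra). apply Rinv_le_contravar; lra. }
    destruct (clim_terms_bounded _ _ Hl1) as (K1 & HK1 & HK1b).
    apply (cauchy_estimate b (fun u => - g u)%C Rad (2 * K) (2 * K1)); [lra| |].
    - intros m. apply (power_series_geometric_bound b Rad (2 * Rad) K1 m); try lra.
      intros k. specialize (HK1b k). rewrite Cmod_mult, Cmod_pow in HK1b.
      rewrite <- RtoC_inv, Cmod_R, Rinv_inv, Rabs_pos_eq in HK1b; [exact HK1b|lra|].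
      apply Rinv_neq_0_compat; lra.
    - intros u Hu. destruct (Hg u Hu) as [G1 G2]. split; auto.
      rewrite Cmod_opp. apply (clim_Cmod_le _ _ _ G1). intros m.
      eapply Rle_trans; [apply Cmod_sumC|].
      rewrite (sumR_ext _ (fun k => Cmod (a k) * (/ Rad) ^ k)).
      2: { intros k _. rewrite Cmod_mult, Cmod_pow, Hmod by lra. now rewrite Hu. }
      apply (power_series_geometric_bound a (/ Rad) (rho * (3 / 4)) K m); auto; try lra.
      + left; apply Rinv_0_lt_compat; lra.
      + assert (/ Rad <= rho / 4).
        { replace (rho / 4) with (/ (4 / rho)) by (field; lra). apply Rinv_le_contravar; lra. }
        lra. }
  assert (Z : Cmod (b (S n)) = 0).
  { destruct (Cmod_ge_0 (b (S n))) as [P|P]; [|auto]. exfalso.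
    (* Large enough that [Cmod (b (S n)) * Rad] already exceeds [2 * K], and at least 1 so that
       [Rad <= Rad ^ S n]. *)
    set (Rad := 1 + 4 / rho + 2 * K / Cmod (b (S n))).
    assert (P1 : 0 < 4 / rho) by (apply Rdiv_lt_0_compat; lra).
    assert (P2 : 0 < 2 * K / Cmod (b (S n))) by (apply Rdiv_lt_0_compat; lra).
    specialize (Hest Rad ltac:(unfold Rad; lra)).
    assert (R1 : Rad <= Rad ^ S n).
    { rewrite <- (pow_1 Rad) at 1. apply Rle_pow; [unfold Rad; lra|lia]. }
    assert (R2 : Cmod (b (S n)) * Rad <= 2 * K) by (eapply Rle_trans; [|exact Hest]; apply Rmult_le_compat_l; lra).
    unfold Rad in R2. replace (Cmod (b (S n)) * (1 + 4 / rho + 2 * K / Cmod (b (S n)))) with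
      (Cmod (b (S n)) * (1 + 4 / rho) + 2 * K) in R2 by (field; lra).
    assert (0 < Cmod (b (S n)) * (1 + 4 / rho)) by (apply Rmult_lt_0_compat; lra). lra. }
  apply Cmod_eq_0 in Z. unfold b in Z. now apply Ceq_minus.
Qed.

Lemma sumC_rev (f : nat -> C) m : sumC f m = sumC (fun k => f (m - 1 - k)%nat) m.
Proof.
  assert (Hshift : forall (f : nat -> C) n, sumC f (S n) = (f O + sumC (fun k => f (S k)) n)%C).
  { intros g n. induction n; [simpl; ring|]. rewrite sumC_S, IHn, (sumC_S _ n). ring. }
  induction m; [reflexivity|].
  rewrite (Hshift (fun k => f (S m - 1 - k)%nat)), sumC_S, IHm.
  replace (S m - 1 - 0)%nat with m by lia. rewrite Cplus_comm. f_equal.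
  apply sumC_ext; intros k Hk. f_equal; lia.
Qed.

Lemma laurent_coef_quotient (f g : C -> C) (kappa : nat -> C) (m : nat) (rho : R) n :
  0 < rho -> (forall z : C, 0 < Cmod z < rho -> clim (sumC (fun j => kappa j * z ^ j)%C) (g z)
     /\ f z = (g z / z ^ m)%C) ->
  (1 <= n <= m)%nat -> laurent_coef f 0%C (- Z.of_nat n)%Z = kappa (m - n)%nat.
Proof.
  intros Hrho H Hn.
  (* The Taylor coefficients of [g] shifted by [m], and zero below [-m], where [Z.to_nat] would
     otherwise return 0. *)
  set (c := fun i : Z => if Z_lt_dec (i + Z.of_nat m) 0 then RtoC 0 else kappa (Z.to_nat (i + Z.of_nat m))).
  assert (Hc : is_laurent f 0%C c).
  { exists rho; split; auto. intros z Hz. replace (z - 0)%C with z in * by ring.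
    assert (Hz0 : z <> 0%C) by (apply Cmod_gt_0; lra).
    assert (Hzm : (z ^ m <> 0)%C) by (apply Cpow_nz; auto).
    destruct (H z Hz) as [Hg Hf].
    set (pp := (/ z ^ m * sumC (fun j => kappa j * z ^ j) m)%C).
    exists (/ z ^ m * g z - pp)%C, pp. split; [|split].
    - apply is_series_clim.
      assert (L := clim_minus _ _ _ _ (clim_scal (/ z ^ m)%C _ _ (proj2 (clim_incr_n _ _ m) Hg)) (clim_const pp)).
      eapply clim_ext; [|exact L]. intros N; simpl. rewrite (Nat.add_comm N m), sumC_split.
      unfold pp. rewrite Cmult_plus_distr_l.
      replace (/ z ^ m * sumC (fun j => kappa j * z ^ j) m + / z ^ m * sumC (fun k => kappa (m + k)%nat * z ^ (m + k)) N -
        / z ^ m * sumC (fun j => kappa j * z ^ j) m)%C with (/ z ^ m * sumC (fun k => kappa (m + k)%nat * z ^ (m + k)) N)%C by ring.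
      rewrite <- sumC_scal. apply sumC_ext; intros k _. unfold c.
      destruct (Z_lt_dec (Z.of_nat k + Z.of_nat m) 0); [lia|].
      replace (Z.to_nat (Z.of_nat k + Z.of_nat m)) with (m + k)%nat by lia.
      rewrite Cpow_add_r. field; auto.
    - apply is_series_clim. apply clim_ext_loc with (fun _ => pp) m; [|apply clim_const].
      assert (E : sumC (fun k => c (- Z.of_nat (S k))%Z / z ^ S k)%C m = pp).
      { unfold pp. rewrite (sumC_rev (fun j => kappa j * z ^ j)%C), <- sumC_scal. apply sumC_ext; intros k Hk.
        unfold c. destruct (Z_lt_dec (- Z.of_nat (S k) + Z.of_nat m) 0); [lia|].
        replace (Z.to_nat (- Z.of_nat (S k) + Z.of_nat m)) with (m - 1 - k)%nat by lia.
        assert (Em : (z ^ m = z ^ (m - 1 - k) * z ^ S k)%C) by (rewrite <- Cpow_add_r; f_equal; lia).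
        rewrite Em.
        assert (z ^ S k <> 0)%C by (apply Cpow_nz; auto).
        assert (z ^ (m - 1 - k) <> 0)%C by (apply Cpow_nz; auto).
        field; auto. }
      intros N HN. induction HN as [|N HN IH]; [auto|]. rewrite sumC_S, <- IH.
      unfold c. destruct (Z_lt_dec (- Z.of_nat (S N) + Z.of_nat m) 0); [|lia]. unfold Cdiv. ring.
    - rewrite Hf. unfold Cdiv. ring. }
  unfold laurent_coef. apply (iota_unique (K := C_AbsRing) (V := C_CompleteNormedModule)).
  - intros y (c' & Hc' & <-). replace n with (S (n - 1)) by lia.
    rewrite (laurent_principal_unique f c' c (n - 1) Hc' Hc). unfold c.
    destruct (Z_lt_dec (- Z.of_nat (S (n - 1)) + Z.of_nat m) 0); [lia|]. f_equal. lia.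
  - exists c; split; auto. unfold c. destruct (Z_lt_dec (- Z.of_nat n + Z.of_nat m) 0); [lia|]. f_equal. lia.
Qed.

(** * The Bessel function and its derivatives at the zeros *)

Definition besselK (q : nat) : R := 2 ^ q * INR (fact q).

Lemma besselK_pos q : 0 < besselK q.
Proof. apply Rmult_lt_0_compat; [apply pow_lt; lra|apply INR_fact_lt_0]. Qed.

Lemma besselJ_besselF q (z : C) :
  besselJ q z = (z ^ q / RtoC (besselK q) * besselF q (z ^ 2))%C.
Proof.
  assert (HK : RtoC (besselK q) <> 0%C) by (apply RtoC_neq_0, Rgt_not_eq, besselK_pos).
  assert (L : clim (sumC (fun m => RtoC ((-1) ^ m / (INR (fact m) * INR (fact (m + q)))) * (z / 2) ^ (2 * m + q))%C)
    (z ^ q / RtoC (besselK q) * besselF q (z ^ 2))%C).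
  { eapply clim_ext; [|exact (clim_scal (z ^ q / RtoC (besselK q))%C _ _ (besselF_lim q (z ^ 2)%C))].
    intros n. cbv beta. rewrite <- sumC_scal. apply sumC_ext; intros m _.
    replace (z / 2)%C with (z * RtoC (/ 2))%C by (rewrite RtoC_inv by lra; reflexivity).
    rewrite Cpow_mult_l, !Cpow_add_r, !Cpow_mult_r, <- !RtoC_pow.
    transitivity (z ^ q * (z ^ 2) ^ m * RtoC (Fcoef q m / besselK q))%C.
    - rewrite RtoC_div by (apply Rgt_not_eq, besselK_pos). field. auto.
    - transitivity ((z ^ 2) ^ m * z ^ q * RtoC ((-1) ^ m / (INR (fact m) * INR (fact (m + q))) * (((/ 2) ^ 2) ^ m * (/ 2) ^ q)))%C.
      + replace ((-1) ^ m / (INR (fact m) * INR (fact (m + q))) * (((/ 2) ^ 2) ^ m * (/ 2) ^ q)) with (Fcoef q m / besselK q); [ring|].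
        unfold Fcoef, besselK. replace (- / 4) with ((-1) * (/ 2) ^ 2) by field.
        rewrite Rpow_mult_distr, (pow_inv 2 q).
        assert (A := INR_fact_neq_0 m). assert (B := INR_fact_neq_0 (m + q)). assert (D := INR_fact_neq_0 q).
        assert (E : 2 ^ q <> 0) by (apply pow_nonzero; lra).
        field. repeat split; auto.
      + rewrite !RtoC_mult. ring. }
  unfold besselJ. apply (iota_unique (K := C_AbsRing) (V := C_CompleteNormedModule)).
  - intros y Hy. apply is_series_clim in Hy. eapply clim_unique; eauto.
  - now apply is_series_clim.
Qed.

Definition Jr (q : nat) (x : R) : R := x ^ q / besselK q * Fr q (x ^ 2).
Definition Jr1 (q : nat) (x : R) : R :=
  (INR q * x ^ pred q * Fr q (x ^ 2) + 2 * x ^ S q * Fr1 q (x ^ 2)) / besselK q.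

Lemma besselJ_RtoC q (x : R) : besselJ q (RtoC x) = RtoC (Jr q x).
Proof.
  rewrite besselJ_besselF, <- !RtoC_pow, besselF_RtoC. unfold Jr.
  rewrite RtoC_mult, RtoC_div by (apply Rgt_not_eq, besselK_pos). reflexivity.
Qed.

Lemma is_derive_Jr q (x : R) : is_derive (Jr q) x (Jr1 q x).
Proof.
  unfold Jr, Jr1. assert (P := besselK_pos q).
  assert (D := is_derive_Fr q (x ^ 2)).
  auto_derive.
  - eexists; exact D.
  - change (fun x : R => Fr q x) with (Fr q). change (x * (x * 1)) with (x ^ 2).
    rewrite (is_derive_unique _ _ _ D). simpl pow. field. lra.
Qed.

(* At a zero, Bessel's equation reduces to [x J'' + J' = 0]. *)
Lemma is_derive_Jr1_root q (x : R) : x <> 0 -> Fr q (x ^ 2) = 0 -> is_derive (Jr1 q) x (- Jr1 q x / x).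
Proof.
  intros Hx H0. assert (P := besselK_pos q).
  assert (O := Fr_ode q (x ^ 2)). rewrite H0 in O.
  assert (D := is_derive_Fr q (x ^ 2)). assert (D1 := is_derive_Fr1 q (x ^ 2)).
  assert (E2 : Fr2 q (x ^ 2) = - (INR q + 1) * Fr1 q (x ^ 2) / x ^ 2).
  { apply Rmult_eq_reg_l with (x ^ 2); [|apply pow_nonzero; auto]. field_simplify_eq; [lra|auto]. }
  unfold Jr1. auto_derive.
  - repeat split; auto; eexists; eauto.
  - change (fun x : R => Fr q x) with (Fr q). change (fun x : R => Fr1 q x) with (Fr1 q).
    change (x * (x * 1)) with (x ^ 2).
    rewrite (is_derive_unique _ _ _ D), (is_derive_unique _ _ _ D1), H0, E2.
    destruct q as [|q].
    + simpl. field. split; [lra|auto].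
    + change (match q with O => 1 | S _ => INR q + 1 end) with (INR (S q)).
      rewrite S_INR. simpl pow. simpl pred. field. split; [lra|auto].
Qed.

Lemma Lim_quotient (phi : R -> R) (x l : R) : is_derive phi x l ->
  is_lim (fun y => (phi y - phi x) / (y - x)) x l.
Proof.
  intros H. apply is_derive_Reals in H. apply is_lim_spec. intros eps.
  destruct (H eps (cond_pos eps)) as [d Hd]. exists d. intros y Hy Hne.
  assert (Hy' : Rabs (y - x) < d) by exact Hy.
  specialize (Hd (y - x) ltac:(lra) Hy'). now replace (x + (y - x)) with y in Hd by (symmetry; apply Rplus_minus).
Qed.

(** [C_derive] takes limits along real increments, so a function that is real on the real axis has
    its real derivative there. No complex differentiability of [J_q] has to be established. *)
Lemma C_derive_real (f : C -> C) (phi : R -> R) (x l : R) :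
  (forall y : R, f (RtoC y) = RtoC (phi y)) -> is_derive phi x l -> C_derive f (RtoC x) = RtoC l.
Proof.
  intros Hf Hd.
  assert (Q : forall y : R, y <> x -> ((f (y, 0) - f (RtoC x)) / ((y, 0) - RtoC x))%C = RtoC ((phi y - phi x) / (y - x))).
  { intros y Hy. change (y, 0) with (RtoC y). rewrite !Hf, <- !RtoC_minus, <- RtoC_div by lra. reflexivity. }
  assert (L1 : Lim (fun y => fst ((f (y, 0%R) - f (RtoC x)) / ((y, 0%R) - RtoC x))%C) x = l).
  { apply is_lim_unique. apply is_lim_ext_loc with (fun y => (phi y - phi x) / (y - x)).
    - exists (mkposreal 1 ltac:(lra)). intros y _ Hne. now rewrite Q.
    - now apply Lim_quotient. }
  assert (L2 : Lim (fun y => snd ((f (y, 0%R) - f (RtoC x)) / ((y, 0%R) - RtoC x))%C) x = 0).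
  { apply is_lim_unique. apply is_lim_ext_loc with (fun _ => 0).
    - exists (mkposreal 1 ltac:(lra)). intros y _ Hne. now rewrite Q.
    - apply is_lim_const. }
  change (C_derive f (RtoC x)) with
    (real (Lim (fun y => fst ((f (y, 0%R) - f (RtoC x)) / ((y, 0%R) - RtoC x))%C) x),
     real (Lim (fun y => snd ((f (y, 0%R) - f (RtoC x)) / ((y, 0%R) - RtoC x))%C) x)).
  rewrite L1, L2. reflexivity.
Qed.

Lemma C_derive_1_besselJ q (x : R) : C_derive_n 1 (besselJ q) (RtoC x) = RtoC (Jr1 q x).
Proof. apply (C_derive_real _ (Jr q)); [apply besselJ_RtoC|apply is_derive_Jr]. Qed.

Lemma C_derive_2_besselJ q (x : R) : x <> 0 -> Fr q (x ^ 2) = 0 ->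
  C_derive_n 2 (besselJ q) (RtoC x) = RtoC (- Jr1 q x / x).
Proof.
  intros Hx H0. apply (C_derive_real _ (Jr1 q)); [apply C_derive_1_besselJ|now apply is_derive_Jr1_root].
Qed.

Lemma Jr1_root q x : Fr q (x ^ 2) = 0 -> Jr1 q x = 2 * x ^ S q * Fr1 q (x ^ 2) / besselK q.
Proof. intros H; unfold Jr1; rewrite H. field. apply Rgt_not_eq, besselK_pos. Qed.

(** * Symmetric sums and principal parts in the variable [z] *)

Lemma sum_n_m_sumC (g : nat -> C) N :
  sum_n_m (G := C_AbelianMonoid) g 1 N = sumC (fun j => g (S j)) N.
Proof.
  induction N.
  - rewrite sum_n_m_zero by lia. reflexivity.
  - rewrite sum_n_Sm, IHN by lia. reflexivity.
Qed.

Lemma is_bisum_clim (f : Z -> C) (l : C) :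
  clim (sumC (fun j => f (Z.of_nat (S j)) + f (- Z.of_nat (S j))%Z)%C) l -> is_bisum f l.
Proof.
  intros H. unfold is_bisum. apply clim_filterlim in H.
  eapply filterlim_ext; [|exact H]. intros N. now rewrite sum_n_m_sumC.
Qed.

Lemma sumC_even (a : nat -> C) n :
  sumC (fun j => if Nat.even j then a (Nat.div2 j) else 0%C) n = sumC a (Nat.div2 (S n)).
Proof.
  assert (G : forall k, sumC (fun j => if Nat.even j then a (Nat.div2 j) else 0%C) (2 * k) = sumC a k).
  { induction k; [reflexivity|]. replace (2 * S k)%nat with (S (S (2 * k))) by lia.
    rewrite !sumC_S, IHk. rewrite Nat.even_mul, Nat.div2_double. simpl Nat.even at 1.
    replace (Nat.even (S (2 * k))) with false; [simpl; ring|].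
    symmetry. rewrite Nat.even_succ, <- Nat.negb_even, Nat.even_mul. reflexivity. }
  destruct (Nat.Even_or_Odd n) as [[k ->]|[k ->]].
  - rewrite G. now rewrite Nat.div2_succ_double.
  - replace (2 * k + 1)%nat with (S (2 * k)) by lia. rewrite sumC_S, G, Nat.even_mul, Nat.div2_double.
    replace (S (S (2 * k))) with (2 * S k)%nat by lia. rewrite Nat.div2_double. reflexivity.
Qed.

Lemma clim_even (a : nat -> C) l : clim (sumC a) l ->
  clim (sumC (fun j => if Nat.even j then a (Nat.div2 j) else 0%C)) l.
Proof.
  intros H. apply clim_ext with (fun n => sumC a (Nat.div2 (S n))).
  { intros n. now rewrite sumC_even. }
  unfold clim in *. apply (is_lim_seq_subseq (fun n => Cmod (sumC a n - l)) 0 (fun n => Nat.div2 (S n))); auto.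
  intros P [N HN]. exists (2 * N)%nat. intros n Hn. apply HN.
  destruct (Nat.Even_or_Odd (S n)) as [[k E]|[k E]]; rewrite E.
  - rewrite Nat.div2_double. lia.
  - replace (2 * k + 1)%nat with (S (2 * k)) by lia. rewrite Nat.div2_succ_double. lia.
Qed.

Lemma even_power_term (gamma : nat -> C) (w : C) j :
  ((if Nat.even j then gamma (Nat.div2 j) else 0) * w ^ j =
   if Nat.even j then gamma (Nat.div2 j) * (w ^ 2) ^ Nat.div2 j else 0)%C.
Proof.
  destruct (Nat.even j) eqn:E; [|ring].
  rewrite <- Cpow_mult_r. do 2 f_equal.
  apply Nat.even_spec in E. destruct E as [k ->]. now rewrite Nat.div2_double.
Qed.

(** Passing from [w = z^2] back to [z] puts the coefficients of [phi] at even indices. Below [m]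
    there are [Nat.div2 (S m)] even indices: [half_up q] of them for [m = q], and [q] for
    [m = 2 q]. *)
Lemma laurent_principal_part (f phi : C -> C) (gamma : nat -> C) (c z : C) (m : nat) (rho : R) : 0 < rho -> rho <= 1 ->
  (forall w, Cmod w < rho -> clim (sumC (fun i => gamma i * w ^ i)%C) (phi w)) ->
  (forall w, 0 < Cmod w < rho -> f w = (c * phi (w ^ 2) / w ^ m)%C) -> z <> 0%C ->
  sumC (fun j => laurent_coef f 0%C (- Z.of_nat (S j))%Z / z ^ S j)%C m =
  (c / z ^ m * sumC (fun i => gamma i * (z ^ 2) ^ i) (Nat.div2 (S m)))%C.
Proof.
  intros Hrho Hrho1 Hphi Hf Hz.
  set (kappa := fun j => (c * (if Nat.even j then gamma (Nat.div2 j) else 0))%C).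
  rewrite (sumC_ext _ (fun j => kappa (m - S j)%nat / z ^ S j)%C).
  2: { intros j Hj. f_equal. apply (laurent_coef_quotient f (fun w => c * phi (w ^ 2))%C kappa m rho); auto; [|lia].
       intros w Hw. split; [|apply Hf; auto].
       (* Here [rho <= 1] ensures that squaring does not leave the disc. *)
       assert (Hw2 : Cmod (w ^ 2) < rho).
       { rewrite Cmod_pow. simpl. nra. }
       eapply clim_ext; [|exact (clim_scal c _ _ (clim_even _ _ (Hphi _ Hw2)))].
       intros n. cbv beta. rewrite <- sumC_scal. apply sumC_ext; intros k _. unfold kappa.
       rewrite <- even_power_term. ring. }
  rewrite <- sumC_even. rewrite (sumC_ext (fun j => if Nat.even j then (gamma (Nat.div2 j) * (z ^ 2) ^ Nat.div2 j)%C else 0%C)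
    (fun j => (if Nat.even j then gamma (Nat.div2 j) else 0) * z ^ j)%C) by (intros; now rewrite even_power_term).
  rewrite (sumC_rev (fun j => (if Nat.even j then gamma (Nat.div2 j) else 0) * z ^ j)%C), <- sumC_scal.
  apply sumC_ext; intros j Hj. unfold kappa. replace (m - 1 - j)%nat with (m - S j)%nat by lia.
  assert (Em : (z ^ m = z ^ (m - S j) * z ^ S j)%C) by (rewrite <- Cpow_add_r; f_equal; lia).
  rewrite Em. assert (z ^ S j <> 0)%C by (apply Cpow_nz; auto).
  assert (z ^ (m - S j) <> 0)%C by (apply Cpow_nz; auto). field; auto.
Qed.

Lemma half_up_div2 q : half_up q = Nat.div2 (S q).
Proof. unfold half_up. rewrite Nat.div2_div. f_equal. lia. Qed.

Lemma pair_neq_0 (zeta : R) (z : C) : 0 < zeta -> (1 - RtoC (/ zeta ^ 2) * z ^ 2 <> 0)%C ->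
  (RtoC zeta ^ 2 - z ^ 2 <> 0)%C /\ (z - RtoC zeta <> 0)%C /\ (z + RtoC zeta <> 0)%C.
Proof.
  intros Hz H1. assert (Nz : RtoC zeta <> 0%C) by (apply RtoC_neq_0; lra).
  assert (Hfac : (- (z - RtoC zeta) * (z + RtoC zeta) <> 0)%C).
  { intros E. apply H1. rewrite RtoC_inv, RtoC_pow by (apply pow_nonzero; lra).
    transitivity (- (z - RtoC zeta) * (z + RtoC zeta) / RtoC zeta ^ 2)%C; [field; auto|rewrite E; field; auto]. }
  repeat split; intros E; apply Hfac; [rewrite <- E|rewrite E|rewrite E]; ring.
Qed.

(** The derivative of [J_q] is odd for even [q] and even for odd [q], so the poles at [zeta] and
    [-zeta] combine to a multiple of [2 zeta / (z^2 - zeta^2)] or of [2 z / (z^2 - zeta^2)]. The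
    factor [z ^ (2 * p - q)], equal to 1 or [z], covers both cases. *)
Lemma num_pair q (zeta F1 : R) (z : C) (p := half_up q) : 0 < zeta -> F1 <> 0 ->
  (1 - RtoC (/ zeta ^ 2) * z ^ 2 <> 0)%C ->
  (1 / RtoC (2 * zeta ^ S q * F1 / besselK q) / (z - RtoC zeta)
   + 1 / RtoC (2 * (- zeta) ^ S q * F1 / besselK q) / (z - RtoC (- zeta)))%C =
  (RtoC (besselK q) * z ^ (2 * p - q) *
    (RtoC ((/ zeta ^ 2) ^ p / (- zeta ^ 2 * F1)) * / (1 - RtoC (/ zeta ^ 2) * z ^ 2)))%C.
Proof.
  intros Hz HF H1. assert (HK := besselK_pos q). set (K := besselK q) in *.
  assert (Hz2 : zeta ^ 2 <> 0) by (apply pow_nonzero; lra).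
  destruct (pair_neq_0 zeta z Hz H1) as (Hfac & Hm & Hp).
  set (P := (zeta ^ 2) ^ p). assert (HP : P <> 0) by (apply pow_nonzero; auto).
  assert (HsP : (/ zeta ^ 2) ^ p = / P) by (unfold P; now rewrite pow_inv).
  rewrite HsP.
  destruct (half_up_cases q) as [E|E]; fold p in E.
  - assert (E1 : zeta ^ S q = zeta * P) by (rewrite E; unfold P; rewrite <- pow_mult; reflexivity).
    assert (E2 : (- zeta) ^ S q = - (zeta * P)).
    { rewrite <- E1. simpl. rewrite E, !pow_mult. replace ((- zeta) ^ 2) with (zeta ^ 2) by ring. ring. }
    rewrite E1, E2. replace (2 * p - q)%nat with O by lia.
    replace (2 * (zeta * P) * F1 / K) with (2 * (zeta * P) * F1 * / K) by reflexivity.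
    replace (2 * - (zeta * P) * F1 / K) with (- (2 * (zeta * P) * F1 * / K)) by (unfold Rdiv; ring).
    replace (/ P / (- zeta ^ 2 * F1)) with (- (/ P * / (zeta * zeta) * / F1)) by (field; repeat split; auto; lra).
    replace (/ zeta ^ 2) with (/ (zeta * zeta)) by (f_equal; ring).
    rewrite !RtoC_opp, !RtoC_mult, !RtoC_inv by (auto; lra). rewrite RtoC_mult.
    simpl Cpow. field.
    repeat split; try assumption;
      first [ intros X; apply Hp; rewrite <- X; ring
            | intros X; apply Hfac; rewrite <- X; ring
            | intros X; apply RtoC_inj in X; lra ].
  - assert (E1 : zeta ^ S q = P) by (replace (S q) with (2 * p)%nat by lia; unfold P; now rewrite pow_mult).
    assert (E2 : (- zeta) ^ S q = P).
    { replace (S q) with (2 * p)%nat by lia. unfold P. rewrite pow_mult. f_equal. ring. }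
    rewrite E1, E2. replace (2 * p - q)%nat with 1%nat by lia.
    replace (/ P / (- zeta ^ 2 * F1)) with (- (/ P * / (zeta * zeta) * / F1)) by (field; repeat split; auto; lra).
    replace (2 * P * F1 / K) with (2 * P * F1 * / K) by reflexivity.
    replace (/ zeta ^ 2) with (/ (zeta * zeta)) by (f_equal; ring).
    rewrite !RtoC_opp, !RtoC_mult, !RtoC_inv by (auto; lra). rewrite RtoC_mult.
    simpl Cpow. field.
    repeat split; try assumption;
      first [ intros X; apply Hp; rewrite <- X; ring
            | intros X; apply Hfac; rewrite <- X; ring
            | intros X; apply RtoC_inj in X; lra ].
Qed.

(** As [J'' = - J' / zeta] at a zero, the simple-pole coefficient is [1 / (zeta J'^2)]. Over the
    pair the double and simple poles then add up to [4 z^2 / (J'^2 (zeta^2 - z^2)^2)], a pure square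
    in [z^2]. *)
Lemma den_pair q (zeta F1 J1 J1' : R) (z : C) : 0 < zeta -> F1 <> 0 ->
  (1 - RtoC (/ zeta ^ 2) * z ^ 2 <> 0)%C ->
  J1 = 2 * zeta ^ S q * F1 / besselK q -> J1' = 2 * (- zeta) ^ S q * F1 / besselK q ->
  (1 / RtoC J1 ^ 2 / (z - RtoC zeta) ^ 2 + - (RtoC (- J1 / zeta) / RtoC J1 ^ 3) / (z - RtoC zeta)
   + (1 / RtoC J1' ^ 2 / (z - RtoC (- zeta)) ^ 2
      + - (RtoC (- J1' / - zeta) / RtoC J1' ^ 3) / (z - RtoC (- zeta))))%C =
  (RtoC (besselK q) ^ 2 * z ^ 2 *
    (RtoC ((/ zeta ^ 2) ^ S q / (- zeta ^ 2 * F1) ^ 2) * (/ (1 - RtoC (/ zeta ^ 2) * z ^ 2)) ^ 2))%C.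
Proof.
  intros Hz HF H1 EJ EJ'. assert (HK := besselK_pos q). set (K := besselK q) in *.
  assert (Nz : RtoC zeta <> 0%C) by (apply RtoC_neq_0; lra).
  assert (NK : RtoC K <> 0%C) by (apply RtoC_neq_0; lra).
  destruct (pair_neq_0 zeta z Hz H1) as (Hfac & Hm & Hp).
  set (Q := zeta ^ S q) in *. assert (HQ : Q <> 0) by (apply pow_nonzero; lra).
  (* Parity of the derivative; the sign drops out because the derivative at [-zeta] enters only
     through its square once [J''] is eliminated. *)
  assert (EJ2 : J1' = J1 \/ J1' = - J1).
  { assert (S2 : (-1) ^ S q = 1 \/ (-1) ^ S q = -1).
    { generalize (S q) as n. induction n as [|n [E|E]]; simpl; [left; auto|right; rewrite E; ring|left; rewrite E; ring]. }
    replace ((- zeta) ^ S q) with ((-1) ^ S q * Q) in EJ'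
      by (unfold Q; rewrite <- Rpow_mult_distr; f_equal; ring).
    destruct S2 as [E|E]; rewrite E in EJ'; [left|right]; rewrite EJ', EJ; unfold Rdiv; ring. }
  assert (HJ : J1 <> 0).
  { clearbody Q. rewrite EJ. unfold Rdiv. repeat apply Rmult_integral_contrapositive_currified; auto; try lra.
    apply Rinv_neq_0_compat; lra. }
  assert (NJ : RtoC J1 <> 0%C) by (apply RtoC_neq_0; auto).
  assert (HsQ : (/ zeta ^ 2) ^ S q = / Q ^ 2).
  { rewrite pow_inv. unfold Q. f_equal. rewrite <- !pow_mult. f_equal. lia. }
  rewrite HsQ.
  replace (/ Q ^ 2 / (- zeta ^ 2 * F1) ^ 2) with (4 * / (K * K) * / (J1 * J1) * / (zeta * zeta) * / (zeta * zeta)).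
  2: { rewrite EJ. field. repeat split; auto; lra. }
  transitivity (4 * z ^ 2 * / (RtoC J1 ^ 2 * (RtoC zeta ^ 2 - z ^ 2) ^ 2))%C.
  - assert (G : forall J, RtoC J = RtoC J1 \/ RtoC J = (- RtoC J1)%C ->
      (1 / RtoC J ^ 2 / (z - RtoC (- zeta)) ^ 2 + - (RtoC (- J / - zeta) / RtoC J ^ 3) / (z - RtoC (- zeta)) =
       1 / RtoC J1 ^ 2 / (z + RtoC zeta) ^ 2 - 1 / (RtoC zeta * RtoC J1 ^ 2) / (z + RtoC zeta))%C).
    { intros J HJJ. replace (- J / - zeta) with (J * / zeta) by (field; lra).
      rewrite RtoC_mult, RtoC_inv, RtoC_opp by lra.
      replace (z - - RtoC zeta)%C with (z + RtoC zeta)%C by ring.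
      destruct HJJ as [->| ->]; field; repeat split; auto. }
    rewrite (G J1').
    2: { destruct EJ2 as [->| ->]; [left; auto|right; apply RtoC_opp]. }
    replace (- J1 / zeta) with (- (J1 * / zeta)) by (unfold Rdiv; ring).
    rewrite RtoC_opp, RtoC_mult, RtoC_inv by lra.
    field. repeat split; try assumption.
  - replace (/ zeta ^ 2) with (/ (zeta * zeta)) by (f_equal; ring).
    rewrite !RtoC_mult, !RtoC_inv, !RtoC_mult by (try apply Rmult_integral_contrapositive_currified; auto; lra).
    field. repeat split; try assumption;
      intros X; apply Hfac; rewrite <- X; ring.
Qed.

(** * Numerator and denominator as [1 / J_q] and [1 / J_q^2] *)

Open Scope C_scope.

Theorem mainTheorem9 (q : nat) (zk : Z -> R)
    (hzk : enumerates_zeros (besselJ q) zk)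
    (z : C) (hz : besselJ q z <> 0) :
  exists snum sden : C,
    is_bisum (fun k : Z => num_am1 q zk k / (z - zk k)) snum /\
    is_bisum (fun k : Z => den_am2 q zk k / (z - zk k) ^ 2
                           + den_am1 q zk k / (z - zk k)) sden /\
    1 + A0den q z + sden <> 0 /\
    besselJ q z = (A0num q z + snum) / (1 + A0den q z + sden).
Proof.
  destruct hzk as (Z1 & Z2 & Z3).
  set (zeta := fun j : nat => zk (Z.of_nat (S j))).
  set (r := fun j => (zeta j ^ 2)%R).
  assert (Hzp : forall j, (0 < zeta j)%R) by (intros j; apply Z1; lia).
  assert (HK := besselK_pos q).
  assert (NK : RtoC (besselK q) <> 0) by (apply RtoC_neq_0; lra).
  assert (HJF : forall x : R, (0 < x)%R -> (besselJ q (RtoC x) = 0 <-> Fr q (x ^ 2)%R = 0%R)).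
  { intros x Hx. rewrite besselJ_RtoC. unfold Jr.
    assert (P : (0 < x ^ q / besselK q)%R) by (apply Rdiv_lt_0_compat; auto; apply pow_lt; auto).
    split; intros E.
    - apply RtoC_inj in E. apply Rmult_integral in E. destruct E; auto; lra.
    - rewrite E, Rmult_0_r. reflexivity. }
  assert (Hr : positive_zeros q r).
  { repeat split.
    - intros k. apply pow_lt; auto.
    - intros k. unfold r. assert (L := Z1 (Z.of_nat (S k)) ltac:(lia)).
      replace (Z.of_nat (S k) + 1)%Z with (Z.of_nat (S (S k))) in L by lia.
      fold (zeta k) (zeta (S k)) in L. nra.
    - intros k. apply HJF; auto. apply (proj2 (Z2 (zeta k) (Hzp k))). exists (Z.of_nat (S k)). split; [lia|reflexivity].
    - intros x Hx E. assert (Hs : (0 < sqrt x)%R) by (apply sqrt_lt_R0; auto).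
      assert (Es : (sqrt x ^ 2)%R = x) by (apply pow2_sqrt; lra).
      destruct (proj1 (Z2 (sqrt x) Hs)) as (k & Hk & Ek).
      { apply HJF; auto. now rewrite Es. }
      (* The zeros are numbered from 1 in [zk] and from 0 in [zeta] and [r]. *)
      exists (Z.to_nat (k - 1)). unfold r, zeta. rewrite <- Es, Ek. do 2 f_equal. lia. }
  assert (HF : besselF q (z ^ 2) <> 0).
  { intros E. apply hz. rewrite besselJ_besselF, E. ring. }
  assert (Hzq : z ^ q <> 0).
  { intros E. apply hz. rewrite besselJ_besselF, E. unfold Cdiv. ring. }
  assert (Hne := F_factor_neq_0 q r Hr _ HF).
  destruct (inv_F_taylor q r Hr) as (gamma & Hg1 & Hg2).
  destruct (inv_F2_taylor q r Hr) as (delta & Hd1 & Hd2).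
  set (rho := Rmin (/ 2) (r 0%nat / 2)) in *.
  assert (Hrho : (0 < rho)%R).
  { apply Rmin_glb_lt; [lra|]. assert (P := r_pos q r Hr 0). lra. }
  assert (Hrho1 : (rho <= / 2)%R) by apply Rmin_l.
  assert (Hcentral : delta q = RtoC (/ (4 ^ q * INR (fact q) ^ 2))).
  { apply (central_coef q rho gamma delta); auto.
    intros x Hx E. apply (besselF_neq_0_small q (RtoC x)); [rewrite Cmod_R; lra|].
    now rewrite besselF_RtoC, E. }
  destruct (Hg2 _ HF) as (S1 & HS1 & E1).
  destruct (Hd2 _ HF) as (S2 & HS2 & E2).
  assert (HJ1 : forall j, Jr1 q (zeta j) = (2 * zeta j ^ S q * Fr1 q (r j) / besselK q)%R).
  { intros j. rewrite Jr1_root; auto. apply Hr. }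
  assert (HrN : forall j, ((- zeta j) ^ 2)%R = r j) by (intros; unfold r; ring).
  assert (HJ1' : forall j, Jr1 q (- zeta j) = (2 * (- zeta j) ^ S q * Fr1 q (r j) / besselK q)%R).
  { intros j. rewrite Jr1_root; rewrite HrN; auto. apply Hr. }
  assert (Hzn : forall j, zk (- Z.of_nat (S j))%Z = (- zeta j)%R) by (intros; apply Z3; lia).
  assert (HF1 : forall j, Fr1 q (r j) <> 0%R) by (intros; apply Fr_root_simple; apply Hr).
  (* The remainders of [1 / F] and [1 / F^2] at [z^2], multiplied by [besselK q / z^q] and its
     square; the powers of [z] are those left by [w ^ half_up] and [w ^ S q]. *)
  exists (RtoC (besselK q) * z ^ (2 * half_up q - q) * S1), (RtoC (besselK q) ^ 2 * z ^ 2 * S2).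
  assert (Hnum : A0num q z = RtoC (besselK q) / z ^ q * sumC (fun i => gamma i * (z ^ 2) ^ i) (half_up q)).
  { destruct q as [|q'].
    - simpl. ring.
    - rewrite half_up_div2. unfold A0num. rewrite sum_n_m_sumC.
      assert (Hz0 : z <> 0) by (intros E; apply Hzq; rewrite E; apply Cmult_0_l).
      apply (laurent_principal_part _ (fun w => / besselF (S q') w) gamma _ z (S q') rho); auto; [lra|].
      intros w Hw. rewrite besselJ_besselF.
      assert (Hw0 : w <> 0) by (apply Cmod_gt_0; lra).
      assert (w ^ S q' <> 0) by (apply Cpow_nz; auto).
      assert (besselF (S q') (w ^ 2) <> 0).
      { apply besselF_neq_0_small. rewrite Cmod_pow. simpl. nra. }
      field; auto. }
  assert (Hden : A0den q z = RtoC (besselK q) ^ 2 / z ^ (2 * q) * sumC (fun i => delta i * (z ^ 2) ^ i) q).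
  { replace (sumC (fun i => delta i * (z ^ 2) ^ i) q) with (sumC (fun i => delta i * (z ^ 2) ^ i) (Nat.div2 (S (2 * q))))
      by (now rewrite Nat.div2_succ_double).
    destruct q as [|q'].
    - simpl. ring.
    - unfold A0den. rewrite sum_n_m_sumC.
      assert (Hz0 : z <> 0) by (intros E; apply Hzq; rewrite E; apply Cmult_0_l).
      apply (laurent_principal_part _ (fun w => / besselF (S q') w ^ 2) delta _ z (2 * S q') rho); auto; [lra|].
      intros w Hw. rewrite besselJ_besselF.
      assert (Hw0 : w <> 0) by (apply Cmod_gt_0; lra).
      assert (w ^ S q' <> 0) by (apply Cpow_nz; auto).
      assert (besselF (S q') (w ^ 2) <> 0).
      { apply besselF_neq_0_small. rewrite Cmod_pow. simpl. nra. }
      rewrite (Nat.mul_comm 2 (S q')), Cpow_mult_r. field; auto. }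
  assert (Htop : A0num q z + RtoC (besselK q) * z ^ (2 * half_up q - q) * S1 = / besselJ q z).
  { rewrite Hnum, besselJ_besselF.
    transitivity (RtoC (besselK q) / z ^ q * / besselF q (z ^ 2)).
    - rewrite E1, <- Cpow_mult_r.
      replace (z ^ (2 * half_up q)) with (z ^ (2 * half_up q - q) * z ^ q)
        by (rewrite <- Cpow_add_r; f_equal; destruct (half_up_cases q); lia).
      field; auto.
    - field; auto. }
  assert (Hbot : 1 + A0den q z + RtoC (besselK q) ^ 2 * z ^ 2 * S2 = / besselJ q z ^ 2).
  { rewrite Hden, besselJ_besselF.
    transitivity (RtoC (besselK q) ^ 2 / z ^ (2 * q) * / besselF q (z ^ 2) ^ 2).
    - rewrite E2, sumC_S, Hcentral, (Cpow_S (z ^ 2) q), <- (Cpow_mult_r z 2 q).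
      assert (Hz2q : z ^ (2 * q) <> 0) by (rewrite Nat.mul_comm, Cpow_mult_r; apply Cpow_nz; auto).
      (* The term [i = q] of the Taylor polynomial, just past the principal part, becomes the
         constant 1 of the denominator because [besselK q] is [2^q q!]. *)
      assert (Hone : RtoC (besselK q) ^ 2 * RtoC (/ (4 ^ q * INR (fact q) ^ 2)) = 1).
      { rewrite <- RtoC_pow, <- RtoC_mult. f_equal. unfold besselK.
        rewrite Rpow_mult_distr, <- pow_mult, Nat.mul_comm, pow_mult.
        replace (2 ^ 2)%R with 4%R by ring.
        assert (A := INR_fact_neq_0 q). assert (B : (4 ^ q)%R <> 0%R) by (apply pow_nonzero; lra).
        field; auto. }
      transitivity (RtoC (besselK q) ^ 2 * RtoC (/ (4 ^ q * INR (fact q) ^ 2)) +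
        RtoC (besselK q) ^ 2 / z ^ (2 * q) * sumC (fun i => delta i * (z ^ 2) ^ i) q +
        RtoC (besselK q) ^ 2 * z ^ 2 * S2); [rewrite Hone; ring|field; auto].
    - rewrite (Nat.mul_comm 2 q), Cpow_mult_r. field; auto. }
  split; [|split; [|split]].
  - apply is_bisum_clim.
    eapply clim_ext; [|exact (clim_scal (RtoC (besselK q) * z ^ (2 * half_up q - q)) _ _ HS1)].
    intros n. cbv beta. rewrite <- sumC_scal. apply sumC_ext; intros j _.
    unfold num_am1. rewrite Hzn. fold (zeta j). rewrite !C_derive_1_besselJ, HJ1, HJ1'.
    symmetry. exact (num_pair q (zeta j) (Fr1 q (r j)) z (Hzp j) (HF1 j) (Hne j)).
  - apply is_bisum_clim.
    eapply clim_ext; [|exact (clim_scal (RtoC (besselK q) ^ 2 * z ^ 2) _ _ HS2)].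
    intros n. cbv beta. rewrite <- sumC_scal. apply sumC_ext; intros j _.
    unfold den_am2, den_am1. rewrite Hzn. fold (zeta j).
    assert (P := Hzp j).
    rewrite !C_derive_1_besselJ, !C_derive_2_besselJ; try lra; try (rewrite HrN; apply Hr); [|apply Hr].
    symmetry. exact (den_pair q (zeta j) (Fr1 q (r j)) _ _ z (Hzp j) (HF1 j) (Hne j) (HJ1 j) (HJ1' j)).
  (* The denominator is the inverse of a nonzero number, hence nonzero; the final quotient is then
     [(1 / J) / (1 / J^2)]. *)
  - rewrite Hbot. intros E. apply C1_nz. rewrite <- (Cinv_r (besselJ q z ^ 2)), E by (apply Cpow_nz; auto). ring.
  - rewrite Htop, Hbot. field. auto.
Qed.
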